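(* Let $T>0$ and let $s(t)$, $t\in[-\tau,T]$, be the time-continuous BIM approximation with step size $h$ described in the context. For every $p>2$ there exists a constant $K_1=K_1(p)$, independent of $h$, such that $$E\Big(\sup_{-\tau\le t\le T}|s(t)|^p\Big)\le K_1 .$$ For $0<p\le2$ and every $t\in[-\tau,T]$, $$E|s(t)|^p\le \big(E[|s(t)|^3]\big)^{p/3}\le K_1^{p/3},$$ where in the latter bound $K_1=K_1(3)$.
   Context: Let $(\Omega,\mathcal F,P)$ be a complete probability space with a right-continuous filtration $\{\mathcal F_t\}_{t\ge0}$ such that $\mathcal F_0$ contains all $P$-null sets. Let $W$ be a standard Brownian motion and $N$ a Poisson process with intensity $\beta>0$ with respect to this filtration, and let $\tilde N(t)=N(t)-\beta t$. Let $\gamma,\lambda,\mu,\sigma,\tau>0$ and $\delta\ge 0$ be constants. The delay CIR model with jump is $$dS(t)=\lambda(\mu-S(t))\,dt+\sigma S(t-\tau)^{\gamma}\sqrt{S(t)}\,dW(t)+\delta S(t)\,d\tilde N(t),\ t\ge0,\qquad S(t)=\xi(t),\ t\in[-\tau,0],$$ where $\xi$ is an $\mathcal F_0$-measurable positive $C([-\tau,0];\mathbb R^+)$-valued random variable with $E[\sup_{-\tau\le t\le0}|\xi(t)|^p]<\infty$ for every $p>0$. Balanced implicit method (BIM): let $h=\tau/m\in(0,1)$ with $m$ a positive integer, $t_n=nh$, $\Delta W_n=W(t_{n+1})-W(t_n)$, $\Delta\tilde N_n=\tilde N(t_{n+1})-\tilde N(t_n)$. Set $s_n=\xi(t_n)$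 for $n=-m,\dots,0$, and for $n\ge0$ $$s_{n+1}=s_n+\lambda(\mu-s_n)h+\sigma s_{n-m}^{\gamma}\sqrt{s_n}\,\Delta W_n+\delta s_n\Delta\tilde N_n+C_n(s_n-s_{n+1}),$$ where $C_n=C_0h+C_1(s_n,s_{n-m})|\Delta W_n|+C_2|\Delta\tilde N_n|$. Here $C_0\ge\lambda$ and $C_2\ge\delta$ are positive constants and, for a fixed $\epsilon>0$, $$C_1(x,y)=\begin{cases}\sigma y^{\gamma}\epsilon^{-1/2}, & x<\epsilon,\\ \sigma y^{\gamma}/\sqrt{x}, & x\ge\epsilon.\end{cases}$$ When the argument $x$ is negative, $x^\gamma$ and $\sqrt{x}$ are read as $|x|^\gamma$ and $\sqrt{|x|}$. Step process: $\hat s(t)=\xi(t)$ for $-\tau\le t\le0$ and $\hat s(t)=s_n$ for $t\in[nh,(n+1)h)$, $n\ge 0$. For $r\in[t_k,t_{k+1})$ put $C_r=C_0h+C_1(\hat s(r),\hat s(r-\tau))|\Delta W_k|+C_2|\Delta\tilde N_k|$. Time-continuous approximation: $s(t)=\xi(t)$ for $-\tau\le t\le0$ and, for $t\ge0$, $$s(t)=\xi(0)+\lambda\int_0^t\frac{\mu-\hat s(r)}{1+C_r}dr+\sigma\int_0^t\frac{\hat s(r-\tau)^{\gamma}\sqrt{\hat s(r)}}{1+C_r}dW(r)+\delta\int_0^t\frac{\hat s(r)}{1+C_r}d\tilde N(r).$$ The integrals are understood interval by interval with the coefficients frozen at their mesh values: for $t\in[t_k,t_{k+1}]$, $$s(t)=s_k+\frac{\lambda(\mu-s_k)(t-t_k)+\sigma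 s_{k-m}^{\gamma}\sqrt{s_k}(W(t)-W(t_k))+\delta s_k(\tilde N(t)-\tilde N(t_k))}{1+C_k},$$ so that $s(nh)=s_n$. *)

(* Defs.v *)
From HB Require Import structures.
From mathcomp Require Import all_boot all_order all_algebra.
From mathcomp Require Import all_classical all_reals all_analysis.
Import Order.TTheory GRing.Theory Num.Theory.
Import numFieldNormedType.Exports.

Set Implicit Arguments.
Unset Strict Implicit.
Unset Printing Implicit Defensive.

Local Open Scope classical_set_scope.
Local Open Scope ring_scope.

Definition sup_pow {R : realType} {Omega : Type} (X : R -> Omega -> R)
    (a b p : R) (w : Omega) : \bar R :=
  ereal_sup [set (`|X t w| `^ p)%:E | t in `[a, b]].

Section processes.
Context {R : realType} {d : measure_display} {Omega : measurableType d}.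
Variable P : probability Omega R.

Definition measurable_wrt d' (E : measurableType d') (G : set (set Omega))
    (X : Omega -> E) : Prop :=
  preimage_set_system [set: Omega] X measurable `<=` G.

(* Only the sets F t with t >= 0 matter. *)
Record usual_filtration (F : R -> set (set Omega)) : Prop := {
  filtration_complete : measure_is_complete P ;
  filtration_sigma : forall t : R, 0 <= t -> sigma_algebra [set: Omega] (F t) ;
  filtration_sub : forall t : R, 0 <= t -> F t `<=` measurable ;
  filtration_mono : forall s t : R, 0 <= s -> s <= t -> F s `<=` F t ;
  filtration_right_continuous :
    forall t : R, 0 <= t -> F t = \bigcap_(s in [set s | t < s]) F s ;
  filtration_null : P.-negligible `<=` F 0 }.

Definition adapted d' (E : measurableType d') (F : R -> set (set Omega))
    (X : R -> Omega -> E) : Prop :=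
  forall t : R, 0 <= t -> measurable_wrt (F t) (X t).

Definition independent_increments (F : R -> set (set Omega))
    (X : R -> Omega -> R) : Prop :=
  forall s t : R, 0 <= s -> s < t ->
  forall (A : set Omega) (B : set R), F s A -> measurable B ->
    P (A `&` (X t \- X s) @^-1` B) = (P A * P ((X t \- X s)%R @^-1` B))%E.

Record brownian_motion (F : R -> set (set Omega)) (W : R -> Omega -> R)
    : Prop := {
  bm_adapted : adapted F W ;
  bm_start : {ae P, forall w, W 0 w = 0} ;
  bm_path : {ae P, forall w, {within `[0, +oo[, continuous (W ^~ w)}} ;
  bm_indep : independent_increments F W ;
  bm_law : forall s t : R, 0 <= s -> s < t -> forall B : set R, measurable B ->
    P ((W t \- W s) @^-1` B) = normal_prob 0 (Num.sqrt (t - s)) B }.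

Record poisson_process (F : R -> set (set Omega)) (beta : R)
    (N : R -> Omega -> nat) : Prop := {
  pp_adapted : adapted F N ;
  pp_start : {ae P, forall w, N 0 w = 0%N} ;
  pp_mono : {ae P, forall w, forall s t : R,
    0 <= s -> s <= t -> (N s w <= N t w)%N} ;
  pp_right_continuous : {ae P, forall w, forall t : R,
    0 <= t -> N s w @[s --> t^'+] --> N t w} ;
  pp_indep : independent_increments F (fun t w => (N t w)%:R) ;
  pp_law : forall s t : R, 0 <= s -> s < t -> forall k : nat,
    P [set w | N t w = (N s w + k)%N]
    = (poisson_pmf (beta * (t - s)) k)%:E }.

Definition compensated (beta : R) (N : R -> Omega -> nat) (t : R) (w : Omega)
    : R :=
  (N t w)%:R - beta * t.

(* An F0-measurable random element of C([-tau, 0]; ]0, +oo[): the Borel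
   sigma-algebra of C([-tau, 0]) is generated by the evaluation maps. *)
Record initial_segment (F0 : set (set Omega)) (tau : R) (xi : R -> Omega -> R)
    : Prop := {
  init_measurable : forall t : R, - tau <= t <= 0 -> measurable_wrt F0 (xi t) ;
  init_continuous : forall w, {within `[- tau, 0], continuous (xi ^~ w)} ;
  init_pos : forall w (t : R), - tau <= t <= 0 -> 0 < xi t w ;
  init_moments : forall p : R, 0 < p ->
    (\int[P]_w sup_pow xi (- tau) 0 p w < +oo)%E }.

End processes.

Section balanced_implicit_method.
Context {R : realType} {Omega : Type}.
Variables (lambda mu sigma gamma delta : R) (C0 C2 eps : R).

(* The convention x^gamma = |x|^gamma for x < 0 is built in; no absolute value
   is needed under the root, since x >= eps > 0 there. *)
Definition bim_C1 (x y : R) : R :=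
  if x < eps then sigma * `|y| `^ gamma * eps `^ (- 2^-1)
  else sigma * `|y| `^ gamma / Num.sqrt x.

Variables (W Nt : R -> Omega -> R) (xi : R -> Omega -> R).
Variables (h : R) (m : nat).

Definition mesh (n : int) : R := n%:~R * h.

Definition mesh_incr (Z : R -> Omega -> R) (n : nat) (w : Omega) : R :=
  Z (mesh n.+1) w - Z (mesh n) w.

(* C_n for the sequence s, where s is indexed by all n >= - m *)
Definition bim_C (s : int -> Omega -> R) (n : nat) (w : Omega) : R :=
  C0 * h
  + bim_C1 (s n%:Z w) (s (n%:Z - m%:Z) w) * `|mesh_incr W n w|
  + C2 * `|mesh_incr Nt n w|.

Record is_bim (s : int -> Omega -> R) : Prop := {
  bim_init : forall (n : int) w, - m%:Z <= n <= 0 -> s n w = xi (mesh n) w ;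
  bim_rec : forall (n : nat) w,
    s n.+1%:Z w = s n%:Z w + lambda * (mu - s n%:Z w) * h
      + sigma * `|s (n%:Z - m%:Z) w| `^ gamma * Num.sqrt `|s n%:Z w|
          * mesh_incr W n w
      + delta * s n%:Z w * mesh_incr Nt n w
      + bim_C s n w * (s n%:Z w - s n.+1%:Z w) }.

Record is_bim_approx (tau : R) (s : int -> Omega -> R) (S : R -> Omega -> R)
    : Prop := {
  approx_init : forall t w, - tau <= t <= 0 -> S t w = xi t w ;
  approx_step : forall (k : nat) t w, mesh k <= t <= mesh k.+1 ->
    S t w = s k%:Z w
      + (lambda * (mu - s k%:Z w) * (t - mesh k)
         + sigma * `|s (k%:Z - m%:Z) w| `^ gamma * Num.sqrt `|s k%:Z w|
             * (W t w - W (mesh k) w)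
         + delta * s k%:Z w * (Nt t w - Nt (mesh k) w))
        / (1 + bim_C s k w) }.

End balanced_implicit_method.

(* Main.v *)
From HB Require Import structures.
Require Import Defs.
From mathcomp Require Import all_boot all_order all_algebra.
From mathcomp Require Import all_classical all_reals all_analysis.
From mathcomp Require Import measurable_realfun.
From mathcomp Require Import ring lra zify.
Import Order.TTheory GRing.Theory Num.Theory.
Import numFieldNormedType.Exports.
Local Open Scope classical_set_scope.
Local Open Scope ring_scope.

(** Why the moments stay bounded.

    Write x for the current value s_k, y for the delayed value s_(k-m), and
    b = sigma |y|^gamma sqrt |x| for the diffusion coefficient.  The factor
    |y|^gamma may grow at any polynomial rate, but y lies one delay earlier:
    the argument runs over successive blocks of m mesh points and controls, on
    each block, the moments of every even order; on the next block the powers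
    of y then have bounded expectation, and in x the coefficients grow at most
    linearly.

    The denominator 1 + C of the scheme contains the increments of the same
    step, so b dW / (1 + C) is not centred.  It differs from b dW by
    b dW C / (1 + C), and b C_1 grows at most like sqrt |x| in x: the roots
    cancel for x >= eps, and C_1 does not depend on x for x < eps.  Hence
    b |dW| C is of second order in the increments and sqrt h, with a coefficient
    sublinear in x.  A Taylor expansion gives [one_step_le]: the
    N-th power of the new value is at most
    x^N + N x^(N-1) b dW + rho H, where rho is at most a multiple of
    1 + |x|^N + |y|^Q for some exponent Q, and H is a sum of h and of powers of
    the increments whose expectation is O(h).  The linear term has mean zero,
    by independence and by symmetry of the normal law ([expectation_step]), so
    that the moments obey a discrete Gronwall inequality with constants
    independent of h ([stopped_moment_step], [stopped_moment_bound]).  The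
    expectations are taken for the scheme stopped when it first leaves
    ]-L, L[, which makes the coefficient of dW bounded; the estimates do not
    depend on L.

    The maximum over the mesh is then reached without a maximal inequality.
    When the largest |s_i| lies between 2^j and 2^(j+1), the scheme stopped at
    level 2^j ends at or above 2^j in absolute value (unless the initial
    segment is already that large), so that the e-th power of the maximum is
    at most 2^e 2^(-j e) times the power 2e of that final value.
    Summation over j turns the moment bound for the stopped schemes, uniform in
    the level, into one for the maximum ([path_majorant_ge],
    [path_majorant_moment]).

    Between two mesh points the compensated jump term is harmless: N is
    nondecreasing, so its increment on a part of the step is controlled by the
    increment on the whole step, and delta times the latter is at most C
    because delta <= C_2.  What remains is a product of powers of 1 + |x|, of
    2 + |y|^c and of 1 + |W(t) - W(t_k)| ([approx_bound]); the last factor is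
    controlled by a running supremum of the Brownian path, whose moments come
    from chaining along dyadic grids ([ae_brownian_le_sup],
    [brownian_sup_moment]).  The bound at a fixed time for exponents below 3 is
    Lyapunov's inequality. *)

(** * Integrals of nonnegative functions *)

Section integration.
Context {d : measure_display} {T : measurableType d} {R : realType}.
Variable mu : {measure set T -> \bar R}.
Local Open Scope ereal_scope.

Import HBNNSimple.

(** The integral of a nonnegative function is a supremum over the simple
    functions below it, hence monotone for arbitrary integrands.  This is what
    allows suprema over a continuum of times to be integrated. *)
Lemma ge0_le_integral_pw (f g : T -> \bar R) :
  (forall x, 0 <= f x) -> (forall x, f x <= g x) ->
  \int[mu]_x f x <= \int[mu]_x g x.
Proof.
move=> f0 fg; rewrite !ge0_integralTE//; last first.
  by move=> x; exact: le_trans (f0 x) (fg x).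
apply: le_ereal_sup => _ /= [h hf <-]; exists h => //= x.
exact: le_trans (hf x) (fg x).
Qed.

(** Raising the majorant to +oo on the exceptional null set makes the
    inequality hold everywhere without changing the integral of the majorant. *)
Lemma ge0_le_integral_ae (f g : T -> \bar R) :
  measurable_fun [set: T] g ->
  (forall x, 0 <= f x) -> (forall x, 0 <= g x) ->
  {ae mu, forall x, f x <= g x} ->
  \int[mu]_x f x <= \int[mu]_x g x.
Proof.
move=> mg f0 g0 [A [mA muA0 fgA]].
pose g' x := if x \in A then +oo else g x.
have mg' : measurable_fun [set: T] g'.
  apply: measurable_fun_if => //=.
  - by apply: (measurable_fun_bool true); rewrite setTI preimage_mem_true.
  - exact: measurable_funTS.
have g'0 x : 0 <= g' x by rewrite /g'; case: ifP => // _; exact: leey.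
apply: (@le_trans _ _ (\int[mu]_x g' x)).
  apply: ge0_le_integral_pw => // x; rewrite /g'; case: ifPn => xA.
    exact: leey.
  apply: contrapT => nfg; move/negP: xA; apply; rewrite inE; exact: fgA.
rewrite (@ge0_ae_eq_integral _ _ _ mu setT g' g)//.
exists A; split => // x /= nxA; apply: contrapT => xA; apply: nxA => _.
by rewrite /g' memNset.
Qed.

Lemma ge0_integral_density (nu : {measure set T -> \bar R}) (p : T -> R)
    (f : T -> \bar R) :
  measurable_fun [set: T] p -> (forall x, (0 <= p x)%R) ->
  (forall A, measurable A -> nu A = \int[mu]_(x in A) (p x)%:E) ->
  measurable_fun [set: T] f -> (forall x, 0 <= f x) ->
  \int[nu]_x f x = \int[mu]_x (f x * (p x)%:E).
Proof.
move=> mp p0 nuE mf f0.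
have mpE : measurable_fun [set: T] (EFin \o p) by exact/measurable_EFinP.
have H (h : {nnsfun T >-> R}) :
    \int[nu]_x (h x)%:E = \int[mu]_x ((h x)%:E * (p x)%:E).
  under [LHS]eq_integral do rewrite fimfunE -fsumEFin//.
  rewrite [LHS]ge0_integral_fsum//; last 2 first.
    - by move=> r; exact/measurable_EFinP/measurableT_comp.
    - by move=> n x _; rewrite EFinM nnfun_muleindic_ge0.
  under [RHS]eq_integral.
    move=> x xD; rewrite fimfunE -fsumEFin// ge0_mule_fsuml; last first.
      by move=> r; rewrite EFinM nnfun_muleindic_ge0.
    over.
  rewrite [RHS]ge0_integral_fsum//; last 2 first.
    - move=> r; apply: emeasurable_funM => //.
      by apply/measurable_EFinP; apply/measurableT_comp.
    - by move=> n x _; rewrite mule_ge0 ?lee_fin ?p0 -?lee_fin ?EFinM ?nnfun_muleindic_ge0.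
  apply: eq_fsbigr => r _; rewrite integralZl_indic_nnsfun//=.
  under [RHS]eq_integral do rewrite EFinM -muleA.
  have [r0|r0] := leP 0%R r.
    rewrite [RHS]ge0_integralZl//; last 2 first.
    - apply: emeasurable_funM => //.
      exact/measurable_EFinP/measurable_indic.
    - by move=> x _; rewrite mule_ge0 ?lee_fin ?p0.
    congr (_ * _); rewrite integral_indic//= setIT nuE//.
    rewrite integral_mkcond/=; apply: eq_integral => x _.
    by rewrite patchE indicE; case: ifPn => _; rewrite ?mul1e ?mul0e.
  have -> : h @^-1` [set r] = set0 by exact: preimage_nnfun0.
  rewrite indic0/= integral0 mule0; apply/esym/integral0_eq => x _.
  by rewrite mul0e mule0.
pose f_ := nnsfun_approx measurableT mf.
transitivity (lim (\int[nu]_x (f_ n x)%:E @[n --> \oo])).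
  rewrite -monotone_convergence//=.
  - apply: eq_integral => ? /[!inE] xD; apply/esym/cvg_lim => //=.
    exact: cvg_nnsfun_approx.
  - by move=> n; exact/measurable_EFinP/measurable_funTS.
  - by move=> n ? _; rewrite lee_fin.
  - by move=> ? _ ? ? mn; rewrite lee_fin; exact/lefP/nd_nnsfun_approx.
rewrite (_ : (fun n => _) = fun n => \int[mu]_x ((f_ n x)%:E * (p x)%:E)).
  2: by apply/funext => n; exact: H.
rewrite -monotone_convergence//=.
- apply: eq_integral => x _; apply/cvg_lim => //=.
  by apply: cvgeZr => //; exact: cvg_nnsfun_approx.
- by move=> n; apply: emeasurable_funM => //; exact/measurable_EFinP.
- by move=> n ? _; rewrite mule_ge0 ?lee_fin.
- move=> x _ a b ab; apply: lee_wpmul2r; rewrite lee_fin//.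
  exact/lefP/nd_nnsfun_approx.
Qed.

End integration.

Section independence.
Context {d : measure_display} {T : measurableType d} {R : realType}.
Variable P : probability T R.
Local Open Scope ereal_scope.

Lemma integral_prob_cst (r : \bar R) : \int[P]__ r = r.
Proof. by rewrite integral_cst//= probability_setT mule1. Qed.

(** Independence says that the law of (X, Y) is the product law, so Tonelli's
    theorem factors the expectation. *)
Lemma ge0_integral_indep (X Y : T -> R) (f g : R -> R) :
  measurable_fun [set: T] X -> measurable_fun [set: T] Y ->
  (forall A B, measurable A -> measurable B ->
     P (X @^-1` A `&` Y @^-1` B) = P (X @^-1` A) * P (Y @^-1` B)) ->
  measurable_fun [set: R] f -> measurable_fun [set: R] g ->
  (forall x, 0 <= f x)%R -> (forall x, 0 <= g x)%R ->
  \int[P]_w (f (X w) * g (Y w))%:E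
    = \int[P]_w (f (X w))%:E * \int[P]_w (g (Y w))%:E.
Proof.
move=> mX mY XY mf mg f0 g0.
pose X' : {RV P >-> R} := HB.pack X (isMeasurableFun.Build _ _ _ _ _ mX).
pose Y' : {RV P >-> R} := HB.pack Y (isMeasurableFun.Build _ _ _ _ _ mY).
pose Z w := (X w, Y w).
have mZ : measurable_fun [set: T] Z by exact: measurable_fun_pair.
pose Z' : {RV P >-> (R * R)%type} := HB.pack Z (isMeasurableFun.Build _ _ _ _ _ mZ).
pose F (z : R * R) := (f z.1 * g z.2)%:E.
have mF : measurable_fun [set: R * R] F.
  by apply/measurable_EFinP; apply: measurable_funM; apply: measurableT_comp.
have F0 z : 0 <= F z by rewrite lee_fin mulr_ge0.
transitivity (\int[distribution P Z']_z F z).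
  by rewrite ge0_integral_distribution.
transitivity (\int[distribution P X' \x distribution P Y']_z F z).
  apply: eq_measure_integral => A mA _; apply/esym.
  apply: (@product_measure_unique _ _ _ _ _ (distribution P X')
    (distribution P Y') (distribution P Z')) => //.
rewrite fubini_tonelli1//= /fubini_F /F/=.
have mfE : measurable_fun [set: R] (fun x => (f x)%:E) by exact/measurable_EFinP.
have mgE : measurable_fun [set: R] (fun x => (g x)%:E) by exact/measurable_EFinP.
transitivity (\int[distribution P X']_x
    ((f x)%:E * \int[distribution P Y']_y (g y)%:E)).
  apply: eq_integral => x _; rewrite -ge0_integralZl//.
  - by move=> y _; rewrite lee_fin.
  - by rewrite lee_fin.
rewrite ge0_integralZr//; last 2 first.
- by move=> y _; rewrite lee_fin.
- by apply: integral_ge0 => y _; rewrite lee_fin.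
by congr (_ * _); apply: ge0_integral_distribution => // y; rewrite lee_fin.
Qed.

End independence.

(** * Moments of the normal and Poisson laws *)

Lemma exprn_le_expR {R : realType} (r : nat) (u : R) : 0 <= u ->
  u ^+ r <= r`!%:R * expR u.
Proof.
move=> u0; case: r => [|r].
  by rewrite !expr0 fact0 mul1r -[leLHS]expR0 ler_expR.
rewrite mulrC -ler_pdivrMr ?ltr0n ?fact_gt0//.
by apply: (le_trans _ (expR_ge1Dxn r u0)); rewrite lerDr.
Qed.

(** Doubling the standard deviation pays for a power of x: the quotient of the
    two densities is 2 exp (- u) with u = 3 x^2 / (8 sigma^2), and
    u^r exp (- u) <= r!.  Integrating gives the moments of the normal law
    with the correct power of sigma. *)
Lemma normal_pdf_moment_le {R : realType} (r : nat) (sigma x : R) :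
  0 < sigma ->
  x ^+ r.*2 * normal_pdf 0 sigma x
    <= 2 * (r`!%:R * 3 ^+ r) * sigma ^+ r.*2 * normal_pdf 0 (2 * sigma) x.
Proof.
move=> sigma0; set c := 2 * _ * _.
rewrite !normal_pdfE ?mulf_neq0 ?gt_eqF//.
rewrite /normal_fun !subr0.
have -> : normal_peak sigma = (2 * normal_peak (2 * sigma)).
  rewrite /normal_peak.
  have -> : ((2 * sigma) ^+ 2 * pi *+ 2 = 2 ^+ 2 * (sigma ^+ 2 * pi *+ 2)).
    by ring.
  by rewrite sqrtrM ?sqr_ge0// sqrtr_sqr ger0_norm// invfM mulrA divff ?mul1r.
set pk := normal_peak _; set E1 := expR _; set E2 := expR _.
have pk0 : (0 <= pk) by exact: normal_peak_ge0.
suff key : (x ^+ r.*2 * E1 <= r`!%:R * 3 ^+ r * sigma ^+ r.*2 * E2).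
  have pk2 : (0 <= 2 * pk) by rewrite mulr_ge0.
  have := ler_wpM2l pk2 key; congr (is_true (_ <= _)); last by rewrite /c; ring.
  by ring.
rewrite /E1 /E2 {pk pk0 E1 E2}.
have s20 : (0 < sigma ^+ 2) by rewrite exprn_gt0.
pose u := (3 * x ^+ 2 / (8 * sigma ^+ 2)).
have u0 : (0 <= u).
  by apply: divr_ge0; apply: mulr_ge0 => //; rewrite sqr_ge0.
have -> : (- x ^+ 2 / (sigma ^+ 2 *+ 2)
   = - u + - x ^+ 2 / ((2 * sigma) ^+ 2 *+ 2)).
  by rewrite /u; field; lra.
rewrite expRD mulrA ler_wpM2r ?expR_ge0// -mul2n exprM.
have -> : (x ^+ 2 = u * (8 / 3 * sigma ^+ 2)).
  by rewrite /u; field; lra.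
set E := expR (- u).
have Eu : (u ^+ r * E <= r`!%:R).
  by rewrite /E expRN ler_pdivrMr ?expR_gt0// exprn_le_expR.
have -> : ((u * (8 / 3 * sigma ^+ 2)) ^+ r * E
    = (u ^+ r * E) * ((8 / 3) ^+ r * sigma ^+ (2 * r))).
  by rewrite exprMn [(8 / 3 * _) ^+ _]exprMn -exprM mulrAC.
rewrite -(mulrA r`!%:R); apply: ler_pM => //.
- by rewrite mulr_ge0 ?exprn_ge0 ?expR_ge0.
- by rewrite mulr_ge0 ?exprn_ge0 ?ltW.
rewrite ler_wpM2r ?exprn_ge0 ?(ltW sigma0)//.
by rewrite lerXn2r ?nnegrE; lra.
Qed.

Section normal_moments.
Context {d : measure_display} {T : measurableType d} {R : realType}.
Variable P : probability T R.
Variables (X : T -> R) (sigma : R).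
Hypotheses (mX : measurable_fun [set: T] X) (sigma0 : 0 < sigma).
Hypothesis lawX : forall B, measurable B ->
  P (X @^-1` B) = normal_prob 0 sigma B.
Local Notation leb := (@lebesgue_measure R).
Local Open Scope ereal_scope.

Lemma ge0_integral_normal (f : R -> R) : measurable_fun [set: R] f ->
  (forall x, 0 <= f x)%R ->
  \int[P]_w (f (X w))%:E = \int[leb]_x (f x * normal_pdf 0 sigma x)%:E.
Proof.
move=> mf f0.
have mfE : measurable_fun [set: R] (fun x => (f x)%:E) by exact/measurable_EFinP.
have mX' : measurable_fun [set: T] (X : T -> measurableTypeR R) by exact: mX.
have mf' : measurable_fun [set: measurableTypeR R] (fun x => (f x)%:E).
  exact: mfE.
pose X' : {RV P >-> measurableTypeR R} :=
  HB.pack (X : T -> measurableTypeR R) (isMeasurableFun.Build _ _ _ _ _ mX').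
have -> : \int[P]_w (f (X w))%:E = \int[distribution P X']_x (f x)%:E.
  by rewrite (ge0_integral_distribution X' mf')// => x; rewrite lee_fin.
transitivity (\int[leb]_x ((f x)%:E * (normal_pdf 0 sigma x)%:E)) => //.
apply: (ge0_integral_density leb (distribution P X')) => //.
- exact: measurable_normal_pdf.
- exact: normal_pdf_ge0.
Qed.

Lemma normal_moment r :
  \int[P]_w (X w ^+ r.*2)%:E
    <= (2 * (r`!%:R * 3 ^+ r) * sigma ^+ r.*2)%:E.
Proof.
rewrite (ge0_integral_normal (fun x => (x ^+ r.*2)%R)); last 2 first.
- exact: measurable_funX.
- by move=> x; rewrite exprn_even_ge0// odd_double.
pose c := (2 * (r`!%:R * 3 ^+ r) * sigma ^+ r.*2)%R.
have c0 : (0 <= c)%R by rewrite !mulr_ge0 ?exprn_ge0// ltW.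
rewrite -/c; apply: (@le_trans _ _
    (\int[leb]_x (c%:E * (normal_pdf 0 (2 * sigma)%R x)%:E))).
  apply: ge0_le_integral_pw => x.
    by rewrite lee_fin mulr_ge0 ?normal_pdf_ge0// exprn_even_ge0// odd_double.
  by rewrite lee_fin; exact: normal_pdf_moment_le.
rewrite ge0_integralZl//; last 2 first.
- by apply/measurable_EFinP; exact: measurable_normal_pdf.
- by move=> x _; rewrite lee_fin normal_pdf_ge0.
by rewrite integral_normal_pdf mule1.
Qed.

(** Symmetry of the law in a form free of subtractions: the positive and the
    negative part have the same expectation. *)
Lemma normal_symmetric_mean :
  \int[P]_w (Num.max (X w) 0)%:E = \int[P]_w (Num.max (- X w) 0)%:E.
Proof.
rewrite (ge0_integral_normal (fun x => Num.max x 0%R)); last 2 first.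
- exact: measurable_maxr.
- by move=> x; rewrite le_max lexx orbT.
rewrite (ge0_integral_normal (fun x => Num.max (- x)%R 0%R)); last 2 first.
- by apply: measurable_maxr => //; exact: measurableT_comp.
- by move=> x; rewrite le_max lexx orbT.
set f := fun x => _.
have mf : measurable_fun [set: R] f.
  apply/measurable_EFinP; apply: measurable_funM => //.
    exact: measurable_maxr.
  exact: measurable_normal_pdf.
pose phi : measurableTypeR R -> measurableTypeR R := -%R.
have mphi : measurable_fun setT phi by exact: oppr_measurable.
transitivity (\int[leb]_(x in phi @^-1` setT) (f \o phi) x).
  rewrite -(ge0_integral_pushforward mphi leb measurableT mf)//.
    by apply: eq_measure_integral => //= A mA AS; exact/esym/lebesgue_measureN.
  move=> y _; rewrite lee_fin mulr_ge0 ?normal_pdf_ge0//.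
  by rewrite le_max lexx orbT.
rewrite preimage_setT; apply: eq_integral => x _.
by rewrite /f/= !normal_pdfE ?gt_eqF// /normal_fun !subr0 sqrrN.
Qed.

Lemma normal_pos_mean_lty : \int[P]_w (Num.max (X w) 0)%:E < +oo.
Proof.
apply: (@le_lt_trans _ _ (\int[P]_w (1%:E + (X w ^+ 2)%:E))).
  apply: ge0_le_integral_pw => w; first by rewrite lee_fin le_max lexx orbT.
  rewrite lee_fin; have := sqr_ge0 (X w - 1)%R; have := sqr_ge0 (X w).
  by case: (leP (X w) 0%R) => ?; nra.
rewrite ge0_integralD//; last 2 first.
- by move=> w _; rewrite lee_fin sqr_ge0.
- by apply/measurable_EFinP; exact: measurable_funX.
rewrite integral_prob_cst.
have h := normal_moment 1.
by rewrite lte_add_pinfty ?ltry// (le_lt_trans h)// ltry.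
Qed.

End normal_moments.

Lemma poisson_pmf_sum {R : realType} (r : R) : 0 < r ->
  (\sum_(k <oo) (poisson_pmf r k)%:E = 1)%E.
Proof.
move=> r0; have := @probability_setT _ _ _ (poisson_prob r 0).
rewrite /= /poisson_prob r0 => <-; rewrite nneseries_esumT//.
by move=> k; rewrite lee_fin poisson_pmf_ge0.
Qed.

(** All moments are O(h), since the term k = 0 vanishes and the others carry
    the factor (beta h)^k <= beta^k h.  Bounding k^q by q! e^k turns the sum
    into q! h times the exponential series with parameter e beta. *)
Lemma poisson_moment_le {R : realType} (q : nat) (beta h : R) :
  (0 < q)%N -> 0 < beta -> 0 < h -> h <= 1 ->
  (\sum_(k <oo) (k%:R ^+ q * poisson_pmf (beta * h) k)%:E
    <= (h * (q`!%:R * expR (expR 1 * beta)))%:E)%E.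
Proof.
move=> q0 b0 h0 h1; set e := expR 1.
have eb0 : 0 < e * beta by rewrite mulr_gt0 ?expR_gt0.
have c0 : 0 <= h * (q`!%:R * expR (e * beta)).
  by rewrite !mulr_ge0 ?expR_ge0// ltW.
rewrite -[leRHS]mule1 -(poisson_pmf_sum _ eb0) -nneseriesZl//; last first.
  by move=> k _; rewrite lee_fin poisson_pmf_ge0.
apply: lee_nneseries => k _.
  by rewrite lee_fin mulr_ge0 ?poisson_pmf_ge0 ?exprn_ge0.
rewrite -EFinM lee_fin; case: k => [|k].
  by rewrite expr0n gtn_eqF// mul0r !mulr_ge0 ?poisson_pmf_ge0 ?expR_ge0// ltW.
rewrite /poisson_pmf mulr_gt0// eb0.
have -> : h * (q`!%:R * expR (e * beta)) *
    ((e * beta) ^+ k.+1 * k.+1`!%:R^-1 * expR (- (e * beta)))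
  = (q`!%:R * e ^+ k.+1) * (beta ^+ k.+1 * k.+1`!%:R^-1 * h).
  rewrite exprMn expRN; set E := expR (e * beta).
  have E0 : E != 0 by rewrite gt_eqF// expR_gt0.
  move: (_^-1) (q`!%:R) (e ^+ _) (beta ^+ _) => a b u v; by field.
apply: ler_pM => //.
- by rewrite !mulr_ge0 ?expR_ge0 ?exprn_ge0 ?mulr_ge0// ltW.
- by rewrite /e -expRM_natl mulr1; apply: exprn_le_expR.
have -> : (beta * h) ^+ k.+1 * k.+1`!%:R^-1 * expR (- (beta * h))
  = beta ^+ k.+1 * k.+1`!%:R^-1 * (h ^+ k.+1 * expR (- (beta * h))).
  by rewrite exprMn; ring.
rewrite ler_wpM2l ?mulr_ge0 ?exprn_ge0 ?(ltW b0)//.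
rewrite exprS -mulrA ler_piMr ?(ltW h0)//.
rewrite mulr_ile1 ?exprn_ge0 ?expR_ge0 ?(ltW h0)//.
  by rewrite exprn_ile1 // ltW.
by rewrite expR_le1 oppr_le0 mulr_ge0 ?ltW.
Qed.

Set Implicit Arguments.
Unset Strict Implicit.
Unset Printing Implicit Defensive.

(** * Increments of the driving processes *)

Lemma normr_exprn_double {R : realType} (x : R) (n : nat) :
  `|x| ^+ n.*2 = x ^+ n.*2.
Proof. by rewrite -mul2n !exprM real_normK ?num_real. Qed.

(** No factor 2^q is lost because a and b have the same sign. *)
Lemma exprn_dist_le {R : realType} (q : nat) (a b : R) : 0 <= a -> 0 <= b ->
  `|a - b| ^+ q <= a ^+ q + b ^+ q.
Proof.
move=> a0 b0; have [ab|ab] : `|a - b| <= a \/ `|a - b| <= b.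
- by have [ba|ba] := leP b a;
    [left; rewrite ger0_norm|right; rewrite ltr0_norm]; lra.
- by rewrite (@le_trans _ _ (a ^+ q))// ?lerDl ?exprn_ge0// lerXn2r ?nnegrE.
- by rewrite (@le_trans _ _ (b ^+ q))// ?lerDr ?exprn_ge0// lerXn2r ?nnegrE.
Qed.

Lemma le_nneseries_term {R : realType} (u : nat -> \bar R) (k : nat) :
  (forall i, 0 <= u i)%E -> (u k <= \sum_(i <oo) u i)%E.
Proof.
by move=> u0; rewrite (@nneseriesD1 _ u k xpredT)// leeDl// nneseries_ge0.
Qed.

Section measurability.
Context {d : measure_display} {Omega : measurableType d} {R : realType}.
Implicit Types (G : set (set Omega)) (X : Omega -> R).

Lemma measurable_wrtP G X : sigma_algebra [set: Omega] G ->
  measurable_wrt G X <->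
  measurable_fun [set: g_sigma_algebraType G] (X : g_sigma_algebraType G -> R).
Proof.
move=> sG; split=> [h _ B mB|h _ [B mB <-]].
  by rewrite measurable_g_measurableTypeE//; apply: h; exists B.
by rewrite -[X in X _](measurable_g_measurableTypeE sG); exact: h.
Qed.

Lemma measurable_wrtT d' (E : measurableType d') G (X : Omega -> E) :
  G `<=` measurable -> measurable_wrt G X -> measurable_fun [set: Omega] X.
Proof. by move=> Gm h _ B mB; apply: Gm; apply: h; exists B. Qed.

Lemma measurable_wrtS d' (E : measurableType d') G G' (X : Omega -> E) :
  G `<=` G' -> measurable_wrt G X -> measurable_wrt G' X.
Proof. by move=> GG' h; exact: subset_trans h GG'. Qed.

End measurability.

Section noise.
Context {R : realType} {d : measure_display} {Omega : measurableType d}.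
Variables (P : probability Omega R) (F : R -> set (set Omega)).
Hypothesis hF : usual_filtration P F.
Local Open Scope ereal_scope.

Lemma adapted_measurable d' (E : measurableType d') (X : R -> Omega -> E) t :
  adapted F X -> (0 <= t)%R -> measurable_fun [set: Omega] (X t).
Proof.
move=> aX t0; apply: measurable_wrtT (aX t t0); exact: (filtration_sub hF t0).
Qed.

(** Conditioning on the past, in the only form used below: a function of the
    past and a function of the coming increment integrate to a product. *)
Lemma increment_integral (Z : R -> Omega -> R) (s t : R) (X : Omega -> R)
    (f g : R -> R) :
  independent_increments P F Z -> (0 <= s)%R -> (s < t)%R ->
  measurable_fun [set: Omega] (Z s) -> measurable_fun [set: Omega] (Z t) ->
  measurable_wrt (F s) X ->
  measurable_fun [set: R] f -> measurable_fun [set: R] g ->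
  (forall x, 0 <= f x)%R -> (forall x, 0 <= g x)%R ->
  \int[P]_w (f (X w) * g (Z t w - Z s w))%:E
    = \int[P]_w (f (X w))%:E * \int[P]_w (g (Z t w - Z s w))%:E.
Proof.
move=> iZ s0 st ms mt mX mf mg f0 g0.
apply: (@ge0_integral_indep _ _ _ P X (fun w => Z t w - Z s w)%R) => //.
- by apply: measurable_wrtT mX; exact: (filtration_sub hF s0).
- exact: measurable_funB.
move=> A B mA mB; apply: iZ => //; apply: mX; exists A => //.
by rewrite setTI.
Qed.

Section poisson.
Variables (beta : R) (N : R -> Omega -> nat).
Hypotheses (beta0 : (0 < beta)%R) (hN : poisson_process P F beta N).

Lemma measurable_poisson t : (0 <= t)%R ->
  measurable_fun [set: Omega] (fun w => (N t w)%:R : R).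
Proof.
move=> t0; apply: (measurableT_comp (f := fun n : nat => n%:R : R)) => //.
exact: (adapted_measurable (pp_adapted hN)).
Qed.

Lemma measurable_compensated t : (0 <= t)%R ->
  measurable_fun [set: Omega] (compensated beta N t).
Proof.
by move=> t0; apply: measurable_funB => //; exact: measurable_poisson.
Qed.

Lemma ae_poisson_mono (s t : R) : (0 <= s)%R -> (s <= t)%R ->
  {ae P, forall w, (N s w <= N t w)%N}.
Proof. by move=> s0 st; apply: filterS (pp_mono hN) => w; exact. Qed.

(** The events N(t) = N(s) + k exhaust the space only up to a null set, since
    the paths are nondecreasing almost surely; hence an almost everywhere
    comparison with the sum over k. *)
Lemma poisson_increment_moment (q : nat) (s t : R) : (0 < q)%N ->
  (0 <= s)%R -> (s < t)%R -> (t - s <= 1)%R ->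
  \int[P]_w (`|(N t w)%:R - (N s w)%:R| ^+ q)%:E
    <= ((t - s) * (q`!%:R * expR (expR 1 * beta)))%:E.
Proof.
move=> q0 s0 st ts1.
have t0 : (0 <= t)%R by exact: le_trans (ltW st).
pose A k := [set w | N t w = (N s w + k)%N].
have mA k : measurable (A k).
  have -> : A k = setT `&` (fun w => (N t w)%:R - (N s w)%:R : R)%R @^-1` [set k%:R%R].
    rewrite setTI; apply/seteqP; split=> w /=; rewrite /A/=.
      by move=> ->; rewrite natrD addrAC subrr add0r.
    by move=> /eqP; rewrite subr_eq -natrD eqr_nat addnC => /eqP.
  by apply: measurable_funB => //; exact: measurable_poisson.
pose g k w := (k%:R ^+ q * \1_(A k) w)%:E : \bar R.
have mg k : measurable_fun [set: Omega] (g k).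
  by apply/measurable_EFinP; apply: measurable_funM => //; exact: measurable_indic.
have g0 k w : 0 <= g k w by rewrite lee_fin mulr_ge0// exprn_ge0.
apply: (@le_trans _ _ (\int[P]_w (\sum_(k <oo) g k w))).
  apply: ge0_le_integral_ae => //.
  - exact: ge0_emeasurable_sum.
  - by move=> w; exact: nneseries_ge0.
  apply: filterS (ae_poisson_mono s0 (ltW st)) => w Nw.
  apply: le_trans (le_nneseries_term (N t w - N s w)%N (g0 ^~ w)).
  rewrite /g indicE mem_set/=; last by rewrite /A/= subnKC.
  by rewrite mulr1 natrB// ger0_norm ?subr_ge0 ?ler_nat.
rewrite integral_nneseries//.
apply: le_trans (poisson_moment_le q beta (t - s) q0 beta0 _ ts1); last by rewrite subr_gt0.
rewrite le_eqVlt; apply/orP; left; apply/eqP; apply: eq_eseriesr => k _.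
rewrite /g; under eq_integral do rewrite EFinM.
rewrite ge0_integralZl ?lee_fin ?exprn_ge0//.
- rewrite EFinM integral_indic// setIT; congr (_ * _); exact: (pp_law hN s0 st k).
- exact/measurable_EFinP/measurable_indic.
Qed.

Lemma compensated_moment (q : nat) (s t : R) : (0 < q)%N ->
  (0 <= s)%R -> (s < t)%R -> (t - s <= 1)%R ->
  \int[P]_w (`|compensated beta N t w - compensated beta N s w| ^+ q)%:E
    <= ((q`!%:R * expR (expR 1 * beta) + beta ^+ q) * (t - s))%:E.
Proof.
move=> q0 s0 st ts1; have t0 : (0 <= t)%R by exact: le_trans (ltW st).
have h0 : (0 <= t - s)%R by rewrite subr_ge0 ltW.
have mD : measurable_fun [set: Omega]
    (fun w => `|(N t w)%:R - (N s w)%:R : R| ^+ q)%R.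
  apply: measurable_funX; apply: measurableT_comp => //.
  by apply: measurable_funB; exact: measurable_poisson.
apply: (@le_trans _ _ (\int[P]_w ((`|(N t w)%:R - (N s w)%:R : R| ^+ q)%:E
     + ((beta * (t - s)) ^+ q)%:E))).
  apply: ge0_le_integral_ae.
  - by apply: emeasurable_funD => //; exact/measurable_EFinP.
  - by move=> w; rewrite lee_fin exprn_ge0.
  - by move=> w; rewrite adde_ge0 ?lee_fin ?exprn_ge0// mulr_ge0// ltW.
  apply: filterS (ae_poisson_mono s0 (ltW st)) => w Nw.
  rewrite -EFinD lee_fin /compensated.
  have -> : ((N t w)%:R - beta * t - ((N s w)%:R - beta * s)
     = ((N t w)%:R - (N s w)%:R) - beta * (t - s) :> R)%R by ring.
  rewrite [`|_ - (N s w)%:R|%R]ger0_norm ?subr_ge0 ?ler_nat//.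
  apply: exprn_dist_le; first by rewrite subr_ge0 ler_nat.
  by rewrite mulr_ge0// ltW.
rewrite ge0_integralD//; last 2 first.
- exact/measurable_EFinP.
- by move=> w _; rewrite lee_fin exprn_ge0// mulr_ge0// ltW.
rewrite integral_prob_cst mulrDl EFinD leeD//.
  by rewrite mulrC; exact: poisson_increment_moment.
rewrite lee_fin exprMn ler_wpM2l ?exprn_ge0 ?(ltW beta0)//.
by case: q q0 {mD} => // q _; rewrite exprS ler_piMr// exprn_ile1.
Qed.

End poisson.

Section brownian.
Variable W : R -> Omega -> R.
Hypothesis hW : brownian_motion P F W.

Lemma measurable_brownian t : (0 <= t)%R -> measurable_fun [set: Omega] (W t).
Proof. exact: (adapted_measurable (bm_adapted hW)). Qed.

Lemma brownian_moment (r : nat) (s t : R) : (0 <= s)%R -> (s < t)%R ->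
  \int[P]_w ((W t w - W s w) ^+ r.*2)%:E
    <= (2 * (r`!%:R * 3 ^+ r) * (t - s) ^+ r)%:E.
Proof.
move=> s0 st; have t0 : (0 <= t)%R by exact: le_trans (ltW st).
have h0 : (0 < t - s)%R by rewrite subr_gt0.
have -> : ((t - s) ^+ r = Num.sqrt (t - s) ^+ r.*2)%R.
  by rewrite -mul2n exprM sqr_sqrtr ?ltW.
apply: (@normal_moment _ _ _ P (fun w => W t w - W s w)%R (Num.sqrt (t - s)));
  rewrite ?sqrtr_gt0//.
- by apply: measurable_funB; exact: measurable_brownian.
- by move=> B mB; exact: (bm_law hW).
Qed.

Lemma brownian_symmetric (s t : R) : (0 <= s)%R -> (s < t)%R ->
  \int[P]_w (Num.max (W t w - W s w) 0)%:E
    = \int[P]_w (Num.max (- (W t w - W s w)) 0)%:E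
  /\ \int[P]_w (Num.max (W t w - W s w) 0)%:E < +oo.
Proof.
move=> s0 st; have t0 : (0 <= t)%R by exact: le_trans (ltW st).
have h0 : (0 < t - s)%R by rewrite subr_gt0.
have mX : measurable_fun [set: Omega] (fun w => W t w - W s w)%R.
  by apply: measurable_funB; exact: measurable_brownian.
split.
  apply: (@normal_symmetric_mean _ _ _ P (fun w => W t w - W s w)%R
    (Num.sqrt (t - s))); rewrite ?sqrtr_gt0//.
  by move=> B mB; exact: (bm_law hW).
apply: (@normal_pos_mean_lty _ _ _ P (fun w => W t w - W s w)%R
    (Num.sqrt (t - s))); rewrite ?sqrtr_gt0//.
by move=> B mB; exact: (bm_law hW).
Qed.

End brownian.
End noise.

(** * One step of the scheme: a pathwise inequality *)

Section one_step.
Context {R : realType}.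
Implicit Types x y d : R.

(** Second-order Taylor remainder, with exponents free of subtraction;
    induction on the exponent. *)
Lemma taylor2_exprn_le k x d :
  `|(x + d) ^+ k.+2 - x ^+ k.+2 - k.+2%:R * x ^+ k.+1 * d|
    <= k.+2%:R ^+ 2 * (`|x| + `|d|) ^+ k * d ^+ 2.
Proof.
elim: k => [|k IH].
  rewrite !expr0 mulr1 (_ : _ - _ = d ^+ 2); last by ring.
  rewrite ger0_norm ?sqr_ge0// ler_peMl ?sqr_ge0//.
  by rewrite -natrX ler1n.
set A := `|x| + `|d| in IH *; have A0 : 0 <= A by rewrite addr_ge0.
set f := (x + d) ^+ k.+2 - x ^+ k.+2 - k.+2%:R * x ^+ k.+1 * d in IH.
have -> : (x + d) ^+ k.+3 - x ^+ k.+3 - k.+3%:R * x ^+ k.+2 * d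
    = (x + d) * f + k.+2%:R * x ^+ k.+1 * d ^+ 2.
  by rewrite /f (exprS (x + d)) (exprS x k.+2) (exprS x k.+1) -(natr1 k.+2); ring.
apply: (le_trans (ler_normD _ _)).
have h1 : `|(x + d) * f| <= A * (k.+2%:R ^+ 2 * A ^+ k * d ^+ 2).
  by rewrite normrM ler_pM// ler_normD.
have h2 : `|k.+2%:R * x ^+ k.+1 * d ^+ 2| <= k.+2%:R * A ^+ k.+1 * d ^+ 2.
  rewrite normrM [`|d ^+ 2|]ger0_norm ?sqr_ge0// normrM normrX normr_nat.
  rewrite ler_wpM2r ?sqr_ge0// ler_wpM2l// lerXn2r ?nnegrE// lerDl//.
apply: (le_trans (lerD h1 h2)).
have -> : A * (k.+2%:R ^+ 2 * A ^+ k * d ^+ 2) + k.+2%:R * A ^+ k.+1 * d ^+ 2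
   = (k.+2%:R ^+ 2 + k.+2%:R) * (A ^+ k.+1 * d ^+ 2).
  by rewrite (exprS A); move: (k.+2%:R) (A ^+ k) => u v; ring.
rewrite -[leRHS]mulrA; apply: ler_wpM2r.
  by apply: mulr_ge0; rewrite ?sqr_ge0 ?exprn_ge0.
by rewrite -(natr1 k.+2); have : 0 <= k.+2%:R :> R by []; nra.
Qed.

Lemma exprnD_le (n : nat) x y : 0 <= x -> 0 <= y ->
  (x + y) ^+ n <= 2 ^+ n * (x ^+ n + y ^+ n).
Proof.
move=> x0 y0; wlog xy : x y x0 y0 / x <= y.
  move=> H; have [xy|yx] := leP x y; first exact: H.
  by rewrite addrC (addrC (x ^+ n)) H// ltW.
apply: (@le_trans _ _ ((2 * y) ^+ n)).
  by rewrite lerXn2r ?nnegrE ?addr_ge0 ?mulr_ge0//; lra.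
by rewrite exprMn ler_wpM2l ?exprn_ge0// lerDr exprn_ge0.
Qed.

Lemma exprnD_mul_le (k : nat) x d : 0 <= x -> 0 <= d ->
  (x + d) ^+ k * d ^+ 2 <= 2 ^+ k * (x ^+ k * d ^+ 2 + d ^+ k.+2).
Proof.
move=> x0 d0; have := exprnD_le k x0 d0 => h.
apply: (le_trans (ler_wpM2r (sqr_ge0 d) h)).
by rewrite -mulrA mulrDl -exprD addn2.
Qed.

(** Young's inequality up to a constant: the larger of A and B dominates. *)
Lemma young_exprn (n : nat) (A B : R) : 0 <= A -> 0 <= B ->
  A * B ^+ n <= A ^+ n.+1 + B ^+ n.+1.
Proof.
move=> A0 B0; have [AB|BA] := leP A B.
  rewrite (@le_trans _ _ (B ^+ n.+1))// ?lerDr ?exprn_ge0//.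
  by rewrite exprS ler_wpM2r ?exprn_ge0.
rewrite (@le_trans _ _ (A ^+ n.+1))// ?lerDl ?exprn_ge0//.
by rewrite exprS ler_wpM2l// lerXn2r ?nnegrE// ltW.
Qed.

Lemma exprn3D_le (n : nat) x y d : 0 <= x -> 0 <= y -> 0 <= d ->
  (x + y + d) ^+ n <= 4 ^+ n * (x ^+ n + y ^+ n + d ^+ n).
Proof.
move=> x0 y0 d0; apply: (le_trans (exprnD_le _ (addr_ge0 x0 y0) d0)).
have -> : 4 ^+ n = 2 ^+ n * 2 ^+ n :> R by rewrite -exprMn; congr (_ ^+ _); ring.
rewrite -[leRHS]mulrA ler_wpM2l ?exprn_ge0//.
have p21 : 1 <= 2 ^+ n :> R by rewrite exprn_ege1//; lra.
rewrite (mulrDr _ (_ + _)) lerD ?exprnD_le//.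
by rewrite ler_peMl ?exprn_ge0.
Qed.

Lemma sqr3D_le x y d : (x + y + d) ^+ 2 <= 3 * (x ^+ 2 + y ^+ 2 + d ^+ 2).
Proof.
by have := sqr_ge0 (x - y); have := sqr_ge0 (x - d); have := sqr_ge0 (y - d); nra.
Qed.

Let subsum_le (h n p q r s : R) :
  0 <= n -> 0 <= p -> 0 <= q -> 0 <= r -> 0 <= s ->
  h + p + r <= h + n + p + q + r + s /\ h + s + q <= h + n + p + q + r + s.
Proof. by move=> *; split; lra. Qed.

Let combine_le (X Y t u v w : R) :
  X - Y - t <= w -> t <= u + v -> X <= Y + u + (v + w).
Proof. by move=> *; lra. Qed.

Let double4 k : (2 * k.+2 = k.*2 + 4)%N. Proof. by lia. Qed.
Let double44 k : ((2 * k).+4 = 2 * k.+2)%N. Proof. by lia. Qed.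
Let double3 k : ((2 * k).+3 = k.*2 + 3)%N. Proof. by lia. Qed.
Let le_double3 k : (k.+2 <= k.*2 + 3)%N. Proof. by lia. Qed.
Let doublesq k : (k.+2 * (2 * k.+2) = 2 * k.+2 ^ 2)%N.
Proof. by rewrite mulnCA mulnn. Qed.

(** Constants of the three error terms [T1], [T2] and [T3] below, weighted by
    the coefficients of the Taylor bound. *)
Definition one_step_const (k : nat) (D : R) : R :=
  k.+2%:R * (3 * D ^+ 2)
  + k.+2%:R ^+ 2 * 2 ^+ k * (3 * D ^+ 2 + 4 ^+ k.+2 * D ^+ k.+2).

Lemma one_step_const_ge0 k D : 0 <= D -> 0 <= one_step_const k D.
Proof.
move=> D0; rewrite /one_step_const.
have DD m : 0 <= D ^+ m by exact: exprn_ge0.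
have K : 0 <= k.+2%:R :> R by [].
apply: addr_ge0.
  by apply: mulr_ge0 => //; exact: mulr_ge0.
apply: mulr_ge0; first by apply: mulr_ge0; exact: exprn_ge0.
by apply: addr_ge0; apply: mulr_ge0 => //; exact: exprn_ge0.
Qed.

(** The step in abstract form: drift a, diffusion b, jump coefficient j and
    denominator 1 + C, where c is the part of C multiplying the Brownian
    increment w, and n is the jump increment.  In the application g is
    sqrt (1 + |x|), so that powers of g measure growth in x by half-integers,
    and Z bounds the power of the delayed value. *)
Section bounds.
Variables (k : nat) (x g Z w n h D a b c j C : R).
Hypotheses (D1 : 1 <= D) (g1 : 1 <= g) (Z1 : 1 <= Z).
Hypotheses (h0 : 0 < h) (h1 : h <= 1) (c0 : 0 <= c).
Hypotheses (xg : `|x| <= g ^+ 2).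
Hypotheses (ag : `|a| <= D * g ^+ 2) (jg : `|j| <= D * g ^+ 2).
Hypotheses (bZ : `|b| <= D * (Z * g)) (bc : `|b| * c <= D * (Z ^+ 2 * g)).
Hypotheses (C0 : 0 <= C) (CD : C <= D * h + c * `|w| + D * `|n|).

Let D0 : 0 <= D. Proof. exact: le_trans D1. Qed.
Let g0 : 0 <= g. Proof. exact: le_trans g1. Qed.
Let Z0 : 0 <= Z. Proof. exact: le_trans Z1. Qed.
Let iC : 0 < 1 + C. Proof. by rewrite ltr_pwDl. Qed.
Let iC0 : 0 <= (1 + C)^-1. Proof. by rewrite invr_ge0 ltW. Qed.
Let iC1 : (1 + C)^-1 <= 1. Proof. by rewrite invf_le1// lerDl. Qed.
Let gk m : 0 <= g ^+ m. Proof. exact: exprn_ge0. Qed.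
Let Zk m : 0 <= Z ^+ m. Proof. exact: exprn_ge0. Qed.
Let nk m : 0 <= `|n| ^+ m. Proof. exact: exprn_ge0. Qed.
Let wk m : 0 <= `|w| ^+ m. Proof. exact: exprn_ge0. Qed.
Let D2 : D <= D ^+ 2. Proof. by rewrite expr2 ler_peMr. Qed.
Let D20 : 0 <= D ^+ 2. Proof. by rewrite exprn_ge0. Qed.
Let hh : h ^+ 2 <= h. Proof. by rewrite expr2 ler_piMl// ltW. Qed.

Let d := (a * h + b * w + j * n) / (1 + C).
Let e := d - b * w.

(** Products of two different increments are split into squares. *)
Let cross_le : `|w| * h + `|w| * `|n| <= h + `|w| ^+ 2 + `|n| ^+ 2.
Proof.
apply: (@le_trans _ _ (h ^+ 2 + `|w| ^+ 2 + `|n| ^+ 2)); last by rewrite !lerD2r.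
by have := sqr_ge0 (`|w| - h); have := sqr_ge0 (`|w| - `|n|); nra.
Qed.

(** The decisive estimate: in the product of b w with the denominator the
    factors b and c appear together, and b c grows only like g. *)
Let bwC : `|b| * `|w| * C
  <= 2 * D ^+ 2 * (Z ^+ 2 * g) * (h + `|w| ^+ 2 + `|n| ^+ 2).
Proof.
apply: (@le_trans _ _ (`|b| * `|w| * (D * h + c * `|w| + D * `|n|))).
  by rewrite ler_wpM2l// mulr_ge0.
have -> : `|b| * `|w| * (D * h + c * `|w| + D * `|n|)
    = `|b| * (D * (`|w| * h + `|w| * `|n|)) + `|b| * c * `|w| ^+ 2 by ring.
set S := h + _ + _.
have S0 : 0 <= S by rewrite !addr_ge0 ?(ltW h0).
rewrite (_ : 2 * _ * _ * S =
  D ^+ 2 * (Z ^+ 2 * g) * S + D ^+ 2 * (Z ^+ 2 * g) * S); last by ring.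
apply: lerD.
  apply: (@le_trans _ _ (D * (Z * g) * (D * S))).
    apply: ler_pM => //; last by rewrite ler_wpM2l.
    by rewrite mulr_ge0// addr_ge0// mulr_ge0// ltW.
  rewrite (_ : _ * (D * S) = D ^+ 2 * (Z * g) * S); last by ring.
  rewrite ler_wpM2r// ler_wpM2l// ler_wpM2r// expr2 ler_peMr//.
apply: ler_pM => //; first by rewrite mulr_ge0.
  by apply: (le_trans bc); rewrite ler_wpM2r ?mulr_ge0.
by rewrite /S addrAC lerDr addr_ge0// ltW.
Qed.

(** The increment without its martingale part b w is linear in h and n and
    quadratic in w. *)
Let e_le : `|e| <= D * g ^+ 2 * (h + `|n|)
    + 2 * D ^+ 2 * (Z ^+ 2 * g) * (h + `|w| ^+ 2 + `|n| ^+ 2).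
Proof.
have -> : e = (a * h + j * n) / (1 + C) - b * w * (C / (1 + C)).
  by rewrite /e /d; field; rewrite gt_eqF.
apply: (le_trans (ler_normB _ _)); apply: lerD.
  rewrite normrM (ger0_norm iC0).
  apply: (@le_trans _ _ (`|a * h + j * n|)); first by rewrite ler_piMr.
  apply: (le_trans (ler_normD _ _)); rewrite !normrM (ger0_norm (ltW h0)).
  by rewrite mulrDr lerD// ler_wpM2r// ltW.
rewrite !normrM (ger0_norm iC0) (ger0_norm C0).
by apply: le_trans bwC; rewrite ler_wpM2l ?mulr_ge0// ler_piMr.
Qed.

Let d_le : `|d| <= D * (g ^+ 2 * h + Z * g * `|w| + g ^+ 2 * `|n|).
Proof.
rewrite /d normrM (ger0_norm iC0).
apply: (@le_trans _ _ `|a * h + b * w + j * n|); first by rewrite ler_piMr.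
apply: (le_trans (ler_normD _ _)); rewrite !mulrDr; apply: lerD; last first.
  by rewrite normrM mulrA ler_wpM2r.
apply: (le_trans (ler_normD _ _)); apply: lerD.
  by rewrite normrM (ger0_norm (ltW h0)) mulrA ler_wpM2r// ltW.
by rewrite normrM mulrA ler_wpM2r.
Qed.

Let H := h + `|n| + `|n| ^+ 2 + `|n| ^+ k.+2 + `|w| ^+ 2 + `|w| ^+ k.+2.
Let A := g ^+ k.*2.
Let V := Z ^+ k.+2 * (A * g ^+ 3).
Let B := A * g ^+ 4 + V.

Let H0 : 0 <= H. Proof. by rewrite !addr_ge0 ?(ltW h0). Qed.
Let A0 : 0 <= A. Proof. exact: gk. Qed.
Let V0 : 0 <= V. Proof. by rewrite /V; do 2 apply: mulr_ge0 => //. Qed.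
Let Ag40 : 0 <= A * g ^+ 4. Proof. exact: mulr_ge0. Qed.
Let B0 : 0 <= B. Proof. exact: addr_ge0. Qed.
Let BA : A * g ^+ 4 <= B. Proof. by rewrite lerDl. Qed.
Let BV : V <= B. Proof. by rewrite lerDr. Qed.
Let Hhn : h + `|n| <= H. Proof. by rewrite /H -!addrA lerD2l lerDl !addr_ge0. Qed.
Let Hhn2w : h + `|n| ^+ 2 + `|w| ^+ 2 <= H.
Proof.
by case: (subsum_le h (normr_ge0 n) (nk 2) (nk k.+2) (wk 2) (wk k.+2)).
Qed.
Let HhwNnN : h + `|w| ^+ k.+2 + `|n| ^+ k.+2 <= H.
Proof.
by case: (subsum_le h (normr_ge0 n) (nk 2) (nk k.+2) (wk 2) (wk k.+2)).
Qed.

Let xk : `|x| ^+ k <= A.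
Proof. by rewrite /A -mul2n exprM lerXn2r ?nnegrE ?sqr_ge0. Qed.
Let xk1 : `|x| ^+ k.+1 <= A * g ^+ 2.
Proof. by rewrite exprSr ler_pM// exprn_ge0. Qed.
Let Ag3V : A * g ^+ 3 * Z ^+ 2 <= V.
Proof. by rewrite /V mulrC ler_wpM2r ?mulr_ge0// ler_weXn2l. Qed.

Let T1 : `|x| ^+ k.+1 * `|e| <= 3 * D ^+ 2 * (B * H).
Proof.
apply: (@le_trans _ _ (D * ((A * g ^+ 4) * (h + `|n|))
    + 2 * D ^+ 2 * ((A * g ^+ 3 * Z ^+ 2) * (h + `|n| ^+ 2 + `|w| ^+ 2)))).
  apply: (le_trans (ler_pM (exprn_ge0 k.+1 (normr_ge0 x)) (normr_ge0 e) xk1 e_le)).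
  rewrite le_eqVlt; apply/orP; left; apply/eqP.
  by move: (`|n|) (`|w|) => u v; ring.
have -> : 3 * D ^+ 2 * (B * H) = D ^+ 2 * (B * H) + 2 * D ^+ 2 * (B * H) by ring.
apply: lerD.
  apply: ler_pM => //; first by rewrite mulr_ge0// addr_ge0// ltW.
  by apply: ler_pM => //; rewrite addr_ge0// ltW.
apply: ler_wpM2l; first by rewrite mulr_ge0.
apply: ler_pM => //.
- by rewrite !mulr_ge0.
- by rewrite !addr_ge0// ltW.
- exact: le_trans BV.
Qed.

Let T2 : `|x| ^+ k * d ^+ 2 <= 3 * D ^+ 2 * (B * H).
Proof.
have dd : d ^+ 2 <= 3 * D ^+ 2
    * ((g ^+ 2 * h) ^+ 2 + (Z * g * `|w|) ^+ 2 + (g ^+ 2 * `|n|) ^+ 2).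
  move: d_le; set u := g ^+ 2 * h; set v := Z * g * `|w|; set y := g ^+ 2 * `|n|.
  move=> duvy; have -> : d ^+ 2 = `|d| ^+ 2 by rewrite real_normK ?num_real.
  apply: (@le_trans _ _ ((D * (u + v + y)) ^+ 2)).
    by rewrite lerXn2r ?nnegrE// mulr_ge0// !addr_ge0 ?mulr_ge0 ?(ltW h0).
  rewrite (_ : 3 * _ * _ = D ^+ 2 * (3 * (u ^+ 2 + v ^+ 2 + y ^+ 2))); last by ring.
  by rewrite exprMn ler_wpM2l// sqr3D_le.
apply: (le_trans (ler_pM _ _ xk dd)); rewrite ?sqr_ge0 ?exprn_ge0//.
rewrite mulrCA; apply: ler_wpM2l; first by rewrite mulr_ge0.
rewrite (_ : A * _ = A * g ^+ 4 * (h ^+ 2 + `|n| ^+ 2)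
   + A * g ^+ 2 * Z ^+ 2 * `|w| ^+ 2); last by ring.
apply: (@le_trans _ _ (B * (h + `|n| ^+ 2) + B * `|w| ^+ 2)).
  apply: lerD.
    by apply: ler_pM => //; [rewrite addr_ge0 ?sqr_ge0|rewrite lerD2r].
  apply: ler_wpM2r => //; apply: le_trans BV; apply: le_trans Ag3V.
  by rewrite ler_wpM2r// ler_wpM2l// ler_weXn2l.
by rewrite -mulrDr ler_wpM2l.
Qed.

Let T3 : `|d| ^+ k.+2 <= 4 ^+ k.+2 * D ^+ k.+2 * (B * H).
Proof.
move: d_le.
set u := g ^+ 2 * h; set v := Z * g * `|w|; set y := g ^+ 2 * `|n| => duvy.
have u0 : 0 <= u by rewrite mulr_ge0// ltW.
have v0 : 0 <= v by rewrite !mulr_ge0.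
have y0 : 0 <= y by rewrite mulr_ge0.
have dD : 0 <= D * (u + v + y) by rewrite mulr_ge0// !addr_ge0.
apply: (@le_trans _ _ ((D * (u + v + y)) ^+ k.+2)); first by rewrite lerXn2r.
rewrite exprMn (_ : 4 ^+ _ * _ * _ = D ^+ k.+2 * (4 ^+ k.+2 * (B * H)));
  last by rewrite -[LHS]mulrA mulrCA.
rewrite ler_wpM2l ?exprn_ge0//.
apply: (le_trans (exprn3D_le _ u0 v0 y0)); rewrite ler_wpM2l ?exprn_ge0//.
have Ag4E : (g ^+ 2) ^+ k.+2 = A * g ^+ 4.
  by rewrite /A -[LHS]exprM -[RHS]exprD double4.
apply: (@le_trans _ _ (B * h + B * `|w| ^+ k.+2 + B * `|n| ^+ k.+2)).
  rewrite /u /v /y (exprMn _ (g ^+ 2) h) (exprMn _ (Z * g)) (exprMn _ Z)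
    (exprMn _ (g ^+ 2) `|n|) Ag4E; apply: lerD; last by rewrite ler_wpM2r.
  apply: lerD.
    apply: ler_pM => //; first by rewrite exprn_ge0 ?ltW.
    by rewrite exprS ler_piMr ?(ltW h0)// exprn_ile1 ?(ltW h0).
  rewrite ler_wpM2r//; apply: le_trans BV; rewrite /V ler_wpM2l//.
  by rewrite /A -exprD ler_weXn2l// le_double3.
by rewrite -!mulrDr ler_wpM2l.
Qed.

(** Separates the two values: the mixed term V, of degree 2k + 3 in g, is one
    degree below the leading one, so Young's inequality leaves a pure power of
    g and a power of Z. *)
Let BY : B <= 2 * g ^+ (2 * k.+2) + Z ^+ (2 * k.+2 ^ 2).
Proof.
have E1 : A * g ^+ 4 = g ^+ (2 * k.+2).
  by rewrite /A -[LHS]exprD double4.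
have E2 : A * g ^+ 3 = g ^+ (2 * k).+3.
  by rewrite /A -[LHS]exprD double3.
have := young_exprn (2 * k).+3 (Zk k.+2) g0.
rewrite -exprM -E2 double44 doublesq.
rewrite -/V /B E1 mulr_natl mulr2n -addrA lerD2l => /le_trans; apply.
by rewrite addrC.
Qed.

(** Expand to second order around x, replace d by b w + e in the linear term,
    and bound the rest by B H. *)
Lemma one_step_le :
  (x + d) ^+ k.+2
    <= x ^+ k.+2 + k.+2%:R * x ^+ k.+1 * (b * w)
     + one_step_const k D
       * (2 * g ^+ (2 * k.+2) + Z ^+ (2 * k.+2 ^ 2))
       * (h + `|n| + `|n| ^+ 2 + `|n| ^+ k.+2 + `|w| ^+ 2 + `|w| ^+ k.+2).
Proof.
have tay := taylor2_exprn_le k x d.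
have /le_trans : (x + d) ^+ k.+2 <= x ^+ k.+2 + k.+2%:R * x ^+ k.+1 * (b * w)
    + (k.+2%:R * (`|x| ^+ k.+1 * `|e|)
    + k.+2%:R ^+ 2 * (2 ^+ k * (`|x| ^+ k * d ^+ 2 + `|d| ^+ k.+2))).
  have xe : k.+2%:R * x ^+ k.+1 * d
      <= k.+2%:R * x ^+ k.+1 * (b * w) + k.+2%:R * (`|x| ^+ k.+1 * `|e|).
    have {1}-> : d = b * w + e by rewrite /e addrC subrK.
    by rewrite mulrDr lerD2l -mulrA ler_wpM2l// -normrX -normrM ler_norm.
  have := ler_norm ((x + d) ^+ k.+2 - x ^+ k.+2 - k.+2%:R * x ^+ k.+1 * d).
  have d2 : d ^+ 2 = `|d| ^+ 2 by rewrite real_normK ?num_real.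
  have := exprnD_mul_le k (normr_ge0 x) (normr_ge0 d); rewrite -d2 => h2.
  have h3 := ler_wpM2l (sqr_ge0 (k.+2%:R : R)) h2.
  rewrite mulrA in h3.
  by move=> h4; exact: (combine_le (le_trans h4 (le_trans tay h3)) xe).
apply; rewrite lerD2l.
rewrite -/H; apply: (@le_trans _ _ (one_step_const k D * (B * H))).
  rewrite /one_step_const [leRHS]mulrDl; apply: lerD.
    by rewrite -mulrA ler_wpM2l.
  rewrite [leLHS]mulrA -[leRHS]mulrA; apply: ler_wpM2l.
    by apply: mulr_ge0; apply: exprn_ge0.
  by rewrite [leRHS]mulrDl; apply: lerD.
by rewrite -mulrA ler_wpM2l ?one_step_const_ge0// ler_wpM2r.
Qed.

End bounds.
End one_step.

(** * One step of the scheme: expectations *)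

Section expectation_step.
Context {R : realType} {d : measure_display} {Omega : measurableType d}.
Variables (P : probability Omega R) (F : R -> set (set Omega)).
Variables (beta : R) (N : R -> Omega -> nat) (W : R -> Omega -> R).
Hypotheses (hF : usual_filtration P F) (beta0 : 0 < beta).
Hypotheses (hN : poisson_process P F beta N) (hW : brownian_motion P F W).
Local Open Scope ereal_scope.

(** Constant of the q-th moment of a compensated Poisson increment. *)
Definition jump_const (q : nat) : R := q`!%:R * expR (expR 1 * beta) + beta ^+ q.

Definition noise_const (r : nat) : R :=
  1 + (jump_const 1 + jump_const 2 + jump_const r.+1.*2)
  + (6 + 2 * (r.+1`!%:R * 3 ^+ r.+1)).

Lemma jump_const_ge0 q : (0 <= jump_const q)%R.
Proof.
by apply: addr_ge0; [rewrite mulr_ge0// expR_ge0|rewrite exprn_ge0// ltW].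
Qed.

Lemma noise_const_ge0 r : (0 <= noise_const r)%R.
Proof.
apply: addr_ge0; last first.
  by apply: addr_ge0 => //; do 2 apply: mulr_ge0 => //; exact: exprn_ge0.
apply: addr_ge0 => //; apply: addr_ge0; last exact: jump_const_ge0.
by apply: addr_ge0; exact: jump_const_ge0.
Qed.

Variables (r : nat) (s t : R).
Hypotheses (s0 : (0 <= s)%R) (st : (s < t)%R) (ts1 : (t - s <= 1)%R).
Let t0 : (0 <= t)%R. Proof. exact: le_trans (ltW st). Qed.
Let h0 : (0 <= t - s)%R. Proof. by rewrite subr_ge0 ltW. Qed.
Let sF := filtration_sub hF s0.

Let dW w := (W t w - W s w)%R.
Let dN w := (compensated beta N t w - compensated beta N s w)%R.

Let mdW : measurable_fun [set: Omega] dW.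
Proof. by apply: measurable_funB; exact: (measurable_brownian hF hW). Qed.
Let mdN : measurable_fun [set: Omega] dN.
Proof. by apply: measurable_funB; exact: (measurable_compensated hF hN). Qed.

Let intW (X : Omega -> R) (f g : R -> R) : measurable_wrt (F s) X ->
  measurable_fun [set: R] f -> measurable_fun [set: R] g ->
  (forall x, 0 <= f x)%R -> (forall x, 0 <= g x)%R ->
  \int[P]_w (f (X w) * g (dW w))%:E
    = \int[P]_w (f (X w))%:E * \int[P]_w (g (dW w))%:E.
Proof.
move=> mX mf mg f0 g0; apply: (increment_integral hF (bm_indep hW)) => //;
  exact: (measurable_brownian hF hW).
Qed.

Let intN (X : Omega -> R) (f g : R -> R) : measurable_wrt (F s) X ->
  measurable_fun [set: R] f -> measurable_fun [set: R] g ->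
  (forall x, 0 <= f x)%R -> (forall x, 0 <= g x)%R ->
  \int[P]_w (f (X w) * g (dN w))%:E
    = \int[P]_w (f (X w))%:E * \int[P]_w (g (dN w))%:E.
Proof.
move=> mX mf mg f0 g0.
have dNE w : dN w = ((N t w)%:R - (N s w)%:R - beta * (t - s))%R.
  by rewrite /dN /compensated; ring.
under eq_integral do rewrite dNE.
under [X in _ = _ * X]eq_integral do rewrite dNE.
apply: (increment_integral (g := fun x => g (x - beta * (t - s))%R)
  hF (pp_indep hN)) => //; try exact: (measurable_poisson hF hN).
by apply: measurableT_comp => //; exact: measurable_funB.
Qed.

Let H w := (t - s + `|dN w| + `|dN w| ^+ 2 + `|dN w| ^+ r.+1.*2
  + dW w ^+ 2 + `|dW w| ^+ r.+1.*2)%R.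

(** H is a function of the coming increments, with expectation O(h); each of
    its terms involves a single driving process and can be separated from rho
    by independence. *)
Lemma noise_integral (rho : Omega -> R) : measurable_wrt (F s) rho ->
  (forall w, 0 <= rho w)%R ->
  \int[P]_w (rho w * H w)%:E
    <= (noise_const r * (t - s))%:E * \int[P]_w (rho w)%:E.
Proof.
move=> Frho rho0.
have mrho : measurable_fun [set: Omega] rho by exact: measurable_wrtT sF Frho.
(* Makes rho a nonnegative function of itself, as the product rule asks. *)
pose f (x : R) := Num.max x 0%R.
have frho w : f (rho w) = rho w by rewrite /f max_l.
have mf : measurable_fun [set: R] f by exact: measurable_maxr.
have f0 x : (0 <= f x)%R by rewrite le_max lexx orbT.
pose phi (x : R) := (`|x| + `|x| ^+ 2 + `|x| ^+ r.+1.*2)%R.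
pose psi (x : R) := (x ^+ 2 + `|x| ^+ r.+1.*2)%R.
have mnX q : measurable_fun [set: R] (fun x : R => `|x| ^+ q)%R.
  by apply: measurable_funX; exact: normr_measurable.
have mphi : measurable_fun [set: R] phi.
  by apply: measurable_funD => //; apply: measurable_funD.
have mpsi : measurable_fun [set: R] psi by exact: measurable_funD.
have phi0 x : (0 <= phi x)%R by rewrite !addr_ge0// exprn_ge0.
have psi0 x : (0 <= psi x)%R by rewrite addr_ge0// ?sqr_ge0// exprn_ge0.
have -> : \int[P]_w (rho w * H w)%:E
  = \int[P]_w (((t - s)%:E * (rho w)%:E + (rho w * phi (dN w))%:E)
      + (rho w * psi (dW w))%:E).
  by apply: eq_integral => w _; rewrite -EFinM -!EFinD /H /phi /psi; congr EFin; ring.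
have Erho0 : 0 <= \int[P]_w (rho w)%:E by apply: integral_ge0 => w _; rewrite lee_fin.
rewrite ge0_integralD//; last 4 first.
- by move=> w _; rewrite adde_ge0// -?EFinM lee_fin mulr_ge0.
- apply/measurable_EFinP; apply: measurable_funD.
    exact: measurable_funM.
  by apply: measurable_funM => //; apply: measurableT_comp.
- by move=> w _; rewrite lee_fin mulr_ge0.
- apply/measurable_EFinP; apply: measurable_funM => //.
  exact: measurableT_comp.
rewrite ge0_integralD//; last 4 first.
- by move=> w _; rewrite -EFinM lee_fin mulr_ge0.
- by apply/measurable_EFinP; exact: measurable_funM.
- by move=> w _; rewrite lee_fin mulr_ge0.
- apply/measurable_EFinP; apply: measurable_funM => //.
  exact: measurableT_comp.
rewrite ge0_integralZl//; last 2 first.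
- exact/measurable_EFinP.
- by move=> w _; rewrite lee_fin.
have IN : \int[P]_w (rho w * phi (dN w))%:E
    <= \int[P]_w (rho w)%:E
       * ((jump_const 1 + jump_const 2 + jump_const r.+1.*2) * (t - s))%:E.
  under eq_integral do rewrite -frho.
  rewrite intN//; under eq_integral do rewrite frho.
  apply: lee_wpmul2l => //.
  rewrite /phi; under eq_integral do rewrite !EFinD.
  have mE q : measurable_fun [set: Omega] (fun w => (`|dN w| ^+ q)%:E).
    apply/measurable_EFinP; exact: (measurableT_comp (mnX q) mdN).
  have pE q w : 0 <= (`|dN w| ^+ q)%:E by rewrite lee_fin exprn_ge0.
  rewrite ge0_integralD//; last 2 first.
  - by move=> w _; rewrite adde_ge0// (pE 1%N).
  - by apply: emeasurable_funD => //; exact: (mE 1%N).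
  rewrite ge0_integralD//; last exact: (mE 1%N).
  rewrite (mulrDl (_ + _)%R) (mulrDl (jump_const 1)) !EFinD.
  apply: leeD; first apply: leeD.
  - rewrite (eq_integral (fun w => (`|dN w| ^+ 1)%:E)); last first.
      by move=> w _; rewrite expr1.
    exact: (compensated_moment hF beta0 hN (q := 1)).
  - exact: (compensated_moment hF beta0 hN (q := 2)).
  - exact: (compensated_moment hF beta0 hN (q := r.+1.*2)).
have IW : \int[P]_w (rho w * psi (dW w))%:E
    <= \int[P]_w (rho w)%:E * ((6 + 2 * (r.+1`!%:R * 3 ^+ r.+1)) * (t - s))%:E.
  under eq_integral do rewrite -frho.
  rewrite intW//; under eq_integral do rewrite frho.
  apply: lee_wpmul2l => //.
  rewrite /psi; under eq_integral do rewrite EFinD.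
  rewrite ge0_integralD//; last 3 first.
  - by move=> w _; rewrite lee_fin sqr_ge0.
  - by apply/measurable_EFinP; exact: measurable_funX.
  - by apply/measurable_EFinP; exact: (measurableT_comp (mnX _) mdW).
  rewrite mulrDl EFinD; apply: leeD.
    apply: (le_trans (brownian_moment hF hW 1 s0 st)).
    by rewrite lee_fin !expr1 (_ : 1`! = 1)%N// mul1r -natrM.
  apply: (@le_trans _ _ (2 * (r.+1`!%:R * 3 ^+ r.+1) * (t - s) ^+ r.+1)%:E).
    apply: le_trans (brownian_moment hF hW r.+1 s0 st).
    rewrite le_eqVlt; apply/orP; left; apply/eqP; apply: eq_integral => w _.
    by congr EFin; rewrite -mul2n !exprM real_normK ?num_real.
  rewrite lee_fin ler_wpM2l ?mulr_ge0 ?exprn_ge0//.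
  by rewrite exprS ler_piMr// exprn_ile1.
rewrite /noise_const; set J := (_ + jump_const r.+1.*2)%R; set G := (6 + _)%R.
have J0 : (0 <= J)%R.
  by apply: addr_ge0; [apply: addr_ge0|]; exact: jump_const_ge0.
have G0 : (0 <= G)%R.
  by apply: addr_ge0 => //; do 2 apply: mulr_ge0 => //; exact: exprn_ge0.
have -> : ((1 + J + G) * (t - s))%:E
    = (t - s)%:E + (J * (t - s))%:E + (G * (t - s))%:E.
  by rewrite -!EFinD !(mulrDl _ _ (t - s)%R) mul1r.
have J1 : 0 <= (J * (t - s))%:E by rewrite lee_fin mulr_ge0.
have G1 : 0 <= (G * (t - s))%:E by rewrite lee_fin mulr_ge0.
rewrite ge0_muleDl ?adde_ge0// ge0_muleDl//.
apply: leeD; last by rewrite muleC.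
by rewrite leeD2l// muleC.
Qed.

(** The linear term f dW averages out.  Its expectation cannot be split off
    directly from an inequality between nonnegative functions, so f and dW are
    written as differences of positive and negative parts and the two negative
    products are moved to the left-hand side.  The symmetry of dW makes both
    sides gain the same amount, which is finite because f is bounded, and
    which can be cancelled. *)
Lemma expectation_step (v' v f rho : Omega -> R) (M : R) :
  measurable_fun [set: Omega] v' -> measurable_fun [set: Omega] v ->
  measurable_wrt (F s) f -> measurable_wrt (F s) rho ->
  (forall w, 0 <= v' w)%R -> (forall w, 0 <= v w)%R ->
  (forall w, 0 <= rho w)%R -> (forall w, `|f w| <= M)%R ->
  (forall w, v' w <= v w + f w * dW w + rho w * H w)%R ->
  \int[P]_w (v' w)%:E
    <= \int[P]_w (v w)%:E + (noise_const r * (t - s))%:E * \int[P]_w (rho w)%:E.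
Proof.
move=> mv' mv Ff Frho v'0 v0 rho0 fM hv.
have mf : measurable_fun [set: Omega] f by exact: measurable_wrtT sF Ff.
have mrho : measurable_fun [set: Omega] rho by exact: measurable_wrtT sF Frho.
pose p (x : R) := Num.max x 0%R; pose q (x : R) := Num.max (- x)%R 0%R.
have mp : measurable_fun [set: R] p by exact: measurable_maxr.
have mq : measurable_fun [set: R] q.
  by apply: measurable_maxr => //; exact: measurableT_comp.
have p0 x : (0 <= p x)%R by rewrite le_max lexx orbT.
have q0 x : (0 <= q x)%R by rewrite le_max lexx orbT.
have pqE x : x = (p x - q x)%R.
  rewrite /p /q; case: (leP x 0%R) => x0; case: (leP (- x)%R 0%R) => x1; lra.
have mpq (a b : R -> R) : measurable_fun [set: R] a -> measurable_fun [set: R] b ->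
    measurable_fun [set: Omega] (fun w => (a (f w) * b (dW w))%:E).
  move=> ma mb; apply/measurable_EFinP.
  by apply: measurable_funM; apply: measurableT_comp.
have [sym mlt] := brownian_symmetric hF hW s0 st.
set mW := \int[P]_w (p (dW w))%:E in sym mlt.
have mW0 : 0 <= mW by apply: integral_ge0 => w _; rewrite lee_fin.
have Ipp : \int[P]_w (p (f w) * p (dW w))%:E = \int[P]_w (p (f w))%:E * mW.
  exact: intW.
have Ipq : \int[P]_w (p (f w) * q (dW w))%:E = \int[P]_w (p (f w))%:E * mW.
  by rewrite sym; exact: intW.
have Iqp : \int[P]_w (q (f w) * p (dW w))%:E = \int[P]_w (q (f w))%:E * mW.
  exact: intW.
have Iqq : \int[P]_w (q (f w) * q (dW w))%:E = \int[P]_w (q (f w))%:E * mW.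
  by rewrite sym; exact: intW.
have fin (a : R -> R) : (forall x, 0 <= a x)%R -> (forall x, a x <= `|x|)%R ->
    \int[P]_w (a (f w))%:E * mW \is a fin_num.
  move=> a0 aM; have I0 : 0 <= \int[P]_w (a (f w))%:E.
    by apply: integral_ge0 => w _; rewrite lee_fin.
  rewrite fin_numM// ge0_fin_numE//.
  apply: (@le_lt_trans _ _ (\int[P]__ M%:E)); last first.
    by rewrite integral_prob_cst ltry.
  apply: ge0_le_integral_pw => w; rewrite lee_fin//.
  exact: le_trans (aM _) (fM w).
have px x : (p x <= `|x|)%R by rewrite ge_max ler_norm normr_ge0.
have qx x : (q x <= `|x|)%R by rewrite ge_max -normrN ler_norm normr_ge0.
have c1 := fin _ p0 px; have c2 := fin _ q0 qx.
have dW' : measurable_fun [set: Omega] (fun w => `|dN w|)%R by exact: measurableT_comp.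
have mH : measurable_fun [set: Omega] H.
  apply: measurable_funD; last exact/measurable_funX/measurableT_comp.
  apply: measurable_funD; last exact: measurable_funX.
  apply: measurable_funD; last exact: measurable_funX.
  apply: measurable_funD; last exact: measurable_funX.
  exact: measurable_funD.
have H0 w : (0 <= H w)%R.
  by rewrite /H; do ?apply: addr_ge0 => //; rewrite ?sqr_ge0 ?exprn_ge0.
set K := _ * \int[P]_w (rho w)%:E.
have key : \int[P]_w (v' w)%:E
    + (\int[P]_w (p (f w))%:E * mW + \int[P]_w (q (f w))%:E * mW)
  <= (\int[P]_w (v w)%:E + K)
    + (\int[P]_w (p (f w))%:E * mW + \int[P]_w (q (f w))%:E * mW).
  apply: (@le_trans _ _ (\int[P]_w (v w)%:E + \int[P]_w (rho w * H w)%:E +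
      (\int[P]_w (p (f w))%:E * mW + \int[P]_w (q (f w))%:E * mW))); last first.
    by rewrite leeD2r// leeD2l//; exact: noise_integral.
  rewrite -{1}Ipq -{1}Iqp -Ipp -Iqq.
  have m2 a b a' b' := fun ma mb ma' mb' =>
    @emeasurable_funD _ _ _ _ _ _ (mpq a b ma mb) (mpq a' b' ma' mb').
  have g2 (a b a' b' : R -> R) : (forall x, 0 <= a x)%R -> (forall x, 0 <= b x)%R ->
      (forall x, 0 <= a' x)%R -> (forall x, 0 <= b' x)%R ->
      forall w, 0 <= (a (f w) * b (dW w))%:E + (a' (f w) * b' (dW w))%:E.
    by move=> *; rewrite -EFinD lee_fin addr_ge0// mulr_ge0.
  have g1 (a b : R -> R) : (forall x, 0 <= a x)%R -> (forall x, 0 <= b x)%R ->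
      forall w, [set: Omega] w -> 0 <= (a (f w) * b (dW w))%:E.
    by move=> *; rewrite lee_fin mulr_ge0.
  have mv'E : measurable_fun [set: Omega] (EFin \o v') by exact/measurable_EFinP.
  have mvE : measurable_fun [set: Omega] (EFin \o v) by exact/measurable_EFinP.
  have mrH : measurable_fun [set: Omega] (fun w => (rho w * H w)%:E).
    by apply/measurable_EFinP; exact: measurable_funM.
  have rH0 w : 0 <= (rho w * H w)%:E by rewrite lee_fin mulr_ge0.
  rewrite -!ge0_integralD//; try exact: m2; try exact: mpq; try exact: g1;
    try (by move=> w _; exact: g2); try (by move=> w _; rewrite lee_fin);
    try (by apply: emeasurable_funD);
    try (by move=> w _; rewrite adde_ge0// lee_fin).
  apply: ge0_le_integral_pw => w.
    by rewrite -!EFinD lee_fin; do ?apply: addr_ge0 => //; exact: mulr_ge0.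
  rewrite -!EFinD lee_fin.
  have := hv w; rewrite [in X in X -> _](pqE (f w)) [in X in X -> _](pqE (dW w)).
  move: (p (f w)) (q (f w)) (p (dW w)) (q (dW w)) => a b a' b' hv'.
  rewrite -subr_ge0; rewrite -subr_ge0 in hv'.
  by apply: le_trans hv' _; rewrite le_eqVlt; apply/orP; left; apply/eqP; ring.
by rewrite leeD2rE ?fin_numD ?c1 ?c2 in key.
Qed.

End expectation_step.

(** * The scheme on the mesh *)

Lemma powR_le1D_exprn {R : realType} (a y : R) (n : nat) :
  0 <= a -> a <= n%:R -> 0 <= y -> y `^ a <= 1 + y ^+ n.
Proof.
move=> a0 an y0; have [y1|y1] := leP y 1.
  apply: (@le_trans _ _ 1); last by rewrite lerDl exprn_ge0.
  have := @ge0_ler_powR _ a a0 y 1; rewrite !nnegrE powR1; exact.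
apply: (@le_trans _ _ (y `^ n%:R)); last by rewrite powR_mulrn// lerDr.
by apply: ler_powR => //; exact: ltW.
Qed.

Lemma measurable_sqrt {R : realType} : measurable_fun [set: R] (@Num.sqrt R).
Proof.
by apply: continuous_measurable_fun; exact: sqrt_continuous.
Qed.

(** On [0, +oo[ the inverse is the power of exponent -1. *)
Lemma measurable_funV_ge0 {R : realType} d (T : measurableType d) (f : T -> R) :
  (forall x, 0 <= f x) -> measurable_fun [set: T] f ->
  measurable_fun [set: T] (fun x => (f x)^-1).
Proof.
move=> f0 mf.
have -> : (fun x => (f x)^-1) = fun x => f x `^ (-1).
  by apply/funext => x; rewrite powR_inv1.
exact: (measurableT_comp (measurable_powR _) mf).
Qed.

Lemma shift_int_bounds (i m : nat) : (i <= m)%N ->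
  - m%:Z <= i%:Z - m%:Z <= 0.
Proof. by lia. Qed.

Section bim.
Context {R : realType} {d : measure_display} {Omega : measurableType d}.
Variables (P : probability Omega R) (F : R -> set (set Omega)).
Variables (W : R -> Omega -> R) (N : R -> Omega -> nat) (xi : R -> Omega -> R).
Variables (beta gamma lambda mu sigma tau delta C0 C2 eps : R).
Hypotheses (hbeta : 0 < beta) (hgamma : 0 < gamma) (hlambda : 0 < lambda).
Hypotheses (hmu : 0 < mu) (hsigma : 0 < sigma) (htau : 0 < tau).
Hypotheses (hdelta : 0 <= delta) (hC0 : 0 < C0) (hC2 : 0 < C2).
Hypothesis heps : 0 < eps.
Hypotheses (hF : usual_filtration P F) (hW : brownian_motion P F W).
Hypothesis hN : poisson_process P F beta N.
Hypothesis hxi : initial_segment P (F 0) tau xi.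

Let Nt := compensated beta N.

(** One constant serving in all the coefficient bounds of [one_step_le]. *)
Definition bim_bound : R := 1 + lambda * (mu + 1) + delta + sigma
  + sigma ^+ 2 + sigma ^+ 2 * eps `^ (- 2^-1) + C0 + C2.

Let epsV0 : 0 <= eps `^ (- 2^-1). Proof. exact: powR_ge0. Qed.

Lemma bim_bound_ge :
  [/\ 1 <= bim_bound, lambda * (mu + 1) <= bim_bound, delta <= bim_bound
    & sigma <= bim_bound] /\
  [/\ sigma ^+ 2 <= bim_bound, sigma ^+ 2 * eps `^ (- 2^-1) <= bim_bound,
     C0 <= bim_bound & C2 <= bim_bound].
Proof.
have l0 : 0 <= lambda * (mu + 1) by rewrite mulr_ge0 ?addr_ge0// ltW.
have s2 : 0 <= sigma ^+ 2 by rewrite sqr_ge0.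
have s3 : 0 <= sigma ^+ 2 * eps `^ (- 2^-1) by rewrite mulr_ge0.
rewrite /bim_bound; set a := lambda * _ in l0 *; set b := _ * eps `^ _ in s3 *.
by split; split; move: l0 s2 s3 hdelta hsigma hC0 hC2 => *; lra.
Qed.

Lemma bim_C1_ge0 x y : 0 <= bim_C1 sigma gamma eps x y.
Proof.
rewrite /bim_C1; case: ifP => _.
  by rewrite !mulr_ge0 ?powR_ge0// ltW.
by rewrite !mulr_ge0 ?powR_ge0 ?invr_ge0 ?sqrtr_ge0// ltW.
Qed.

(** An even integer above gamma, so that delayed powers are again even moments
    of the scheme. *)
Definition delay_exp : nat := (Num.truncn gamma).+1.*2.

Lemma delay_exp_ge : gamma <= delay_exp%:R.
Proof.
rewrite /delay_exp; apply: (@le_trans _ _ (Num.truncn gamma).+1%:R).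
  exact/ltW/truncnS_gt.
by rewrite ler_nat -addnn leq_addr.
Qed.

(** Integer-power substitute for |y|^gamma, bounded below by 1. *)
Definition delay_factor (y : R) : R := 2 + `|y| ^+ delay_exp.

Lemma delay_factor_ge1 y : 1 <= delay_factor y.
Proof. by have := exprn_ge0 delay_exp (normr_ge0 y); rewrite /delay_factor; lra. Qed.

Lemma powR_le_delay_factor y : `|y| `^ gamma <= delay_factor y.
Proof.
apply: (le_trans (powR_le1D_exprn (ltW hgamma) delay_exp_ge (normr_ge0 y))).
by rewrite /delay_factor; lra.
Qed.

Section path_step.
Variables (x y w n h : R).
Hypotheses (h0 : 0 < h) (h1 : h <= 1).
Let g := Num.sqrt (1 + `|x|).
Let Z := delay_factor y.
Let b := sigma * `|y| `^ gamma * Num.sqrt `|x|.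
Let c := bim_C1 sigma gamma eps x y.
Let C := C0 * h + c * `|w| + C2 * `|n|.

Let g2 : g ^+ 2 = 1 + `|x|. Proof. by rewrite sqr_sqrtr// addr_ge0. Qed.
Let g1 : 1 <= g.
Proof. by rewrite -[leLHS]sqrtr1 ler_wsqrtr// lerDl. Qed.
Let sx : Num.sqrt `|x| <= g. Proof. by rewrite ler_wsqrtr// lerDr. Qed.
Let yZ := powR_le_delay_factor y.
Let y0 : 0 <= `|y| `^ gamma. Proof. exact: powR_ge0. Qed.

Lemma bim_C_ge0 : 0 <= C.
Proof.
by rewrite /C !addr_ge0// mulr_ge0 ?bim_C1_ge0// ltW.
Qed.

(** The coefficients of the scheme fit [one_step_le] with g = sqrt (1 + |x|).
    The product b C_1 needs a case distinction: for x >= eps the two roots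
    cancel, and for x < eps the factor eps^(-1/2) replaces 1 / sqrt x. *)
Lemma bim_path_step (k : nat) :
  (x + (lambda * (mu - x) * h + b * w + delta * x * n) / (1 + C)) ^+ k.+2
    <= x ^+ k.+2 + k.+2%:R * x ^+ k.+1 * (b * w)
     + one_step_const k bim_bound
       * (2 * (1 + `|x|) ^+ k.+2 + Z ^+ (2 * k.+2 ^ 2))
       * (h + `|n| + `|n| ^+ 2 + `|n| ^+ k.+2 + w ^+ 2 + `|w| ^+ k.+2).
Proof.
have [[D1 Dl Dd Ds] [Ds2 De DC0 DC2]] := bim_bound_ge.
set D := bim_bound in D1 Dl Dd Ds Ds2 De DC0 DC2 *.
have D0 : 0 <= D by exact: le_trans D1.
have Z1 := delay_factor_ge1 y; rewrite -/Z in Z1.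
have Z0 : 0 <= Z by exact: le_trans Z1.
have g0 : 0 <= g by exact: le_trans g1.
have ax : 0 <= `|x| by [].
have := @one_step_le R k x g Z w n h D (lambda * (mu - x)) b c (delta * x) C
  D1 g1 Z1 h0 h1 (bim_C1_ge0 x y).
rewrite exprM g2 [w ^+ 2](_ : _ = `|w| ^+ 2); last by rewrite real_normK ?num_real.
apply.
- by rewrite lerDr.
- rewrite normrM (ger0_norm (ltW hlambda)).
  apply: (@le_trans _ _ (lambda * (mu + 1) * (1 + `|x|))); last first.
    by rewrite ler_wpM2r// addr_ge0.
  rewrite -mulrA ler_wpM2l ?(ltW hlambda)//.
  apply: (le_trans (ler_normB _ _)); rewrite (ger0_norm (ltW hmu)).
  have := mulr_ge0 (ltW hmu) ax; lra.
- rewrite normrM (ger0_norm hdelta); apply: ler_pM => //.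
  by rewrite lerDr.
- rewrite /b ger0_norm; last by rewrite !mulr_ge0 ?sqrtr_ge0// ltW.
  rewrite -mulrA; apply: ler_pM => //; rewrite ?mulr_ge0 ?sqrtr_ge0 ?(ltW hsigma)//.
  by apply: ler_pM => //; rewrite sqrtr_ge0.
- have b0 : 0 <= b by rewrite /b !mulr_ge0 ?sqrtr_ge0// ltW.
  rewrite (ger0_norm b0) /b /c /bim_C1.
  have yy : (`|y| `^ gamma) ^+ 2 <= Z ^+ 2 by rewrite lerXn2r ?nnegrE.
  case: ifPn => xe.
    rewrite (_ : _ * _ * _ * _ = sigma ^+ 2 * eps `^ (- 2^-1)
      * ((`|y| `^ gamma) ^+ 2 * Num.sqrt `|x|)); last by ring.
    apply: ler_pM => //.
    - by apply: mulr_ge0 => //; exact: sqr_ge0.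
    - by apply: ler_pM => //; rewrite ?sqrtr_ge0 ?sqr_ge0.
  have x0 : 0 < x by rewrite -leNgt in xe; exact: lt_le_trans xe.
  rewrite (gtr0_norm x0) (_ : _ * _ * _ * _ = sigma ^+ 2 * (`|y| `^ gamma) ^+ 2).
    apply: ler_pM; rewrite ?sqr_ge0//.
    by apply: (le_trans yy); rewrite ler_peMr// exprn_ge0.
  by field; rewrite gt_eqF// sqrtr_gt0.
- exact: bim_C_ge0.
- rewrite /C; apply: lerD; first apply: lerD => //.
    by rewrite ler_wpM2r// ltW.
  by rewrite ler_wpM2r.
Qed.

End path_step.

Section scheme.
Variables (m : nat) (h : R) (s : int -> Omega -> R).
Hypotheses (m0 : (0 < m)%N) (hE : h = tau / m%:R) (h1 : h < 1).
Hypothesis hs :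
  is_bim lambda mu sigma gamma delta C0 C2 eps W Nt xi h m s.

Lemma step_gt0 : 0 < h. Proof. by rewrite hE divr_gt0// ltr0n. Qed.

Lemma step_mul : m%:R * h = tau.
Proof. by rewrite hE mulrC divfK// pnatr_eq0 -lt0n. Qed.

Lemma meshE (k : nat) : mesh h k%:Z = k%:R * h. Proof. by []. Qed.

Lemma mesh_ge0 (k : nat) : 0 <= mesh h k%:Z.
Proof. by rewrite meshE mulr_ge0// ltW// step_gt0. Qed.

Lemma meshS (k : nat) : mesh h k.+1%:Z - mesh h k%:Z = h.
Proof. by rewrite !meshE -(natr1 k) mulrDl mul1r addrAC subrr add0r. Qed.

Lemma mesh_ltS (k : nat) : mesh h k%:Z < mesh h k.+1%:Z.
Proof. by rewrite -subr_gt0 meshS step_gt0. Qed.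

Lemma mesh_le (k l : nat) : (k <= l)%N -> mesh h k%:Z <= mesh h l%:Z.
Proof. by move=> kl; rewrite !meshE ler_wpM2r ?ler_nat// ltW// step_gt0. Qed.

(** The scheme reindexed by the naturals: index 0 is time - tau, and the delayed
    argument of index m + k is index k. *)
Definition shifted (i : nat) (w : Omega) : R := s (i%:Z - m%:Z) w.
Local Notation z := shifted.

Lemma shifted_mesh (k : nat) w : s k%:Z w = z (m + k) w.
Proof. by rewrite /shifted PoszD addrAC subrr add0r. Qed.

Lemma mesh_init (i : nat) : (i <= m)%N -> - tau <= mesh h (i%:Z - m%:Z) <= 0.
Proof.
move=> im; rewrite /mesh rmorphB/= mulrBl step_mul lerDr subr_le0 -step_mul.
have h0 := ltW step_gt0.
by apply/andP; split; [exact: mulr_ge0|rewrite ler_wpM2r// ler_nat].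
Qed.

Lemma shifted_init (i : nat) w : (i <= m)%N ->
  z i w = xi (mesh h (i%:Z - m%:Z)) w.
Proof.
by move=> im; apply: (bim_init hs); exact: shift_int_bounds.
Qed.

Local Notation dW k w := (W (mesh h k.+1%:Z) w - W (mesh h k%:Z) w).
Local Notation dN k w := (Nt (mesh h k.+1%:Z) w - Nt (mesh h k%:Z) w).

Definition bim_den (x y w n : R) : R :=
  1 + (C0 * h + bim_C1 sigma gamma eps x y * `|w| + C2 * `|n|).

(** The implicit recursion solved for the new value. *)
Lemma shifted_step (k : nat) w :
  z (m + k).+1 w = z (m + k) w
    + (lambda * (mu - z (m + k) w) * h
       + sigma * `|z k w| `^ gamma * Num.sqrt `|z (m + k) w| * dW k w
       + delta * z (m + k) w * dN k w)
      / bim_den (z (m + k) w) (z k w) (dW k w) (dN k w).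
Proof.
have := bim_rec hs k w.
rewrite shifted_mesh shifted_mesh addnS -/(z k w) /bim_C -/(z k w) shifted_mesh.
rewrite /mesh_incr -/(bim_den _ _ _ _).
set x := z (m + k) w; set x' := z (m + k).+1 w; set y := z k w.
set u := dW k w; set v := dN k w; rewrite /bim_den.
have C_ge0 := bim_C_ge0 x y u v step_gt0.
set C := C0 * h + _ + _ in C_ge0 *.
move: (lambda * _ * h) (sigma * _ * _ * u) (delta * x * v) => a b c e.
have {}e : x' * (1 + C) = x * (1 + C) + (a + b + c) by lra.
have C1 : 1 + C != 0 by rewrite gt_eqF// ltr_pwDl.
by apply: (mulIf C1); rewrite e mulrDl divfK.
Qed.

Section measurability.
Context {d' : measure_display} {T : measurableType d'}.
Variables (x y u v : T -> R).
Hypotheses (mx : measurable_fun [set: T] x) (my : measurable_fun [set: T] y).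
Hypotheses (mu' : measurable_fun [set: T] u) (mv : measurable_fun [set: T] v).

Let mnorm (f : T -> R) : measurable_fun [set: T] f ->
  measurable_fun [set: T] (fun w => `|f w|).
Proof. by move=> mf; exact: measurableT_comp. Qed.

Let msqrt (f : T -> R) : measurable_fun [set: T] f ->
  measurable_fun [set: T] (fun w => Num.sqrt (f w)).
Proof. by move=> mf; exact: (measurableT_comp measurable_sqrt mf). Qed.

Let mpow : measurable_fun [set: T] (fun w => `|y w| `^ gamma).
Proof. by apply: (measurableT_comp (measurable_powR _)); exact: mnorm. Qed.

Lemma measurable_bim_diffusion :
  measurable_fun [set: T] (fun w => sigma * `|y w| `^ gamma * Num.sqrt `|x w|).
Proof.
apply: measurable_funM; first exact: measurable_funM.
by apply: msqrt; exact: mnorm.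
Qed.

Lemma measurable_bim_den :
  measurable_fun [set: T] (fun w => bim_den (x w) (y w) (u w) (v w)).
Proof.
apply: measurable_funD => //; apply: measurable_funD; last first.
  by apply: measurable_funM => //; exact: mnorm.
apply: measurable_funD => //; apply: measurable_funM; last exact: mnorm.
rewrite /bim_C1; apply: measurable_fun_ifT.
- exact: measurable_fun_ltr.
- by apply: measurable_funM => //; exact: measurable_funM.
- apply: measurable_funM; first exact: measurable_funM.
  apply: measurable_funV_ge0; last exact: msqrt.
  by move=> w; rewrite sqrtr_ge0.
Qed.

(** The increments u' and v' of the numerator are kept apart from those of the
    denominator: they differ in the interpolation between mesh points. *)
Lemma measurable_bim_increment (r : R) (u' v' : T -> R) :
  measurable_fun [set: T] u' -> measurable_fun [set: T] v' ->
  measurable_fun [set: T] (fun w => x w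
    + (lambda * (mu - x w) * r
       + sigma * `|y w| `^ gamma * Num.sqrt `|x w| * u' w
       + delta * x w * v' w) / bim_den (x w) (y w) (u w) (v w)).
Proof.
move=> mu1 mv1; apply: measurable_funD => //; apply: measurable_funM; last first.
  apply: measurable_funV_ge0; last exact: measurable_bim_den.
  move=> w; rewrite /bim_den addr_ge0//.
  exact: (bim_C_ge0 (x w) (y w) (u w) (v w) step_gt0).
apply: measurable_funD; last by apply: measurable_funM => //; exact: measurable_funM.
apply: measurable_funD.
  apply: measurable_funM => //; apply: measurable_funM => //.
  exact: measurable_funB.
by apply: measurable_funM => //; exact: measurable_bim_diffusion.
Qed.

End measurability.

Lemma adapted_brownian (k l : nat) : (k <= l)%N ->
  measurable_wrt (F (mesh h l%:Z)) (W (mesh h k%:Z)).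
Proof.
move=> kl; apply: measurable_wrtS (bm_adapted hW (mesh_ge0 k)).
by apply: (filtration_mono hF (mesh_ge0 k)); exact: mesh_le.
Qed.

Lemma adapted_compensated (k l : nat) : (k <= l)%N ->
  measurable_wrt (F (mesh h l%:Z)) (Nt (mesh h k%:Z)).
Proof.
move=> kl; apply: (@measurable_wrtS _ _ _ _ (F (mesh h k%:Z))).
  by apply: (filtration_mono hF (mesh_ge0 k)); exact: mesh_le.
have sG := filtration_sigma hF (mesh_ge0 k).
apply: (proj2 (@measurable_wrtP _ _ _ _ (Nt (mesh h k)) sG)).
apply: measurable_funB => //.
apply: (measurableT_comp (f := fun n : nat => n%:R : R)) => //.
move=> _ B mB; rewrite measurable_g_measurableTypeE//.
by apply: (pp_adapted hN (mesh_ge0 k)); exists B.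
Qed.

Lemma shifted_adapted (k i : nat) : (i <= m + k)%N ->
  measurable_wrt (F (mesh h k%:Z)) (z i).
Proof.
elim: k i => [|k IH] i ik.
  have -> : mesh h 0%:Z = 0 by rewrite meshE mul0r.
  rewrite addn0 in ik.
  have -> : z i = xi (mesh h (i%:Z - m%:Z)).
    by apply/funext => w; rewrite shifted_init.
  by apply: (init_measurable hxi); exact: mesh_init.
have Fmono : F (mesh h k%:Z) `<=` F (mesh h k.+1%:Z).
  by apply: (filtration_mono hF (mesh_ge0 k)); exact: mesh_le.
have [ik'|] := leqP i (m + k); first exact: measurable_wrtS (IH _ ik').
move=> ki; have {ki ik}-> : i = (m + k).+1.
  by apply: anti_leq; rewrite ki -addnS ik.
have sG := filtration_sigma hF (mesh_ge0 k.+1).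
have mS (X : Omega -> R) := proj1 (@measurable_wrtP _ _ R _ X sG).
have mx := mS _ (measurable_wrtS Fmono (IH (m + k)%N (leqnn _))).
have my := mS _ (measurable_wrtS Fmono (IH k (leq_addl _ _))).
have mW0 := mS _ (adapted_brownian (leqnSn k)).
have mW1 := mS _ (adapted_brownian (leqnn k.+1)).
have mN0 := mS _ (adapted_compensated (leqnSn k)).
have mN1 := mS _ (adapted_compensated (leqnn k.+1)).
apply: (proj2 (@measurable_wrtP _ _ R _ _ sG)).
rewrite (funext (shifted_step k)).
have mdW := measurable_funB mW1 mW0; have mdN := measurable_funB mN1 mN0.
exact: (measurable_bim_increment mx my mdW mdN h mdW mdN).
Qed.

Section stopping.
Variable L : R.
Hypothesis L0 : 0 < L.

(** No value up to index i has left ]-L, L[. *)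
Fixpoint alive (i : nat) (w : Omega) : bool :=
  (if i is i'.+1 then alive i' w else true) && (`|z i w| < L).

(** The scheme frozen after its first exit from ]-L, L[.  Along the initial
    segment, i <= m, it is never frozen, so that its moments there are those of
    the initial data. *)
Fixpoint stopped (i : nat) (w : Omega) : R :=
  if i is i'.+1 then
    if (i' < m)%N || alive i' w then z i w else stopped i' w
  else z 0 w.

Lemma alive_lt (i j : nat) w : (j <= i)%N -> alive i w -> `|z j w| < L.
Proof.
elim: i => [|i IH]; first by rewrite leqn0 => /eqP ->.
rewrite leq_eqVlt => /orP[/eqP -> /andP[]//|ji /= /andP[ai _]].
exact: IH.
Qed.

Lemma alive_le (i j : nat) w : (j <= i)%N -> alive i w -> alive j w.
Proof.
elim: i => [|i IH]; first by rewrite leqn0 => /eqP ->.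
rewrite leq_eqVlt => /orP[/eqP -> //|ji /= /andP[ai _]]; exact: IH.
Qed.

Lemma aliveN_lt (i : nat) w : ~~ alive i w -> exists2 j, (j <= i)%N & L <= `|z j w|.
Proof.
elim: i => [|i IH] /=; first by rewrite -leNgt => ?; exists 0%N.
rewrite negb_and => /orP[/IH [j ji Lj]|]; first by exists j => //; exact: leqW.
by rewrite -leNgt => ?; exists i.+1.
Qed.

Lemma stopped_init (i : nat) w : (i <= m)%N -> stopped i w = z i w.
Proof. by case: i => [|i] //= ->. Qed.

Lemma stopped_alive (i : nat) w : alive i w -> stopped i w = z i w.
Proof. by case: i => [|i] //= /andP[-> _]; rewrite orbT. Qed.

Lemma stoppedS (k : nat) w : stopped (m + k).+1 w
  = if alive (m + k) w then z (m + k).+1 w else stopped (m + k) w.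
Proof. by rewrite /= ltnNge leq_addr. Qed.

(** The overshoot is kept: the frozen value is the first one of absolute value
    at least L. *)
Lemma stopped_exit (k : nat) w :
  alive m w -> ~~ alive (m + k) w -> L <= `|stopped (m + k) w|.
Proof.
move=> am; elim: k => [|k IH]; first by rewrite addn0 am.
rewrite addnS stoppedS; case: ifPn => [ak|/IH//].
by rewrite /= ak /= -leNgt.
Qed.

Lemma alive_adapted (k i : nat) : (i <= m + k)%N ->
  measurable_fun [set: g_sigma_algebraType (F (mesh h k%:Z))]
    (alive i : g_sigma_algebraType (F (mesh h k%:Z)) -> bool).
Proof.
move=> ik; have sG := filtration_sigma hF (mesh_ge0 k).
have mz j : (j <= m + k)%N -> measurable_fun
    [set: g_sigma_algebraType (F (mesh h k%:Z))]
    ((fun w => `|z j w| < L) : g_sigma_algebraType (F (mesh h k%:Z)) -> bool).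
  move=> jk; apply: measurable_fun_ltr => //.
  apply: measurableT_comp => //.
  exact: (proj1 (@measurable_wrtP _ _ R _ _ sG) (shifted_adapted jk)).
elim: i ik => [|i IH] ik.
  exact: mz.
by apply: measurable_and; [apply: IH; exact: ltnW|exact: mz].
Qed.

Lemma stopped_adapted (k i : nat) : (i <= m + k)%N ->
  measurable_wrt (F (mesh h k%:Z)) (stopped i).
Proof.
move=> ik; have sG := filtration_sigma hF (mesh_ge0 k).
apply: (proj2 (@measurable_wrtP _ _ R _ _ sG)).
have mz j : (j <= m + k)%N -> _ := fun jk =>
  proj1 (@measurable_wrtP _ _ R _ _ sG) (shifted_adapted jk).
elim: i ik => [|i IH] ik; first exact: mz.
apply: measurable_fun_ifT; [|exact: mz|by apply: IH; exact: ltnW].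
apply: measurable_or; first exact: measurable_cst.
by apply: alive_adapted; exact: ltnW.
Qed.

Lemma measurable_stopped (i : nat) : measurable_fun [set: Omega] (stopped i).
Proof.
apply: measurable_wrtT (stopped_adapted (leq_addl m i)).
exact: (filtration_sub hF (mesh_ge0 i)).
Qed.

Lemma measurable_stopped_moment (i n : nat) :
  measurable_fun [set: Omega] (fun w => `|stopped i w| ^+ n).
Proof.
apply: measurable_funX; apply: measurableT_comp => //.
exact: measurable_stopped.
Qed.

Section moment_step.
Variables r k : nat.

Let n := r.+1.*2.
Let Q := (2 * n ^ 2)%N.
Let K := one_step_const r.*2 bim_bound.
Let K0 : 0 <= K.
Proof.
by have [[D1 _ _ _] _] := bim_bound_ge; apply: one_step_const_ge0; exact: le_trans D1.
Qed.

(** Absorbs the powers of 2 lost when (1 + |x|)^n and the power of the delay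
    factor are expanded. *)
Definition growth_const : R := K * (2 ^+ n.+1 + 4 ^+ Q).

Lemma growth_const_ge0 : 0 <= growth_const.
Proof. by apply: mulr_ge0 => //; apply: addr_ge0; exact: exprn_ge0. Qed.

Let rho w := growth_const
  * (2 + `|stopped (m + k) w| ^+ n + `|stopped k w| ^+ (delay_exp * Q)).

Let rho0 w : 0 <= rho w.
Proof.
by apply: mulr_ge0; [exact: growth_const_ge0|rewrite !addr_ge0// exprn_ge0].
Qed.

Let rho_ge (x y : R) :
  K * (2 * (1 + `|x|) ^+ n + delay_factor y ^+ Q)
   <= growth_const * (2 + `|x| ^+ n + `|y| ^+ (delay_exp * Q)).
Proof.
rewrite /growth_const -mulrA ler_wpM2l//.
have x0 : 0 <= `|x| ^+ n by exact: exprn_ge0.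
have y0 : 0 <= `|y| ^+ (delay_exp * Q) by exact: exprn_ge0.
have h2 : 2 * (1 + `|x|) ^+ n <= 2 ^+ n.+1 * (1 + `|x| ^+ n).
  rewrite exprS -mulrA ler_wpM2l//.
  by apply: le_trans (exprnD_le _ ler01 (normr_ge0 x)) _; rewrite expr1n.
have h4 : delay_factor y ^+ Q <= 4 ^+ Q * (1 + `|y| ^+ (delay_exp * Q)).
  have yd : 0 <= `|y| ^+ delay_exp by exact: exprn_ge0.
  apply: (@le_trans _ _ ((2 * (1 + `|y| ^+ delay_exp)) ^+ Q)).
    rewrite /delay_factor; set a := _ ^+ delay_exp in yd *.
    by apply: lerXn2r; rewrite ?nnegrE; lra.
  rewrite exprMn (_ : 4 ^+ Q = 2 ^+ Q * 2 ^+ Q).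
    rewrite -mulrA ler_wpM2l ?exprn_ge0//.
    by apply: le_trans (exprnD_le _ ler01 yd) _; rewrite expr1n exprM.
  by rewrite -exprMn; congr (_ ^+ _); ring.
apply: (le_trans (lerD h2 h4)).
have a0 : 0 <= 2 ^+ n.+1 :> R by exact: exprn_ge0.
have b0 : 0 <= 4 ^+ Q :> R by exact: exprn_ge0.
by rewrite mulrDl lerD// ler_wpM2l//; lra.
Qed.

Let b w := sigma * `|z k w| `^ gamma * Num.sqrt `|z (m + k) w|.
Let f w := if alive (m + k) w
  then n%:R * z (m + k) w ^+ r.*2.+1 * b w else 0.

(** Stopping is used here: before the exit, both the current and the delayed
    value are below L. *)
Let f_bound w :
  `|f w| <= n%:R * L ^+ r.*2.+1 * (sigma * L `^ gamma * Num.sqrt L).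
Proof.
have b0 : 0 <= sigma * L `^ gamma * Num.sqrt L.
  by rewrite !mulr_ge0 ?sqrtr_ge0 ?powR_ge0// ltW.
have LL : 0 <= n%:R * L ^+ r.*2.+1 by rewrite mulr_ge0// exprn_ge0// ltW.
rewrite /f; case: ifPn => [ak|_]; last by rewrite normr0 mulr_ge0.
have xL := ltW (alive_lt (leqnn _) ak).
have yL := ltW (alive_lt (leq_addl m k) ak).
rewrite normrM; apply: ler_pM => //.
  rewrite normrM normr_nat normrX ler_wpM2l// lerXn2r ?nnegrE//; exact: ltW.
rewrite /b ger0_norm; last by rewrite !mulr_ge0 ?sqrtr_ge0 ?powR_ge0// ltW.
apply: ler_pM; rewrite ?sqrtr_ge0 ?ler_wsqrtr//.
  by rewrite mulr_ge0 ?powR_ge0// ltW.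
rewrite ler_wpM2l ?(ltW hsigma)//.
by rewrite ge0_ler_powR ?nnegrE// ltW.
Qed.

(** After the exit nothing moves and rho H is nonnegative; before it this is
    [bim_path_step]. *)
Let step_le w : `|stopped (m + k).+1 w| ^+ n <= `|stopped (m + k) w| ^+ n
  + f w * dW k w
  + rho w * (mesh h k.+1%:Z - mesh h k%:Z + `|dN k w| + `|dN k w| ^+ 2
     + `|dN k w| ^+ n + dW k w ^+ 2 + `|dW k w| ^+ n).
Proof.
rewrite stoppedS meshS.
set H := h + _ + _ + _ + _ + _.
have h0 := step_gt0.
have H0 : 0 <= H.
  rewrite /H; do ?apply: addr_ge0 => //; rewrite ?sqr_ge0 ?exprn_ge0//; exact: ltW.
rewrite /f; case: ifPn => ak; last first.
  by rewrite mul0r addr0 lerDl mulr_ge0.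
rewrite (stopped_alive ak) !normr_exprn_double shifted_step.
apply: (le_trans (bim_path_step _ _ _ _ h0 (ltW h1) _)).
rewrite -[_ * b w * dW k w]mulrA; apply: lerD => //.
apply: ler_wpM2r => //.
rewrite /rho (stopped_alive ak).
rewrite (stopped_alive (alive_le (leq_addl m k) ak)).
exact: rho_ge.
Qed.

(** The moment recursion.  The delayed moment has a higher order, but belongs
    to the previous block. *)
Lemma stopped_moment_step :
  (\int[P]_w (`|stopped (m + k).+1 w| ^+ n)%:E
   <= \int[P]_w (`|stopped (m + k) w| ^+ n)%:E
     + (noise_const beta r * growth_const * h)%:E
       * (2%:E + \int[P]_w (`|stopped (m + k) w| ^+ n)%:E
          + \int[P]_w (`|stopped k w| ^+ (delay_exp * Q))%:E))%E.
Proof.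
have sG := filtration_sigma hF (mesh_ge0 k).
have mk0 := mesh_ge0 k.
have mS (X : Omega -> R) := proj1 (@measurable_wrtP _ _ R _ X sG).
have mT (X : Omega -> R) := proj2 (@measurable_wrtP _ _ R _ X sG).
have mx := mS _ (shifted_adapted (leqnn (m + k))).
have my := mS _ (shifted_adapted (leq_addl m k)).
have mzx := mS _ (stopped_adapted (leqnn (m + k))).
have mzy := mS _ (stopped_adapted (leq_addl m k)).
have Ff : measurable_wrt (F (mesh h k%:Z)) f.
  apply: mT; apply: measurable_fun_ifT => //; first exact: alive_adapted.
  apply: measurable_funM; last exact: (measurable_bim_diffusion mx my).
  by apply: measurable_funM => //; exact: measurable_funX.
have Frho : measurable_wrt (F (mesh h k%:Z)) rho.
  apply: mT; apply: measurable_funM => //; apply: measurable_funD.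
    apply: measurable_funD => //; apply: measurable_funX.
    exact: (measurableT_comp (f := @Num.norm R R) _ mzx).
  apply: measurable_funX.
  exact: (measurableT_comp (f := @Num.norm R R) _ mzy).
have hstep : mesh h k.+1%:Z - mesh h k%:Z <= 1 by rewrite meshS ltW.
have := expectation_step hF hbeta hN hW mk0 (mesh_ltS k) hstep
  (measurable_stopped_moment _ _) (measurable_stopped_moment _ _) Ff Frho
  (fun w => exprn_ge0 n (normr_ge0 _)) (fun w => exprn_ge0 n (normr_ge0 _))
  rho0 f_bound step_le.
rewrite meshS => /le_trans; apply; rewrite leeD2l//.
have -> : (\int[P]_w (rho w)%:E = growth_const%:E *
   (2%:E + \int[P]_w (`|stopped (m + k) w| ^+ n)%:E
          + \int[P]_w (`|stopped k w| ^+ (delay_exp * Q))%:E))%E.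
  rewrite -[in RHS](@integral_prob_cst _ _ _ P 2%:E).
  have me i q : measurable_fun [set: Omega] (fun w => (`|stopped i w| ^+ q)%:E).
    by apply/measurable_EFinP; exact: measurable_stopped_moment.
  have pe i q w : (0 <= (`|stopped i w| ^+ q)%:E)%E by rewrite lee_fin exprn_ge0.
  rewrite -ge0_integralD// -ge0_integralD//; last 2 first.
  - by move=> w _; rewrite adde_ge0// pe.
  - by apply: emeasurable_funD.
  rewrite -ge0_integralZl ?lee_fin ?growth_const_ge0//; last 2 first.
  - by do 2 apply: emeasurable_funD => //.
  - by move=> w _; rewrite !adde_ge0// pe.
rewrite muleA -EFinM.
rewrite le_eqVlt; apply/orP; left; apply/eqP; congr (_%:E * _)%E.
by rewrite mulrAC.
Qed.

End moment_step.
End stopping.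
End scheme.

Lemma sup_pow_ge (X : R -> Omega -> R) (a b t : R) (q : nat) (w : Omega) :
  a <= t <= b -> ((`|X t w| ^+ q)%:E <= sup_pow X a b q%:R w)%E.
Proof.
move=> tab; rewrite -powR_mulrn//; apply: ereal_sup_ubound; exists t => //=.
Qed.

Lemma initial_moment (q : nat) : (0 < q)%N -> exists X : R, 0 <= X /\
  forall t, - tau <= t <= 0 -> (\int[P]_w (`|xi t w| ^+ q)%:E <= X%:E)%E.
Proof.
move=> q0; set I := (\int[P]_w sup_pow xi (- tau) 0 q%:R w)%E.
have I0 : (0 <= I)%E.
  apply: integral_ge0 => w _; apply: le_trans (sup_pow_ge xi q w (t := 0) _).
    by rewrite lee_fin exprn_ge0.
  by rewrite lexx andbT oppr_le0 ltW.
have Ioo : (I < +oo)%E by apply: (init_moments hxi); rewrite ltr0n.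
exists (fine I); split; first exact: fine_ge0.
move=> t ht; rewrite fineK ?ge0_fin_numE//.
apply: ge0_le_integral_pw => w; first by rewrite lee_fin exprn_ge0.
exact: sup_pow_ge.
Qed.

(** The delayed moment in [stopped_moment_step] is again of positive even order,
    as the induction over blocks requires. *)
Lemma delay_moment_exp (r : nat) :
  exists q, (delay_exp * (2 * r.+1.*2 ^ 2) = q.+1.*2)%N.
Proof.
rewrite /delay_exp -doubleMl; set a := (_ * _)%N; exists a.-1.
by rewrite prednK// muln_gt0/= muln_gt0/= expn_gt0.
Qed.

(** Induction over the blocks of m steps, for all even orders at once.  Within
    a block, E_(k+1) <= E_k + alpha h (2 + E_k + K2), where K2 bounds the
    delayed moments; the solution of this recursion is dominated by
    A exp (alpha h k) - (2 + K2), and h k stays below the total length of the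
    blocks. *)
Lemma stopped_moment_bound (J r : nat) : exists K : R,
  forall (m : nat) (h : R) (s : int -> Omega -> R),
  (0 < m)%N -> h = tau / m%:R -> h < 1 ->
  is_bim lambda mu sigma gamma delta C0 C2 eps W Nt xi h m s ->
  forall (L : R) (i : nat), 0 < L -> (i <= m + J * m)%N ->
  (\int[P]_w (`|stopped m s L i w| ^+ r.+1.*2)%:E <= K%:E)%E.
Proof.
elim: J r => [|J IH] r.
  have [X [X0 hX]] := initial_moment (isT : 0 < r.+1.*2)%N.
  exists X => m h s m0 hE h1 hs L i L0; rewrite mul0n addn0 => im.
  under eq_integral do rewrite (stopped_init s L _ im) (shifted_init hs _ im).
  by apply: hX; exact: (mesh_init m0 hE).
have [X [X0 hX]] := initial_moment (isT : 0 < r.+1.*2)%N.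
have [q qE] := delay_moment_exp r.
have [K' hK'] := IH q.
pose K2 := Num.max K' 0.
have K20 : 0 <= K2 by rewrite le_max lexx orbT.
pose alpha := noise_const beta r * growth_const r.
have alpha0 : 0 <= alpha.
  by apply: mulr_ge0; [exact: noise_const_ge0|exact: growth_const_ge0].
pose A := 2 + X + K2.
have A0 : 0 <= A by rewrite /A; lra.
exists (A * expR (alpha * (J.+1%:R * tau))) => m h s m0 hE h1 hs L i L0 iJ.
have h0 := step_gt0 m0 hE.
have init j : (j <= m)%N ->
    (\int[P]_w (`|stopped m s L j w| ^+ r.+1.*2)%:E <= X%:E)%E.
  move=> jm; under eq_integral do rewrite (stopped_init s L _ jm) (shifted_init hs _ jm).
  by apply: hX; exact: (mesh_init m0 hE).
have key k : (k <= m + J * m)%N ->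
    (\int[P]_w (`|stopped m s L (m + k) w| ^+ r.+1.*2)%:E
      <= (A * expR (alpha * (h * k%:R)) - (2 + K2))%:E)%E.
  elim: k => [|k IHk] kJ.
    rewrite addn0; apply: le_trans (init _ (leqnn m)) _.
    by rewrite lee_fin mulr0 mulr0 expR0 /A; lra.
  rewrite addnS.
  apply: le_trans (stopped_moment_step m0 hE h1 hs L0 r k) _.
  have := hK' m h s m0 hE h1 hs L k L0 (ltnW kJ); rewrite -qE => hk.
  have {}IHk := IHk (ltnW kJ).
  set b := A * expR _ - _ in IHk *.
  have hk2 : (\int[P]_w (`|stopped m s L k w| ^+ (delay_exp * (2 * r.+1.*2 ^ 2)))%:E
      <= K2%:E)%E by apply: le_trans hk _; rewrite lee_fin le_max lexx.
  have ah0 : 0 <= alpha * h by rewrite mulr_ge0// ltW.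
  rewrite -/alpha.
  apply: (@le_trans _ _ (b%:E + (alpha * h)%:E * (2%:E + b%:E + K2%:E))%E).
    apply: leeD => //; apply: lee_wpmul2l; first by rewrite lee_fin.
    by apply: leeD => //; apply: leeD.
  rewrite -!EFinD lee_fin /b.
  set e := expR (alpha * (h * k%:R)).
  have e0 : 0 <= e by exact: expR_ge0.
  have -> : expR (alpha * (h * k.+1%:R)) = e * expR (alpha * h).
    by rewrite -expRD -(natr1 k); congr expR; ring.
  have := expR_ge1Dx (alpha * h) => ea.
  have := ler_wpM2l (mulr_ge0 A0 e0) ea.
  by move: (expR (alpha * h)) => u; lra.
have K1 : 1 <= expR (alpha * (J.+1%:R * tau)).
  by rewrite -[leLHS]expR0 ler_expR mulr_ge0// mulr_ge0// ltW.
have [im|mi] := leqP i m.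
  apply: le_trans (init _ im) _; rewrite lee_fin.
  by apply: le_trans (ler_peMr A0 K1); rewrite /A; lra.
have iE : i = (m + (i - m))%N by rewrite subnKC// ltnW.
have kJ : (i - m <= m + J * m)%N by rewrite leq_subLR -mulSn.
rewrite iE; apply: le_trans (key _ kJ) _; rewrite lee_fin.
apply: (@le_trans _ _ (A * expR (alpha * (h * (i - m)%:R)))); first by lra.
rewrite ler_wpM2l// ler_expR ler_wpM2l//.
rewrite -(step_mul m0 hE) mulrA -natrM mulrC ler_wpM2r ?(ltW h0)//.
by rewrite ler_nat mulSn.
Qed.

End bim.

(** * Chaining along dyadic grids *)

Section grid.
Context {R : realType}.
Implicit Types (a b t B : R) (f : R -> R).

Definition grid a b (n i : nat) : R := a + (b - a) * i%:R / 2 ^+ n.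

Lemma grid_in a b n i : a <= b -> (i <= 2 ^ n)%N -> a <= grid a b n i <= b.
Proof.
move=> ab in2; have p2 : 0 < 2 ^+ n :> R by rewrite exprn_gt0.
have i01 : 0 <= (i%:R / 2 ^+ n : R) <= 1.
  by rewrite divr_ge0 ?(ltW p2)//= ler_pdivrMr// mul1r -natrX ler_nat.
have ba : 0 <= b - a by rewrite subr_ge0.
rewrite /grid -mulrA; move/andP: i01 => []; move: (_ / _) => u u0 u1.
by apply/andP; split; nra.
Qed.

Lemma grid_dense a b t (e : R) : a < b -> a <= t <= b -> 0 < e ->
  exists n i, (i <= 2 ^ n)%N /\ `|t - grid a b n i| < e.
Proof.
move=> ab /andP[at_ tb] e0; have ba : 0 < b - a by rewrite subr_gt0.
pose n := (Num.truncn ((b - a) / e)).+1.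
have p2 : 0 < 2 ^+ n :> R by rewrite exprn_gt0.
have hn : (b - a) / 2 ^+ n < e.
  rewrite ltr_pdivrMr// mulrC -ltr_pdivrMr//.
  apply: (lt_le_trans (truncnS_gt _)); rewrite -/n -natrX ler_nat.
  exact/ltnW/ltn_expl.
pose u := (t - a) / (b - a) * 2 ^+ n.
have u0 : 0 <= u.
  by rewrite mulr_ge0 ?(ltW p2)// divr_ge0 ?subr_ge0// ltW.
have /andP[iu ui] := truncn_itv u0; set i := Num.truncn u in iu ui.
exists n, i; split.
  rewrite -(ler_nat R) natrX; apply: (le_trans iu).
  by rewrite /u ler_piMl ?(ltW p2)// ler_pdivrMr// mul1r lerD2r.
have -> : t - grid a b n i = (b - a) / 2 ^+ n * (u - i%:R).
  by rewrite /grid /u; field; rewrite !gt_eqF.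
have w0 : 0 < (b - a) / 2 ^+ n by rewrite divr_gt0.
have ui1 : 0 <= u - i%:R < 1.
  by rewrite subr_ge0 iu/= ltrBlDr -natr1 addrC in ui *.
move/andP: ui1 => [ui0 ui1]; rewrite ger0_norm; last by apply: mulr_ge0 => //; exact: ltW.
by apply: le_lt_trans hn; rewrite ler_piMr ?(ltW w0)// ltW.
Qed.

(** A continuous function bounded on a dense set is bounded. *)
Lemma continuous_grid_le a b f B : a < b -> {within `[a, b], continuous f} ->
  (forall n i, (i <= 2 ^ n)%N -> f (grid a b n i) <= B) ->
  forall t, a <= t <= b -> f t <= B.
Proof.
move=> ab cf fB t tab; apply/ler_addgt0Pr => e e0.
move/subspace_continuousP: cf => /(_ t); rewrite /= in_itv/= tab => /(_ isT).
move=> /cvgrPdist_lt/(_ e e0); rewrite near_withinE.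
move=> /nbhs_ballP[/= r r0 hr].
have [n [i [in2 ti]]] := grid_dense ab tab r0.
have := hr _ ti; rewrite /= in_itv/= => /(_ (grid_in (ltW ab) in2)).
have := fB n i in2; rewrite ltr_norml => h /andP[_ h2].
rewrite /from_subspace in h2; move: h h2; move: (f t) (f _) => u v h h2; lra.
Qed.

(** Chaining.  A point of level n + 1 is a point of level n or the right
    neighbour of one, and the increments of level n are at most A (4/5)^n; the
    geometric series sums to 5 A.  The ratio 5/4 is small enough for the
    weighted Brownian moments in [brownian_sup_moment] to be summable. *)
Lemma grid_chain f b A : 0 <= A ->
  (forall n i, (i < 2 ^ n)%N ->
     (5 / 4) ^+ n * `|f (grid 0 b n i.+1) - f (grid 0 b n i)| <= A) ->
  forall n i, (i <= 2 ^ n)%N -> `|f (grid 0 b n i) - f 0| <= 5 * A.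
Proof.
move=> A0 hA n i in2.
suff : `|f (grid 0 b n i) - f 0| <= A * (5 - 4 * (4 / 5) ^+ n).
  move/le_trans; apply; rewrite mulrC ler_wpM2r//.
  by rewrite gerBl mulr_ge0// exprn_ge0//; lra.
elim: n i in2 => [|n IH] i.
  rewrite expn0 expr0 mulr1; case: i => [|[|//]] _.
    rewrite /grid mulr0 mul0r addr0 subrr normr0 mulr_ge0//; lra.
  have := hA 0%N 0%N isT; rewrite expr0 mul1r.
  have -> : grid 0 b 0 0 = 0 by rewrite /grid mulr0 mul0r addr0.
  by move=> /le_trans; apply; lra.
have half j : grid 0 b n.+1 j.*2 = grid 0 b n j.
  rewrite /grid -mul2n natrM exprS; field.
  by rewrite gt_eqF// exprn_gt0.
have q0 : 0 <= (4 / 5 : R) ^+ n by rewrite exprn_ge0//; lra.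
move=> in2; have iE := odd_double_half i; case: (boolP (odd i)) => oi; last first.
  move: iE; rewrite (negbTE oi) add0n => iE.
  rewrite -iE half; apply: (le_trans (IH _ _)).
    by move: in2; rewrite -{1}iE expnS -mul2n leq_pmul2l.
  by rewrite ler_wpM2l// exprS; lra.
move: iE; rewrite oi add1n => iE; set j := i./2 in iE.
have jn : (j.*2 < 2 ^ n.+1)%N by rewrite iE.
have jn' : (j < 2 ^ n)%N by move: jn; rewrite expnS -mul2n ltn_pmul2l.
rewrite -iE.
have := hA n.+1 j.*2 jn; rewrite half => h1.
have h2 := IH j (ltnW jn').
have h3 : `|f (grid 0 b n.+1 j.*2.+1) - f (grid 0 b n j)| <= A * (4 / 5) ^+ n.+1.
  have p0 : 0 < (5 / 4 : R) ^+ n.+1 by rewrite exprn_gt0//; lra.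
  rewrite -(ler_pM2l p0) (le_trans h1)// mulrCA -exprMn.
  by rewrite (_ : 5 / 4 * (4 / 5) = 1) ?expr1n ?mulr1//; field.
rewrite -[_ - f 0](subrKA (f (grid 0 b n j))).
apply: (le_trans (ler_normD _ _)); apply: (le_trans (lerD h3 h2)).
by rewrite exprS -mulrDr ler_wpM2l//; lra.
Qed.

End grid.

Lemma nneseries_geometric_le {R : realType} (c z : R) : 0 <= c -> 0 <= z < 1 ->
  (\sum_(n <oo) (c * z ^+ n)%:E <= (c / (1 - z))%:E)%E.
Proof.
move=> c0 /andP[z0 z1]; have z10 : 0 < 1 - z by rewrite subr_gt0.
have t0 n : (0 <= (c * z ^+ n)%:E)%E by rewrite lee_fin mulr_ge0// exprn_ge0.
apply: lime_le; first by apply: is_cvg_nneseries => n _ _; exact: t0.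
apply: nearW => n; rewrite sumEFin lee_fin.
have := @geometric_seriesE R c z; rewrite lt_eqF// => /(_ isT).
move=> /(congr1 (fun u => u n)); rewrite /series/= => ->.
rewrite ler_pM2r ?invr_gt0// ler_piMr// gerBl exprn_ge0//.
Qed.

Section brownian_sup.
Context {R : realType} {d : measure_display} {Omega : measurableType d}.
Variables (P : probability Omega R) (F : R -> set (set Omega)).
Variables (W : R -> Omega -> R) (T : R).
Hypotheses (hF : usual_filtration P F) (hW : brownian_motion P F W).
Hypothesis T0 : 0 < T.

Definition grid_incr (n i : nat) (w : Omega) : R :=
  W (grid 0 T n i.+1) w - W (grid 0 T n i) w.

(** The maximum over the increments of a level is replaced by a sum, whose
    expectation is explicit. *)
Definition chain_level (q n : nat) (w : Omega) : R :=
  \sum_(i < 2 ^ n) ((5 / 4) ^+ n * `|grid_incr n i w|) ^+ q.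

Definition brownian_sup (q : nat) (w : Omega) : \bar R :=
  ((5 ^+ q)%:E * \sum_(n <oo) (chain_level q n w)%:E)%E.

Lemma chain_level_ge0 q n w : 0 <= chain_level q n w.
Proof. by apply: sumr_ge0 => i _; rewrite exprn_ge0// mulr_ge0// exprn_ge0//; lra. Qed.

Lemma brownian_sup_ge0 q w : (0 <= brownian_sup q w)%E.
Proof.
rewrite mule_ge0 ?lee_fin ?exprn_ge0// nneseries_ge0// => n _ _.
by rewrite lee_fin chain_level_ge0.
Qed.

Let grid0 n i : (i <= 2 ^ n)%N -> 0 <= grid 0 T n i.
Proof. by move=> in2; have /andP[] := grid_in (ltW T0) in2. Qed.

Let gridS n i : grid 0 T n i.+1 - grid 0 T n i = T / 2 ^+ n.
Proof. by rewrite /grid -(natr1 i); field; rewrite gt_eqF// exprn_gt0. Qed.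

Let grid_lt n i : grid 0 T n i < grid 0 T n i.+1.
Proof. by rewrite -subr_gt0 gridS divr_gt0// exprn_gt0. Qed.

Lemma measurable_chain_level q n : measurable_fun [set: Omega] (chain_level q n).
Proof.
apply: measurable_sum => i; apply: measurable_funX; apply: measurable_funM => //.
apply: measurableT_comp => //; apply: measurable_funB;
  by apply: (measurable_brownian hF hW); apply: grid0 => //; exact: ltnW.
Qed.

Lemma measurable_brownian_sup q : measurable_fun [set: Omega] (brownian_sup q).
Proof.
apply: measurable_funeM; apply: ge0_emeasurable_sum.
  by move=> n w _ _; rewrite lee_fin chain_level_ge0.
by move=> n _; apply/measurable_EFinP; exact: measurable_chain_level.
Qed.

Lemma ae_brownian_le_sup q : (0 < q)%N ->
  {ae P, forall w, forall t, 0 <= t <= T ->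
    ((`|W t w - W 0 w| ^+ q)%:E <= brownian_sup q w)%E}.
Proof.
move=> q0; apply: filterS (bm_path hW) => w cW t tT.
have cWT : {within `[0, T], continuous (W ^~ w)}.
  apply: continuous_subspaceW cW => u /=; rewrite !in_itv/= => /andP[-> _] //.
have s0 := brownian_sup_ge0 q w.
case: (ltP (brownian_sup q w) +oo%E) => [soo|]; last first.
  by rewrite leye_eq => /eqP ->; rewrite leey.
rewrite /brownian_sup in s0 soo *.
set X := (\sum_(n <oo) _)%E in s0 soo *.
have X0 : (0 <= X)%E by apply: nneseries_ge0 => n _ _; rewrite lee_fin chain_level_ge0.
have Xfin : X \is a fin_num.
  rewrite ge0_fin_numE// ltNge leye_eq; apply/negP => /eqP Xoo.
  by move: soo; rewrite Xoo gt0_muley ?lte_fin ?exprn_gt0.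
pose Y := fine X; have XE : X = Y%:E by rewrite fineK.
have Y0 : 0 <= Y by rewrite fine_ge0.
pose A := Y `^ (q%:R^-1).
have A0 : 0 <= A by exact: powR_ge0.
have Aq : A ^+ q = Y.
  by rewrite -powR_mulrn// -powRrM mulVf ?powRr1// pnatr_eq0 -lt0n.
have hA n i : (i < 2 ^ n)%N ->
    (5 / 4) ^+ n * `|W (grid 0 T n i.+1) w - W (grid 0 T n i) w| <= A.
  move=> in2; set u := _ * _.
  have u0 : 0 <= u by rewrite mulr_ge0// exprn_ge0//; lra.
  rewrite -(ler_pXn2r q0) ?nnegrE// Aq -lee_fin -XE.
  apply: le_trans (le_nneseries_term n _); last first.
    by move=> k; rewrite lee_fin chain_level_ge0.
  rewrite lee_fin /chain_level (bigD1 (Ordinal in2))//= lerDl sumr_ge0//.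
have bound : `|W t w - W 0 w| <= 5 * A.
  have g := @grid_chain _ (W ^~ w) T A A0 hA.
  rewrite ler_norml; apply/andP; split.
    rewrite -lerN2 opprK opprB.
    apply: (@continuous_grid_le _ 0 T (fun u => W 0 w - W u w) _ T0 _ _ t tT).
      move=> u; apply: (@continuousB _ _ _ (fun=> W 0 w)); last exact: cWT.
      exact: cst_continuous.
    by move=> n i in2; have := g n i in2; rewrite distrC => /(le_trans (ler_norm _)).
  apply: (@continuous_grid_le _ 0 T (fun u => W u w - W 0 w) _ T0 _ _ t tT).
    move=> u; apply: (@continuousB _ _ _ _ (fun=> W 0 w)); first exact: cWT.
    exact: cst_continuous.
  by move=> n i in2; have := g n i in2; move=> /(le_trans (ler_norm _)).
rewrite XE -EFinM lee_fin -Aq -exprMn lerXn2r ?nnegrE// mulr_ge0//.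
Qed.

(** There are 2^n increments of level n, each with moment of order
    (5/4)^(2 r n) 2^(- n r); the level contributes (2 (25/32)^r)^n, which is
    summable from r = 3 on. *)
Lemma brownian_sup_moment r : (3 <= r)%N ->
  exists K : R, (\int[P]_w brownian_sup r.*2 w <= K%:E)%E.
Proof.
move=> r3.
pose c := 2 * (r`!%:R * 3 ^+ r) * T ^+ r : R.
have c0 : 0 <= c.
  by apply: mulr_ge0; [apply: mulr_ge0 => //; apply: mulr_ge0 => //; exact: exprn_ge0
    |rewrite exprn_ge0// ltW].
pose z := 2 * (25 / 32) ^+ r : R.
have z01 : 0 <= z < 1.
  apply/andP; split; first by rewrite mulr_ge0// exprn_ge0//; lra.
  apply: (@le_lt_trans _ _ (2 * (25 / 32) ^+ 3)); last by rewrite !exprS expr0; lra.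
  by rewrite ler_wpM2l// ler_wiXn2l//; lra.
exists (5 ^+ r.*2 * (c / (1 - z))).
rewrite ge0_integralZl//; last 2 first.
- apply: ge0_emeasurable_sum; first by move=> n w _ _; rewrite lee_fin chain_level_ge0.
  by move=> n _; apply/measurable_EFinP; exact: measurable_chain_level.
- by move=> w _; apply: nneseries_ge0 => n _ _; rewrite lee_fin chain_level_ge0.
rewrite EFinM lee_wpmul2l ?lee_fin ?exprn_ge0//.
rewrite integral_nneseries//; last 2 first.
- by move=> n; apply/measurable_EFinP; exact: measurable_chain_level.
- by move=> n w _; rewrite lee_fin chain_level_ge0.
apply: le_trans (nneseries_geometric_le c0 z01).
apply: lee_nneseries => n _.
  by move=> _; apply: integral_ge0 => w _; rewrite lee_fin chain_level_ge0.
rewrite (eq_integral (fun w => \sum_(i < 2 ^ n)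
  (((5 / 4) ^+ n * `|grid_incr n i w|) ^+ r.*2)%:E)%E); last first.
  by move=> w _; rewrite sumEFin.
have p0 : 0 <= ((5 / 4) ^+ n) ^+ r.*2 :> R by rewrite !exprn_ge0//; lra.
have mD i : (i < 2 ^ n)%N -> measurable_fun [set: Omega]
    (fun w => (W (grid 0 T n i.+1) w - W (grid 0 T n i) w) ^+ r.*2).
  move=> in2; apply: measurable_funX; apply: measurable_funB;
  by apply: (measurable_brownian hF hW); apply: grid0 => //; exact: ltnW.
have term (i : 'I_(2 ^ n)) :
    (\int[P]_w (((5 / 4) ^+ n * `|grid_incr n i w|) ^+ r.*2)%:E
     <= (((5 / 4) ^+ n) ^+ r.*2 * (c / (2 ^+ n) ^+ r))%:E)%E.
  rewrite (eq_integral (fun w => (((5 / 4) ^+ n) ^+ r.*2)%:E *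
    ((W (grid 0 T n i.+1) w - W (grid 0 T n i) w) ^+ r.*2)%:E)%E); last first.
    by move=> w _; rewrite -EFinM exprMn normr_exprn_double.
  rewrite ge0_integralZl//; last 2 first.
  - by apply/measurable_EFinP; exact: mD.
  - by move=> w _; rewrite lee_fin exprn_even_ge0// odd_double.
  rewrite EFinM lee_wpmul2l ?lee_fin//.
  apply: le_trans (brownian_moment hF hW r (grid0 (ltnW (ltn_ord i))) (grid_lt n i)) _.
  by rewrite lee_fin gridS exprMn exprVn /c [leLHS]mulrA.
rewrite ge0_integral_sum//; last first.
  move=> i; apply/measurable_EFinP; apply: measurable_funX; apply: measurable_funM => //.
  apply: measurableT_comp => //; apply: measurable_funB;
  by apply: (measurable_brownian hF hW); apply: grid0 => //; exact: ltnW.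
apply: le_trans (lee_sum _ (fun i _ => term i)) _.
rewrite sumEFin lee_fin sumr_const card_ord -[leLHS]mulr_natl natrX.
rewrite le_eqVlt; apply/orP; left; apply/eqP.
have -> : ((5 / 4) ^+ n) ^+ r.*2 = ((25 / 16) ^+ r) ^+ n :> R.
  have -> : 25 / 16 = (5 / 4) ^+ 2 :> R by field.
  by rewrite -!exprM -mul2n mulnCA (mulnC n r) mulnA.
rewrite /z.
have -> : (2 ^+ n) ^+ r = (2 ^+ r) ^+ n :> R by rewrite -!exprM mulnC.
have -> : (25 / 32) ^+ r = (25 / 16) ^+ r / 2 ^+ r :> R.
  by rewrite -exprVn -exprMn; congr (_ ^+ _); field.
set u := (25 / 16) ^+ r; set v := 2 ^+ r; rewrite (exprMn _ 2) (exprMn _ u) exprVn.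
by move: (2 ^+ n) (u ^+ n) (_^-1) => a b e; ring.
Qed.

End brownian_sup.

(** * Suprema over the initial segment and over the mesh *)

Lemma dyadic_level {R : realType} (x : R) : 1 <= x ->
  exists j : nat, 2 ^+ j <= x < 2 ^+ j.+1.
Proof.
move=> x1; have : x < 2 ^+ (Num.truncn x).+1.
  apply: (lt_le_trans (truncnS_gt _)); rewrite -natrX ler_nat.
  exact/ltnW/ltn_expl.
elim: (Num.truncn x).+1 => [|n IH]; first by rewrite expr0 ltNge x1.
have [xn _|nx xn] := ltP x (2 ^+ n); first exact: IH.
by exists n; rewrite nx xn.
Qed.

Section mesh_suprema.
Context {R : realType} {d : measure_display} {Omega : measurableType d}.
Variables (P : probability Omega R) (F : R -> set (set Omega)).
Variables (W : R -> Omega -> R) (N : R -> Omega -> nat) (xi : R -> Omega -> R).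
Variables (beta gamma lambda mu sigma tau delta C0 C2 eps : R).
Hypotheses (hbeta : 0 < beta) (hgamma : 0 < gamma) (hlambda : 0 < lambda).
Hypotheses (hmu : 0 < mu) (hsigma : 0 < sigma) (htau : 0 < tau).
Hypotheses (hdelta : 0 <= delta) (hC0 : 0 < C0) (hC2 : 0 < C2).
Hypotheses (hC2delta : delta <= C2) (heps : 0 < eps).
Hypotheses (hF : usual_filtration P F) (hW : brownian_motion P F W).
Hypothesis hN : poisson_process P F beta N.
Hypothesis hxi : initial_segment P (F 0) tau xi.

Let Nt := compensated beta N.

Section initial_sup.
Variable e : nat.

(** Enumeration of the dyadic points of [-tau, 0]. *)
Definition init_point (k : nat) : R :=
  if unpickle k is Some (n, i) then grid (- tau) 0 n (minn i (2 ^ n)) else - tau.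

(** Supremum of the initial segment over a countable dense set, which is
    measurable. *)
Definition init_sup (w : Omega) : \bar R :=
  esups (fun k => (`|xi (init_point k) w| ^+ e)%:E) 0.

Let tau0 : - tau < 0. Proof. by rewrite oppr_lt0. Qed.

Lemma init_point_in k : - tau <= init_point k <= 0.
Proof.
rewrite /init_point; case: unpickle => [[n i]|]; last by rewrite lexx/= ltW.
by apply: grid_in; [exact: ltW|exact: geq_minr].
Qed.

Lemma measurable_init t : - tau <= t <= 0 -> measurable_fun [set: Omega] (xi t).
Proof.
move=> ht; apply: measurable_wrtT (init_measurable hxi ht).
exact: (filtration_sub hF (lexx 0)).
Qed.

Lemma measurable_init_sup : measurable_fun [set: Omega] init_sup.
Proof.
apply: measurable_fun_esups => k; apply/measurable_EFinP.
apply: measurable_funX; apply: measurableT_comp => //.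
exact: measurable_init (init_point_in k).
Qed.

Lemma init_sup_ub k w : ((`|xi (init_point k) w| ^+ e)%:E <= init_sup w)%E.
Proof. by apply: ereal_sup_ubound; exists k. Qed.

Lemma init_sup_ge0 w : (0 <= init_sup w)%E.
Proof. by apply: le_trans (init_sup_ub 0 w); rewrite lee_fin exprn_ge0. Qed.

Lemma init_sup_ge t w : - tau <= t <= 0 ->
  ((`|xi t w| ^+ e)%:E <= init_sup w)%E.
Proof.
move=> ht; have s0 := init_sup_ge0 w.
case E : (init_sup w) s0 => [c| |]// _; last by rewrite leey.
rewrite lee_fin; apply: (@continuous_grid_le _ (- tau) 0
  (fun u => `|xi u w| ^+ e) c tau0 _ _ t ht).
  have : {within `[- tau, 0], continuous (xi ^~ w)} by exact: (init_continuous hxi).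
  move/subspace_continuousP => cxi.
  apply/subspace_continuousP => u hu.
  have cp : {for xi u w, continuous (fun x : R => `|x| ^+ e)}.
    apply: (@continuous_comp _ _ _ (fun x : R => `|x|) (fun x => x ^+ e)).
      exact: norm_continuous.
    exact: exprn_continuous.
  exact: (cvg_comp _ _ (cxi u hu) cp).
move=> n i in2; rewrite -lee_fin -E.
have <- : init_point (pickle (n, i)) = grid (- tau) 0 n i.
  by rewrite /init_point pickleK (minn_idPl in2).
exact: init_sup_ub.
Qed.

Lemma init_sup_moment : (0 < e)%N ->
  exists K : R, (\int[P]_w init_sup w <= K%:E)%E.
Proof.
move=> e0; set I := (\int[P]_w sup_pow xi (- tau) 0 e%:R w)%E.
have le w : (init_sup w <= sup_pow xi (- tau) 0 e%:R w)%E.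
  apply: ge_ereal_sup => _ [k _ <-].
  by apply: sup_pow_ge; exact: init_point_in.
have I0 : (0 <= I)%E.
  apply: integral_ge0 => w _; apply: le_trans (le w); exact: init_sup_ge0.
have Ioo : (I < +oo)%E by apply: (init_moments hxi); rewrite ltr0n.
exists (fine I); rewrite fineK ?ge0_fin_numE//.
by apply: ge0_le_integral_pw => // w; exact: init_sup_ge0.
Qed.

End initial_sup.

Section majorant.
Variables (m : nat) (h : R) (s : int -> Omega -> R).
Hypotheses (m0 : (0 < m)%N) (hE : h = tau / m%:R) (h1 : h < 1).
Hypothesis hs :
  is_bim lambda mu sigma gamma delta C0 C2 eps W Nt xi h m s.
Variables (n r : nat).
Let e := r.+1.

(** Contribution to the majorant of the event that the maximum over the mesh is
    between 2^j and 2^(j+1). *)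
Definition level_term (j : nat) (w : Omega) : R :=
  2 ^+ e * (2^-1 ^+ e) ^+ j * `|stopped m s (2 ^+ j) (m + n) w| ^+ e.*2.

Definition path_majorant (w : Omega) : \bar R :=
  (1%:E + (2 ^+ e)%:E * init_sup e w + \sum_(j <oo) (level_term j w)%:E)%E.

Let h2 : 0 <= 2 ^+ e :> R. Proof. exact: exprn_ge0. Qed.
Let hf j : 0 <= 2 ^+ e * (2^-1 ^+ e) ^+ j :> R.
Proof. by rewrite mulr_ge0// !exprn_ge0. Qed.

Lemma level_term_ge0 j w : 0 <= level_term j w.
Proof. by rewrite /level_term mulr_ge0// exprn_ge0. Qed.

Let series_ge0 w : (0 <= \sum_(j <oo) (level_term j w)%:E)%E.
Proof. by apply: nneseries_ge0 => j _ _; rewrite lee_fin level_term_ge0. Qed.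

Let init_ge0 w : (0 <= (2 ^+ e)%:E * init_sup e w)%E.
Proof. by rewrite mule_ge0 ?lee_fin// init_sup_ge0. Qed.

Lemma path_majorant_ge0 w : (0 <= path_majorant w)%E.
Proof. by rewrite /path_majorant !adde_ge0. Qed.

(** If x lies in [2^j, 2^(j+1)[ for some j, then either a value of the initial
    segment already reaches 2^j, or the scheme stopped at level 2^j ends at or
    above 2^j, and then level_term j is at least 2^e (2^j)^e. *)
Lemma path_majorant_ge (i : nat) w : (i <= m + n)%N ->
  ((`|shifted m s i w| ^+ e)%:E <= path_majorant w)%E.
Proof.
move=> imn; set x := `|_|; have x0 : 0 <= x by exact: normr_ge0.
have [x1|x1] := leP x 1.
  apply: (@le_trans _ _ 1%:E); first by rewrite lee_fin exprn_ile1.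
  by rewrite /path_majorant -addeA leeDl// adde_ge0.
have [j /andP[jx xj]] := dyadic_level (ltW x1).
have L0 : 0 < 2 ^+ j :> R by rewrite exprn_gt0.
have xe : x ^+ e <= 2 ^+ e * (2 ^+ j) ^+ e.
  rewrite -exprMn -exprS; apply: lerXn2r; rewrite ?nnegrE.
  - exact: normr_ge0.
  - exact: exprn_ge0.
  - exact: ltW xj.
case: (boolP (alive m s (2 ^+ j) m w)) => am; last first.
  have [i' im' Lz] := aliveN_lt am.
  apply: (@le_trans _ _ ((2 ^+ e)%:E * init_sup e w)%E); last first.
    by rewrite /path_majorant addeAC leeDr// adde_ge0.
  apply: (@le_trans _ _ ((2 ^+ e)%:E * (`|shifted m s i' w| ^+ e)%:E)%E).
    rewrite -EFinM lee_fin; apply: (le_trans xe); rewrite ler_wpM2l//.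
    by rewrite lerXn2r ?nnegrE// ltW.
  rewrite lee_wpmul2l ?lee_fin// (shifted_init hs _ im').
  by apply: init_sup_ge; exact: (mesh_init htau m0 hE im').
have an : ~~ alive m s (2 ^+ j) (m + n) w.
  by apply/negP => /(alive_lt imn); rewrite ltNge jx.
have Ls := stopped_exit am an.
apply: (@le_trans _ _ (level_term j w)%:E); last first.
  apply: (le_trans (@le_nneseries_term _ (fun k => (level_term k w)%:E) j _)).
    by move=> k; rewrite lee_fin level_term_ge0.
  by rewrite /path_majorant leeDr// adde_ge0.
rewrite lee_fin; apply: (le_trans xe); rewrite /level_term -mulrA ler_wpM2l//.
apply: (@le_trans _ _ ((2^-1 ^+ e) ^+ j * (2 ^+ j) ^+ e.*2)); last first.
  by rewrite ler_wpM2l ?exprn_ge0// lerXn2r ?nnegrE// ltW.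
rewrite -addnn exprD mulrA.
have -> : (2^-1 ^+ e) ^+ j * (2 ^+ j) ^+ e = 1 :> R.
  by rewrite -exprM mulnC exprM -exprMn -exprMn mulVf// !expr1n.
by rewrite mul1r.
Qed.

Let measurable_level j : measurable_fun [set: Omega] (level_term j).
Proof.
apply: measurable_funM => //.
exact: (measurable_stopped_moment hsigma htau hC0 hC2 hF hW hN hxi m0 hE hs).
Qed.

Lemma measurable_path_majorant : measurable_fun [set: Omega] path_majorant.
Proof.
apply: emeasurable_funD.
  apply: emeasurable_funD => //; apply: measurable_funeM.
  exact: measurable_init_sup.
apply: ge0_emeasurable_sum; first by move=> j w _ _; rewrite lee_fin level_term_ge0.
by move=> j _; apply/measurable_EFinP.
Qed.

(** The moments of the stopped schemes are bounded uniformly in the level, so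
    the factors 2^(- j e) make the series converge. *)
Lemma path_majorant_moment (K : R) : 0 <= K ->
  (forall L : R, 0 < L ->
    (\int[P]_w (`|stopped m s L (m + n) w| ^+ e.*2)%:E <= K%:E)%E) ->
  (\int[P]_w path_majorant w
    <= 1%:E + (2 ^+ e)%:E * \int[P]_w init_sup e w + (2 ^+ e * K * 2)%:E)%E.
Proof.
move=> K0 hK; have mI := measurable_init_sup e.
have mJ : measurable_fun [set: Omega] (fun w => (2 ^+ e)%:E * init_sup e w)%E.
  exact: measurable_funeM.
have ml j : measurable_fun [set: Omega] (fun w => (level_term j w)%:E).
  exact/measurable_EFinP.
rewrite ge0_integralD//; last 3 first.
- by move=> w _; rewrite adde_ge0.
- exact: emeasurable_funD.
- apply: ge0_emeasurable_sum => //.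
  by move=> j w _ _; rewrite lee_fin level_term_ge0.
rewrite ge0_integralD// integral_prob_cst ge0_integralZl//; last first.
  by move=> w _; exact: init_sup_ge0.
apply: leeD => //.
rewrite integral_nneseries//; last by move=> j w _; rewrite lee_fin level_term_ge0.
have := @nneseries_geometric_le R (2 ^+ e * K) 2^-1.
rewrite (_ : _ / (1 - 2^-1) = 2 ^+ e * K * 2); last by field.
have c0 : 0 <= 2 ^+ e * K by rewrite mulr_ge0.
have h01 : 0 <= (2^-1 : R) < 1 by lra.
move=> /(_ c0 h01) /(le_trans _); apply.
apply: lee_nneseries => j _.
  by move=> _; apply: integral_ge0 => w _; rewrite lee_fin level_term_ge0.
rewrite /level_term; under eq_integral do rewrite EFinM.
have mS := measurable_stopped_moment hsigma htau hC0 hC2 hF hW hN hxi m0 hE hs.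
rewrite ge0_integralZl//; last by apply/measurable_EFinP; exact: mS.
have L0 : 0 < 2 ^+ j :> R by rewrite exprn_gt0.
apply: le_trans (lee_wpmul2l _ (hK _ L0)) _; first by rewrite lee_fin.
rewrite -EFinM lee_fin mulrAC ler_wpM2l//.
rewrite -exprM; apply: ler_wiXn2l; [lra|lra|].
by rewrite mulSn leq_addr.
Qed.

End majorant.

Lemma path_majorant_moment_bound (J r : nat) : exists K : R,
  forall (m : nat) (h : R) (s : int -> Omega -> R),
  (0 < m)%N -> h = tau / m%:R -> h < 1 ->
  is_bim lambda mu sigma gamma delta C0 C2 eps W Nt xi h m s ->
  (\int[P]_w path_majorant m s (J * m) r w <= K%:E)%E.
Proof.
have [K hK] := stopped_moment_bound hbeta hgamma hlambda hmu hsigma htau hdelta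
  hC0 hC2 heps hF hW hN hxi J r.
have [I hI] := init_sup_moment (isT : 0 < r.+1)%N.
pose K' := Num.max K 0; have K'0 : 0 <= K' by rewrite le_max lexx orbT.
exists (1 + 2 ^+ r.+1 * I + 2 ^+ r.+1 * K' * 2) => m h s m0 hE h1 hs.
apply: (le_trans (path_majorant_moment m0 hE hs K'0 _)).
  move=> L L0; apply: le_trans (hK m h s m0 hE h1 hs L _ L0 (leqnn _)) _.
  by rewrite lee_fin le_max lexx.
rewrite !EFinD; apply: leeD => //; apply: leeD => //.
by rewrite [in leRHS]EFinM lee_wpmul2l// lee_fin exprn_ge0.
Qed.

Definition approx_const : R := 2 + lambda * (mu + 1) + sigma + 2 * (delta * beta).

Lemma approx_const_ge0 : 0 <= approx_const.
Proof.
rewrite /approx_const !addr_ge0 ?mulr_ge0 ?addr_ge0 ?(ltW hlambda) ?(ltW hmu)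
  ?(ltW hsigma) ?(ltW hbeta)//.
Qed.

(** The jump term is where the balancing matters: the increment u of the
    compensated process over part of the step is at most |n| + 2 beta in
    absolute value, n being the increment over the whole step, and
    delta |n| <= C, so that dividing by 1 + C leaves a bounded multiple of x. *)
Lemma approx_bound (m : nat) (h : R) (s : int -> Omega -> R) (S : R -> Omega -> R)
    (k : nat) (t : R) (w : Omega) :
  (0 < m)%N -> h = tau / m%:R -> h < 1 ->
  is_bim_approx lambda mu sigma gamma delta C0 C2 eps W Nt xi h m tau s S ->
  (forall u v, 0 <= u -> u <= v -> (N u w <= N v w)%N) ->
  mesh h k%:Z <= t <= mesh h k.+1%:Z ->
  `|S t w| <= approx_const * ((1 + `|shifted m s (m + k) w|)
     * delay_factor gamma (shifted m s k w)
     * (1 + `|W t w - W (mesh h k%:Z) w|)).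
Proof.
move=> m0 hE h1 hS Nmono tk; have h0 := step_gt0 htau m0 hE.
rewrite (approx_step hS w tk) (shifted_mesh m) /bim_C (shifted_mesh m).
rewrite -/(shifted m s k w) /mesh_incr.
have /andP[tk0 tk1] := tk.
set x := shifted m s (m + k) w; set y := shifted m s k w.
set V := W t w - _; set dW := W _ w - W _ w; set u := Nt t w - _.
set n := Nt _ w - Nt _ w.
have C_ge0 := bim_C_ge0 gamma eps hsigma hC0 hC2 x y dW n h0.
set C := C0 * h + _ + _ in C_ge0 *.
have iC : 0 < 1 + C by lra.
have iC0 : 0 <= (1 + C)^-1 by rewrite invr_ge0 ltW.
have iC1 : (1 + C)^-1 <= 1 by rewrite invf_le1//; lra.
have ax : 0 <= `|x| by [].
have aV : 0 <= `|V| by [].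
have Z1 := delay_factor_ge1 gamma y.
have yZ := powR_le_delay_factor hgamma y.
set Z := delay_factor gamma y in Z1 yZ *.
have th0 : 0 <= t - mesh h k%:Z by rewrite subr_ge0.
have th1 : t - mesh h k%:Z <= 1.
  apply: (@le_trans _ _ h); last exact: ltW.
  by have := meshS h k; move: tk1; lra.
have drift : `|lambda * (mu - x) * (t - mesh h k%:Z) / (1 + C)|
    <= lambda * (mu + 1) * (1 + `|x|).
  rewrite normrM (ger0_norm iC0) normrM (ger0_norm th0) normrM (gtr0_norm hlambda).
  apply: (@le_trans _ _ (lambda * (mu + `|x|))).
    rewrite -[leRHS]mulr1; apply: ler_pM => //; first by rewrite !mulr_ge0// ltW.
    rewrite -[leRHS]mulr1; apply: ler_pM => //; first by rewrite mulr_ge0// ltW.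
    rewrite ler_wpM2l ?(ltW hlambda)// (le_trans (ler_normB _ _))//.
    by rewrite gtr0_norm.
  rewrite -mulrA ler_wpM2l ?(ltW hlambda)//.
  by have := mulr_ge0 (ltW hmu) ax; lra.
have sx : Num.sqrt `|x| <= 1 + `|x|.
  rewrite -{2}(sqr_sqrtr ax); have := sqr_ge0 (Num.sqrt `|x| - 1).
  have := sqrtr_ge0 `|x|; move: (Num.sqrt _) => v; nra.
have diff : `|sigma * `|y| `^ gamma * Num.sqrt `|x| * V / (1 + C)|
    <= sigma * (Z * (1 + `|x|) * `|V|).
  rewrite normrM (ger0_norm iC0) -[leRHS]mulr1; apply: ler_pM => //.
  rewrite !normrM (gtr0_norm hsigma) (ger0_norm (powR_ge0 _ _)).
  rewrite (ger0_norm (sqrtr_ge0 _)) -!mulrA ler_wpM2l ?(ltW hsigma)//.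
  apply: ler_pM.
  - exact: powR_ge0.
  - by apply: mulr_ge0; rewrite ?sqrtr_ge0.
  - exact: yZ.
  - by rewrite ler_wpM2r.
have k0 := mesh_ge0 htau m0 hE k.
have Nt1 := Nmono _ _ k0 tk0.
have Nt2 := Nmono _ _ (le_trans k0 tk0) tk1.
have jump : `|delta * x * u / (1 + C)| <= (1 + 2 * (delta * beta)) * (1 + `|x|).
  rewrite normrM (ger0_norm iC0) ler_pdivrMr// normrM normrM (ger0_norm hdelta).
  have un : `|u| <= `|n| + 2 * beta.
    have uE : u = (N t w)%:R - (N (mesh h k%:Z) w)%:R - beta * (t - mesh h k%:Z).
      by rewrite /u /Nt /compensated; ring.
    have nE : n = (N (mesh h k.+1%:Z) w)%:R - (N (mesh h k%:Z) w)%:R - beta * h.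
      have -> : beta * h = beta * mesh h k.+1%:Z - beta * mesh h k%:Z.
        by have := meshS h k => hk; rewrite -mulrBr; congr (_ * _); move: hk; lra.
      by rewrite /n /mesh_incr /Nt /compensated; ring.
    move: Nt1 Nt2; rewrite -!(ler_nat R) => Nt1 Nt2.
    have b1 : beta * (t - mesh h k%:Z) <= beta by rewrite ler_piMr// ltW.
    have b2 : beta * h <= beta by rewrite ler_piMr// ltW.
    have b3 : 0 <= beta * (t - mesh h k%:Z) by rewrite mulr_ge0// ltW.
    have b4 : 0 <= beta * h by rewrite mulr_ge0// ltW.
    have := ler_norm n; have := normr_ge0 n; move: `|n| => v v0 nv.
    rewrite nE in nv; rewrite uE ler_norml; apply/andP.
    by move: b1 b2 b3 b4 v0 nv Nt1 Nt2 => *; split; lra.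
  have dC : delta * `|n| <= C.
    apply: (@le_trans _ _ (C2 * `|n|)); first by rewrite ler_wpM2r.
    by rewrite /C lerDr addr_ge0// mulr_ge0 ?bim_C1_ge0// ltW.
  have db : 0 <= delta * beta by rewrite mulr_ge0// ltW.
  have du : delta * `|u| <= (1 + 2 * (delta * beta)) * (1 + C).
    apply: (@le_trans _ _ (delta * (`|n| + 2 * beta))); first by rewrite ler_wpM2l.
    by rewrite mulrDr mulrCA; have := mulr_ge0 db C_ge0; nra.
  rewrite mulrAC [leRHS]mulrAC; apply: ler_pM => //; first by rewrite mulr_ge0.
  by rewrite lerDr.
rewrite [in leLHS]mulrDl [in leLHS]mulrDl.
apply: (@le_trans _ _ (`|x| + (lambda * (mu + 1) * (1 + `|x|)
   + sigma * (Z * (1 + `|x|) * `|V|) + (1 + 2 * (delta * beta)) * (1 + `|x|)))).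
  apply: (le_trans (ler_normD _ _)); rewrite lerD2l.
  apply: (le_trans (ler_normD _ _)); apply: lerD => //.
  by apply: (le_trans (ler_normD _ _)); apply: lerD.
pose G := (1 + `|x|) * Z * (1 + `|V|).
have G1 : 1 + `|x| <= G.
  rewrite /G -mulrA ler_peMr ?addr_ge0//.
  by rewrite -[leLHS]mulr1; apply: ler_pM => //; lra.
have G2 : Z * (1 + `|x|) * `|V| <= G.
  rewrite /G (mulrC Z) ler_wpM2l ?mulr_ge0 ?addr_ge0//; lra.
have l0 : 0 <= lambda * (mu + 1) by rewrite mulr_ge0 ?addr_ge0// ltW.
have db : 0 <= 1 + 2 * (delta * beta) by rewrite addr_ge0// !mulr_ge0// ltW.
have e1 := ler_wpM2l l0 G1.
have e2 := ler_wpM2l (ltW hsigma) G2.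
have e3 := ler_wpM2l db G1.
rewrite -/G; have -> : approx_const * G = G + lambda * (mu + 1) * G + sigma * G
  + (1 + 2 * (delta * beta)) * G by rewrite /approx_const; ring.
move: e1 e2 e3 G1; move: (lambda * _) => a; lra.
Qed.

End mesh_suprema.

(** * Suprema between mesh points *)

(** Each factor is at most the largest of the three. *)
Lemma exprn_mul3_le {R : realType} (a : nat) (x y z : R) :
  0 <= x -> 0 <= y -> 0 <= z ->
  (x * y * z) ^+ a <= x ^+ (3 * a) + y ^+ (3 * a) + z ^+ (3 * a).
Proof.
move=> x0 y0 z0; pose M := Num.max x (Num.max y z).
have xM : x <= M by rewrite le_max lexx.
have yM : y <= M by rewrite !le_max lexx orbT.
have zM : z <= M by rewrite !le_max lexx !orbT.
have M0 : 0 <= M by exact: le_trans xM.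
have px := exprn_ge0 (3 * a) x0; have py := exprn_ge0 (3 * a) y0.
have pz := exprn_ge0 (3 * a) z0.
apply: (@le_trans _ _ (M ^+ (3 * a))).
  rewrite exprM lerXn2r ?nnegrE ?exprn_ge0 ?mulr_ge0//.
  by rewrite !exprS expr0 mulr1 mulrA !ler_pM ?mulr_ge0.
have : M = x \/ M = y \/ M = z.
  rewrite /M; case: (leP x); last by left.
  by case: (leP y) => _ _; [right; right|right; left].
by case=> [->|[->|->]]; lra.
Qed.

(** Separates the product in [approx_bound] into a sum of powers of the single
    factors, so that no joint moments are needed.  The power of u + v is raised
    from b to q to match the available Brownian moments. *)
Lemma approx_factors_le {R : realType} (D x y u v : R) (b c a : nat) (q : nat) :
  0 <= D -> 0 <= x -> 0 <= y -> 0 <= u -> 0 <= v -> b = (3 * a)%N -> (b <= q)%N ->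
  (D * ((1 + x) * (2 + y ^+ c) * (1 + (u + v)))) ^+ a <=
    D ^+ a * 2 ^+ b *
    (4 + 2 ^+ b + x ^+ b + y ^+ (c * b) + 2 ^+ q * (u ^+ q + v ^+ q)).
Proof.
move=> D0 x0 y0 u0 v0 bE bq; have yc := exprn_ge0 c y0.
have uv0 := addr_ge0 u0 v0.
rewrite exprMn -[leRHS]mulrA ler_wpM2l ?exprn_ge0//.
have X0 : 0 <= 1 + x by lra.
have Y0 : 0 <= 2 + y ^+ c by lra.
have V0 : 0 <= 1 + (u + v) by lra.
apply: (le_trans (exprn_mul3_le a X0 Y0 V0)); rewrite -bE.
have e1 := exprnD_le b (ler01 : 0 <= 1 :> R) x0.
have e2 := exprnD_le b (ler0n _ 2 : 0 <= 2 :> R) yc.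
have e3 := exprnD_le b (ler01 : 0 <= 1 :> R) uv0.
have e4 : (u + v) ^+ b <= 1 + (u + v) ^+ q.
  rewrite -[leLHS]powR_mulrn//.
  by apply: powR_le1D_exprn; rewrite ?ler_nat// ler0n.
have e5 := exprnD_le q u0 v0.
rewrite exprM; rewrite !expr1n in e1 e3.
have e6 : 0 <= 2 ^+ b :> R by exact: exprn_ge0.
move: e1 e2 e3; set t := 2 ^+ b in e6 *; move=> e1 e2 e3.
have e7 := le_trans e4 (lerD (lexx 1) e5).
have e8 : t * (1 + (u + v) ^+ b) <= t * (1 + (1 + 2 ^+ q * (u ^+ q + v ^+ q))).
  by rewrite ler_wpM2l// lerD2l.
apply: (le_trans (lerD (lerD e1 e2) (le_trans e3 e8))).
rewrite -!mulrDr ler_wpM2l//; set Q := _ * (_ + _).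
move: (x ^+ b) (_ ^+ b) Q => A B Q; lra.
Qed.

Section approximation.
Context {R : realType} {d : measure_display} {Omega : measurableType d}.
Variables (P : probability Omega R) (F : R -> set (set Omega)).
Variables (W : R -> Omega -> R) (N : R -> Omega -> nat) (xi : R -> Omega -> R).
Variables (beta gamma lambda mu sigma tau delta C0 C2 eps : R).
Hypotheses (hbeta : 0 < beta) (hgamma : 0 < gamma) (hlambda : 0 < lambda).
Hypotheses (hmu : 0 < mu) (hsigma : 0 < sigma) (htau : 0 < tau).
Hypotheses (hdelta : 0 <= delta) (hC0 : 0 < C0) (hC2 : 0 < C2).
Hypotheses (hC2delta : delta <= C2) (heps : 0 < eps).
Hypotheses (hF : usual_filtration P F) (hW : brownian_motion P F W).
Hypothesis hN : poisson_process P F beta N.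
Hypothesis hxi : initial_segment P (F 0) tau xi.

Let Nt := compensated beta N.
Variable T : R.
Hypothesis hT : 0 < T.

(** The number of mesh steps up to time T is at most a number of blocks, fixed
    once and for all, times m. *)
Lemma mesh_index (m : nat) (h t : R) :
  (0 < m)%N -> h = tau / m%:R -> 0 <= t -> t <= T ->
  exists2 k, (k <= (Num.truncn (T / tau)).+1 * m)%N
           & mesh h k%:Z <= t <= mesh h k.+1%:Z.
Proof.
move=> m0 hE t0 tT; have h0 := step_gt0 htau m0 hE.
have th0 : 0 <= t / h by rewrite divr_ge0// ltW.
exists (Num.truncn (t / h)).
  rewrite -(ler_nat R); apply: (@le_trans _ _ (t / h)); first by rewrite truncn_le.
  rewrite natrM ler_pdivrMr// -mulrA (step_mul m0 hE) -ler_pdivrMr//.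
  apply: (@le_trans _ _ (T / tau)); last exact/ltW/truncnS_gt.
  by rewrite ler_wpM2r// invr_ge0 ltW.
have /andP[k1 /ltW k2] := truncn_itv th0.
by rewrite !meshE -ler_pdivlMr// k1 -ler_pdivrMr.
Qed.

(** The exponent b comes from splitting a product of three factors, c is the
    resulting exponent of the delayed value, and q is an even number above b
    that is large enough for [brownian_sup_moment]. *)
Section majorant.
Variables (m : nat) (h : R) (s : int -> Omega -> R) (S : R -> Omega -> R).
Hypotheses (m0 : (0 < m)%N) (hE : h = tau / m%:R) (h1 : h < 1).
Hypothesis hs : is_bim lambda mu sigma gamma delta C0 C2 eps W Nt xi h m s.
Hypothesis hS :
  is_bim_approx lambda mu sigma gamma delta C0 C2 eps W Nt xi h m tau s S.
Variable a : nat.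

Let J := (Num.truncn (T / tau)).+1.
Let b := (3 * a.+1)%N.
Let c := (delay_exp gamma * b)%N.
Let q := (b + 3).*2%N.
Let D := approx_const beta lambda mu sigma delta ^+ a.+1 * 2 ^+ b.

Definition approx_majorant (w : Omega) : \bar R :=
  (1%:E + init_sup xi tau a.+1 w
   + D%:E * ((4 + 2 ^+ b)%:E + path_majorant xi tau m s (J * m) b.-1 w
       + path_majorant xi tau m s (J * m) c.-1 w
       + (2 ^+ q)%:E * (2%:E * brownian_sup W T q w)))%E.

Let D_ge0 : 0 <= D.
Proof. by rewrite mulr_ge0// exprn_ge0// approx_const_ge0. Qed.

Lemma approx_le_majorant (w : Omega) (t : R) :
  (forall u v, 0 <= u -> u <= v -> (N u w <= N v w)%N) ->
  (forall u, 0 <= u <= T -> ((`|W u w - W 0 w| ^+ q)%:E <= brownian_sup W T q w)%E) ->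
  - tau <= t <= T -> ((1 + `|S t w| ^+ a.+1)%:E <= approx_majorant w)%E.
Proof.
move=> Nmono hB tT; rewrite EFinD.
have I0 := init_sup_ge0 xi tau a.+1 w.
have p1 := path_majorant_ge0 xi tau m s (J * m) b.-1 w.
have p2 := path_majorant_ge0 xi tau m s (J * m) c.-1 w.
have B0 := brownian_sup_ge0 W T q w.
have inner0 : (0 <= (4 + 2 ^+ b)%:E + path_majorant xi tau m s (J * m) b.-1 w
       + path_majorant xi tau m s (J * m) c.-1 w
       + (2 ^+ q)%:E * (2%:E * brownian_sup W T q w))%E.
  have k0 : (0 <= (4 + 2 ^+ b)%:E :> \bar R)%E.
    by rewrite lee_fin addr_ge0// exprn_ge0.
  apply: adde_ge0; first exact: adde_ge0 (adde_ge0 k0 p1) p2.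
  by rewrite mule_ge0 ?lee_fin ?exprn_ge0// mule_ge0.
have [t0|t0] := leP t 0.
  have ht : - tau <= t <= 0 by have /andP[-> _] := tT.
  rewrite (approx_init hS _ ht) /approx_majorant -[leLHS]adde0.
  apply: leeD; last by rewrite mule_ge0.
  by rewrite leeD2l// (init_sup_ge htau hxi).
have t1 : t <= T by have /andP[_ ->] := tT.
have [k kJ tk] := mesh_index m0 hE (ltW t0) t1.
have /andP[tk0 _] := tk; have k0 := mesh_ge0 htau m0 hE k.
rewrite /approx_majorant; apply: leeD; first by rewrite leeDl.
have := approx_bound hbeta hgamma hlambda hmu hsigma htau hdelta hC0 hC2
  hC2delta m0 hE h1 hS Nmono tk.
set x := shifted m s (m + k) w; set y := shifted m s k w => hSt.
have V_le : `|W t w - W (mesh h k%:Z) w|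
    <= `|W t w - W 0 w| + `|W (mesh h k%:Z) w - W 0 w|.
  by rewrite (distrC (W (mesh h _) w)); exact: ler_distD.
have aD0 : 0 <= approx_const beta lambda mu sigma delta.
  exact: approx_const_ge0.
have V0 := addr_ge0 (normr_ge0 (W t w - W 0 w)) (normr_ge0 (W (mesh h k%:Z) w - W 0 w)).
have Spow : `|S t w| ^+ a.+1 <= D * (4 + 2 ^+ b + `|x| ^+ b + `|y| ^+ c
    + 2 ^+ q * (`|W t w - W 0 w| ^+ q + `|W (mesh h k%:Z) w - W 0 w| ^+ q)).
  apply: le_trans (approx_factors_le _ aD0 (normr_ge0 x) (normr_ge0 y)
    (normr_ge0 _) (normr_ge0 _) erefl _); last by rewrite /q -addnn -addnA leq_addr.
  apply: lerXn2r; rewrite ?nnegrE ?normr_ge0//.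
    by rewrite mulr_ge0// !mulr_ge0// !addr_ge0// exprn_ge0.
  apply: (le_trans hSt); rewrite ler_wpM2l//.
  have Z1 := delay_factor_ge1 gamma y.
  apply: ler_wpM2l; last by rewrite lerD2l.
  by apply: mulr_ge0; [rewrite addr_ge0|lra].
have wb u : 0 <= u <= T -> ((`|W u w - W 0 w| ^+ q)%:E <= brownian_sup W T q w)%E.
  exact: hB.
have kT : mesh h k%:Z <= T by exact: le_trans t1.
have B1 := wb t; rewrite (ltW t0) t1 in B1.
have B2 := wb (mesh h k%:Z); rewrite k0 kT in B2.
apply: (@le_trans _ _ (D * (4 + 2 ^+ b + `|x| ^+ b + `|y| ^+ c
    + 2 ^+ q * (`|W t w - W 0 w| ^+ q + `|W (mesh h k%:Z) w - W 0 w| ^+ q)))%:E).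
  by rewrite lee_fin.
rewrite EFinM lee_wpmul2l ?lee_fin// 3!EFinD; apply: leeD; last first.
  rewrite EFinM lee_wpmul2l ?lee_fin ?exprn_ge0// EFinD mule_natl mule2n.
  apply: leeD; [exact: B1|exact: B2].
have bE : b.-1.+1 = b by [].
have cE : c.-1.+1 = c by rewrite prednK// /c muln_gt0.
apply: leeD; last first.
  rewrite -{1}cE; apply: (path_majorant_ge htau hxi m0 hE hs).
  exact: leq_trans kJ (leq_addl _ _).
rewrite leeD2l// -{1}bE; apply: (path_majorant_ge htau hxi m0 hE hs).
by rewrite leq_add2l.
Qed.

Lemma approx_majorant_ge0 w : (0 <= approx_majorant w)%E.
Proof.
have I0 := init_sup_ge0 xi tau a.+1 w.
have p1 := path_majorant_ge0 xi tau m s (J * m) b.-1 w.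
have p2 := path_majorant_ge0 xi tau m s (J * m) c.-1 w.
have B0 := brownian_sup_ge0 W T q w.
have k0 : (0 <= (4 + 2 ^+ b)%:E :> \bar R)%E.
  by rewrite lee_fin addr_ge0// exprn_ge0.
apply: adde_ge0; first exact: adde_ge0.
apply: mule_ge0 => //; apply: adde_ge0; first exact: adde_ge0 (adde_ge0 k0 p1) p2.
by rewrite mule_ge0 ?lee_fin ?exprn_ge0// mule_ge0.
Qed.

Lemma measurable_approx_majorant : measurable_fun [set: Omega] approx_majorant.
Proof.
have mp := measurable_path_majorant hsigma htau hC0 hC2 hF hW hN hxi m0 hE hs.
have mI := @measurable_init_sup _ _ _ _ _ _ _ htau hF hxi a.+1.
apply: emeasurable_funD; first exact: emeasurable_funD.
apply: measurable_funeM; apply: emeasurable_funD.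
  by apply: emeasurable_funD; first apply: emeasurable_funD.
apply: measurable_funeM; apply: measurable_funeM.
exact: measurable_brownian_sup hF hW hT q.
Qed.

Lemma approx_majorant_moment (I K1 K2 B : R) :
  (\int[P]_w init_sup xi tau a.+1 w <= I%:E)%E ->
  (\int[P]_w path_majorant xi tau m s (J * m) b.-1 w <= K1%:E)%E ->
  (\int[P]_w path_majorant xi tau m s (J * m) c.-1 w <= K2%:E)%E ->
  (\int[P]_w brownian_sup W T q w <= B%:E)%E ->
  (\int[P]_w approx_majorant w
    <= (1 + I + D * (4 + 2 ^+ b + K1 + K2 + 2 ^+ q * (2 * B)))%:E)%E.
Proof.
move=> hI hK1 hK2 hB.
have mp := measurable_path_majorant hsigma htau hC0 hC2 hF hW hN hxi m0 hE hs.
have mI := @measurable_init_sup _ _ _ _ _ _ _ htau hF hxi a.+1.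
have mB : measurable_fun [set: Omega] (brownian_sup W T q).
  exact: measurable_brownian_sup hF hW hT q.
have I0 := init_sup_ge0 xi tau a.+1.
have p1 := path_majorant_ge0 xi tau m s (J * m) b.-1.
have p2 := path_majorant_ge0 xi tau m s (J * m) c.-1.
have B0 := brownian_sup_ge0 W T q.
have k0 : (0 <= (4 + 2 ^+ b)%:E :> \bar R)%E.
  by rewrite lee_fin addr_ge0// exprn_ge0.
have q0 : (0 <= (2 ^+ q)%:E :> \bar R)%E by rewrite lee_fin exprn_ge0.
have mqB : measurable_fun [set: Omega]
    (fun w => (2 ^+ q)%:E * (2%:E * brownian_sup W T q w))%E.
  by apply: measurable_funeM; exact: measurable_funeM.
have qB0 w : (0 <= (2 ^+ q)%:E * (2%:E * brownian_sup W T q w))%E.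
  by rewrite mule_ge0// mule_ge0// lee_fin.
have mp1 : measurable_fun [set: Omega] (fun w => (4 + 2 ^+ b)%:E
   + path_majorant xi tau m s (J * m) b.-1 w)%E by exact: emeasurable_funD.
have mp2 : measurable_fun [set: Omega] (fun w => (4 + 2 ^+ b)%:E
   + path_majorant xi tau m s (J * m) b.-1 w
   + path_majorant xi tau m s (J * m) c.-1 w)%E by exact: emeasurable_funD.
have m3 : measurable_fun [set: Omega] (fun w => (4 + 2 ^+ b)%:E
   + path_majorant xi tau m s (J * m) b.-1 w
   + path_majorant xi tau m s (J * m) c.-1 w
   + (2 ^+ q)%:E * (2%:E * brownian_sup W T q w))%E by exact: emeasurable_funD.
have m1 : measurable_fun [set: Omega] (fun w => 1%:E + init_sup xi tau a.+1 w)%E.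
  exact: emeasurable_funD.
have D0 : (0 <= D%:E)%E by rewrite lee_fin.
have e1 w : (0 <= 1%:E + init_sup xi tau a.+1 w)%E by rewrite adde_ge0.
have e2 w := adde_ge0 k0 (p1 w).
have e3 w := adde_ge0 (e2 w) (p2 w).
have e4 w := adde_ge0 (e3 w) (qB0 w).
rewrite /approx_majorant ge0_integralD//; last 2 first.
- by move=> w _; rewrite mule_ge0.
- exact: measurable_funeM.
rewrite ge0_integralZl// [in leRHS]EFinD; apply: leeD.
  by rewrite ge0_integralD// integral_prob_cst [in leRHS]EFinD leeD2l.
rewrite [in leRHS]EFinM lee_wpmul2l// ge0_integralD// [in leRHS]EFinD; apply: leeD; last first.
  rewrite ge0_integralZl//; [|exact: measurable_funeM|by move=> w _; rewrite mule_ge0].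
  by rewrite ge0_integralZl// ![in leRHS]EFinM lee_wpmul2l// lee_wpmul2l.
rewrite ge0_integralD// [in leRHS]EFinD; apply: leeD => //.
by rewrite ge0_integralD// integral_prob_cst [in leRHS]EFinD leeD2l.
Qed.

End majorant.

Lemma approx_sup_moment (p : R) : 0 < p -> exists K : R,
  forall (m : nat) (h : R) (s : int -> Omega -> R) (S : R -> Omega -> R),
  (0 < m)%N -> h = tau / m%:R -> h < 1 ->
  is_bim lambda mu sigma gamma delta C0 C2 eps W Nt xi h m s ->
  is_bim_approx lambda mu sigma gamma delta C0 C2 eps W Nt xi h m tau s S ->
  (\int[P]_w sup_pow S (- tau) T p w <= K%:E)%E.
Proof.
move=> p0; pose a := Num.truncn p; pose J := (Num.truncn (T / tau)).+1.
pose b := (3 * a.+1)%N; pose c := (delay_exp gamma * b)%N.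
(* The exponent a + 1 is an integer above p. *)
have [I hI] := init_sup_moment htau hxi (isT : 0 < a.+1)%N.
have [K1 hK1] := path_majorant_moment_bound hbeta hgamma hlambda hmu hsigma htau
  hdelta hC0 hC2 heps hF hW hN hxi J b.-1.
have [K2 hK2] := path_majorant_moment_bound hbeta hgamma hlambda hmu hsigma htau
  hdelta hC0 hC2 heps hF hW hN hxi J c.-1.
have [B hB] := brownian_sup_moment hF hW hT (leq_addl b 3).
eexists=> m h s S m0 hE h1 hs hS.
have maj := approx_majorant_moment m0 hE hs hI (hK1 m h s m0 hE h1 hs)
  (hK2 m h s m0 hE h1 hs) hB.
apply: le_trans maj.
have tT : - tau <= - tau <= T.
  by rewrite lexx/= (@le_trans _ _ 0)// ?oppr_le0 ltW.
apply: ge0_le_integral_ae.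
- exact: (measurable_approx_majorant m0 hE hs).
- move=> w; apply: (@le_trans _ _ (`|S (- tau) w| `^ p)%:E).
    by rewrite lee_fin powR_ge0.
  by apply: ereal_sup_ubound; exists (- tau) => //=; rewrite in_itv.
- exact: approx_majorant_ge0.
have q0 : (0 < (b + 3).*2)%N by rewrite addn3.
move: (pp_mono hN) (ae_brownian_le_sup hW hT q0); apply: filterS2.
move=> w Nmono hw.
apply: ge_ereal_sup => _ [t /= ht <-]; rewrite in_itv/= in ht.
apply: le_trans (approx_le_majorant m0 hE h1 hs hS Nmono hw ht).
rewrite lee_fin; apply: powR_le1D_exprn => //; first exact: ltW.
exact/ltW/truncnS_gt.
Qed.

End approximation.

(** * Lyapunov inequality and conclusion *)

(** Hoelder's inequality for |X|^p and the constant 1, with exponent r / p. *)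
Lemma lyapunov {R : realType} {d : measure_display} {T : measurableType d}
    (P : probability T R) (X : T -> R) (p r : R) :
  measurable_fun [set: T] X -> 0 < p -> p < r ->
  ('E_P[fun w => (`|X w| `^ p)%R] <= 'E_P[fun w => (`|X w| `^ r)%R] `^ (p / r))%E.
Proof.
move=> mX p0 pr; have r0 := lt_trans p0 pr.
have a1 : 0 < r / p by rewrite divr_gt0.
have pr1 : p / r < 1 by rewrite ltr_pdivrMr// mul1r.
have b0 : 0 < (1 - p / r)^-1 by rewrite invr_gt0 subr_gt0.
have e1 : (r / p)^-1 + (1 - p / r)^-1^-1 = 1 by rewrite invrK invf_div; ring.
have mXp : measurable_fun [set: T] (fun w => `|X w| `^ p).
  by apply: (measurableT_comp (measurable_powR p)); exact: measurableT_comp.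
have := hoelder P mXp (measurable_cst (1 : R)) a1 b0 e1.
rewrite Lnorm1 (_ : EFin \o cst 1 = cst 1%E)// Lnorm_cst1.
rewrite [X in (_ <= _ * X)%E -> _](_ : _ = 1%E); last first.
  rewrite -[RHS](poweR1r (1 - p / r)^-1^-1); congr (_ `^ _)%E.
  exact: probability_setT.
rewrite mule1.
rewrite hoelder.Lnorm.unlock expectation.unlock /= invf_div.
under eq_integral do rewrite mulr1 ger0_norm ?powR_ge0//.
move=> /le_trans; apply.
under eq_integral do rewrite ger0_norm ?powR_ge0// -powRrM mulrCA divff ?gt_eqF// mulr1.
by [].
Qed.

Section approximation_measurable.
Context {R : realType} {d : measure_display} {Omega : measurableType d}.
Variables (P : probability Omega R) (F : R -> set (set Omega)).
Variables (W : R -> Omega -> R) (N : R -> Omega -> nat) (xi : R -> Omega -> R).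
Variables (beta gamma lambda mu sigma tau delta C0 C2 eps : R).
Hypotheses (hsigma : 0 < sigma) (htau : 0 < tau).
Hypotheses (hC0 : 0 < C0) (hC2 : 0 < C2).
Hypotheses (hF : usual_filtration P F) (hW : brownian_motion P F W).
Hypothesis hN : poisson_process P F beta N.
Hypothesis hxi : initial_segment P (F 0) tau xi.

Let Nt := compensated beta N.
Variable T : R.

Lemma measurable_approx (m : nat) (h : R) (s : int -> Omega -> R)
    (S : R -> Omega -> R) (t : R) :
  (0 < m)%N -> h = tau / m%:R ->
  is_bim lambda mu sigma gamma delta C0 C2 eps W Nt xi h m s ->
  is_bim_approx lambda mu sigma gamma delta C0 C2 eps W Nt xi h m tau s S ->
  - tau <= t <= T -> measurable_fun [set: Omega] (S t).
Proof.
move=> m0 hE hs hS /andP[t1 tT]; have [t0|t0] := leP t 0.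
  have ht : - tau <= t <= 0 by rewrite t1.
  rewrite (funext (fun w => approx_init hS w ht)).
  exact: measurable_init hF hxi _ ht.
have [k _ tk] := mesh_index htau m0 hE (ltW t0) tT.
have h0 := step_gt0 htau m0 hE.
have k0 := mesh_ge0 htau m0 hE k; have k1 := mesh_ge0 htau m0 hE k.+1.
have ms i : measurable_fun [set: Omega] (shifted m s i).
  apply: measurable_wrtT (shifted_adapted hsigma htau hC0 hC2 hF hW hN hxi m0 hE hs
    (leq_addl m i)).
  exact: (filtration_sub hF (mesh_ge0 htau m0 hE i)).
have mW u : 0 <= u -> measurable_fun [set: Omega] (W u).
  move=> u0; exact: (measurable_brownian hF hW u0).
have mN u : 0 <= u -> measurable_fun [set: Omega] (Nt u).
  move=> u0; exact: (measurable_compensated hF hN u0).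
have -> : S t = fun w => shifted m s (m + k) w
    + (lambda * (mu - shifted m s (m + k) w) * (t - mesh h k%:Z)
       + sigma * `|shifted m s k w| `^ gamma * Num.sqrt `|shifted m s (m + k) w|
           * (W t w - W (mesh h k%:Z) w)
       + delta * shifted m s (m + k) w * (Nt t w - Nt (mesh h k%:Z) w))
      / bim_den gamma sigma C0 C2 eps h (shifted m s (m + k) w) (shifted m s k w)
         (W (mesh h k.+1%:Z) w - W (mesh h k%:Z) w)
         (Nt (mesh h k.+1%:Z) w - Nt (mesh h k%:Z) w).
  apply/funext => w; rewrite (approx_step hS w tk) /bim_C !(shifted_mesh m).
  by [].
have md (Z : R -> Omega -> R) u v :
   measurable_fun [set: Omega] (Z u) -> measurable_fun [set: Omega] (Z v) ->
   measurable_fun [set: Omega] (fun w => Z u w - Z v w :> R).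
  by move=> mu1 mv1; exact: measurable_funB.
have t0' := ltW t0.
have e1 := md W _ _ (mW _ k1) (mW _ k0).
have e2 := md Nt _ _ (mN _ k1) (mN _ k0).
have e3 := md W _ _ (mW _ t0') (mW _ k0).
have e4 := md Nt _ _ (mN _ t0') (mN _ k0).
exact: (measurable_bim_increment gamma lambda mu delta eps hsigma htau hC0 hC2
  m0 hE (ms (m + k)%N) (ms k) e1 e2 (t - mesh h k%:Z) e3 e4).
Qed.

End approximation_measurable.

Unset Implicit Arguments.

Theorem theorem2p4 (R : realType) (d : measure_display)
  (Omega : measurableType d) (P : probability Omega R)
  (F : R -> set (set Omega)) (W : R -> Omega -> R) (N : R -> Omega -> nat)
  (xi : R -> Omega -> R)
  (beta gamma lambda mu sigma tau delta C0 C2 eps T : R)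
  (hbeta : 0 < beta) (hgamma : 0 < gamma) (hlambda : 0 < lambda)
  (hmu : 0 < mu) (hsigma : 0 < sigma) (htau : 0 < tau) (hdelta : 0 <= delta)
  (hC0 : 0 < C0) (hC0lambda : lambda <= C0)
  (hC2 : 0 < C2) (hC2delta : delta <= C2)
  (heps : 0 < eps) (hT : 0 < T)
  (hF : usual_filtration P F)
  (hW : brownian_motion P F W) (hN : poisson_process P F beta N)
  (hxi : initial_segment P (F 0) tau xi) :
  exists K1 : R -> R,
    forall (m : nat) (h : R) (s : int -> Omega -> R) (S : R -> Omega -> R),
      (0 < m)%N -> h = tau / m%:R -> h < 1 ->
      is_bim lambda mu sigma gamma delta C0 C2 eps W (compensated beta N)
        xi h m s ->
      is_bim_approx lambda mu sigma gamma delta C0 C2 eps W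
        (compensated beta N) xi h m tau s S ->
      (forall p : R, 2 < p ->
        (\int[P]_w sup_pow S (- tau) T p w <= (K1 p)%:E)%E) /\
      (forall p t : R, 0 < p <= 2 -> - tau <= t <= T ->
        ('E_P[(fun w => `|S t w| `^ p)%R]
           <= 'E_P[(fun w => `|S t w| `^ 3)%R] `^ (p / 3)
         /\ 'E_P[(fun w => `|S t w| `^ 3)%R] `^ (p / 3)
           <= ((K1 3 `^ (p / 3))%R)%:E)%E).
Proof.
have moment (p : R) : exists K : R, 0 < p ->
    forall (m : nat) (h : R) (s : int -> Omega -> R) (S : R -> Omega -> R),
    (0 < m)%N -> h = tau / m%:R -> h < 1 ->
    is_bim lambda mu sigma gamma delta C0 C2 eps W (compensated beta N) xi h m s ->
    is_bim_approx lambda mu sigma gamma delta C0 C2 eps W (compensated beta N)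
      xi h m tau s S ->
    (\int[P]_w sup_pow S (- tau) T p w <= K%:E)%E.
  have [p0|] := ltP 0 p; last by exists 0.
  have [K hK] := approx_sup_moment hbeta hgamma hlambda hmu hsigma htau hdelta
    hC0 hC2 hC2delta heps hF hW hN hxi hT p0.
  by exists K.
(* The order p is fixed before h; choice turns the constants into a function. *)
have [K1 hK1] := choice moment.
exists K1 => m h s S m0 hE h1 hs hS; split=> [p p2|p t /andP[p0 p2] ht].
  have p0 : 0 < p by lra.
  exact: hK1 p p0 m h s S m0 hE h1 hs hS.
have mS := measurable_approx hsigma htau hC0 hC2 hF hW hN hxi m0 hE hs hS ht.
have p3 : p < 3 by lra.
split; first exact: lyapunov.
have k0 : (0 <= 'E_P[(fun w => `|S t w| `^ 3)%R])%E.
  by rewrite expectation.unlock integral_ge0// => w _; rewrite lee_fin powR_ge0.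
have kK : ('E_P[(fun w => `|S t w| `^ 3)%R] <= (K1 3)%:E)%E.
  apply: le_trans (hK1 3 _ m h s S m0 hE h1 hs hS) => //.
  rewrite expectation.unlock; apply: ge0_le_integral_pw.
    by move=> w; rewrite lee_fin powR_ge0.
  by move=> w; apply: ereal_sup_ubound; exists t => //=; rewrite in_itv.
rewrite -poweR_EFin; apply: gt0_ler_poweR => //.
- by rewrite divr_ge0// ltW.
- by rewrite in_itv/= k0 leey.
- by rewrite in_itv/= (le_trans k0 kK) leey.
Qed.
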